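(* Let $\epsilon>0$ be a constant. For any fixed sketching matrix $\Phi\in\mathbb{R}^{k\times\binom n2}$ with $k\le n^{1/20-\epsilon}$, we have $$\mathbb{E}_\pi\Big[d_{\mathrm{TV}}\big((\Phi B^w)_{\pi,\mathrm{yes}},(\Phi B^w)_{\pi,\mathrm{no}}\big)\Big]\le o(1).$$
   Context: Hard distribution on $n$-vertex weighted graphs ($n$ even; $s=n^{1/5}$, $\ell=n^{4/5}$): choose a uniformly random permutation $\pi$ of $\{1,\dots,n\}$. For $0\le i<\ell$ the $i$-th block is $\{\pi(si+1),\dots,\pi(si+s)\}$ (indices mod $\ell$). Non-crossing edges: all pairs within a block and all pairs between blocks $i$ and $i+1$; their weights are i.i.d. $\mathcal N(8n^{2/5}, n^{4/5}/\log n)$. With probability $1/2$ the crossing edge $\{\pi(1),\pi(n/2+1)\}$ is added with weight $\mathcal N(0,1)$. Fix an orientation of all edge slots; $B^w\in\mathbb{R}^{\binom n2\times n}$ has $B^w_{eu}=w_e$ if $e$ is present and $u$ is its head, $-w_e$ if $u$ is its tail, $0$ otherwise. $(\Phi B^w)_{\pi,\mathrm{yes}}$ (resp. $\mathrm{no}$) denotes the distribution of $\Phi B^w$ conditioned on the permutation being $\pi$ and the crossing edge being present (resp. absent); $d_{\mathrm{TV}}$ is total variation distance, and the expectation is over the uniformly random $\pi$. *)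

(* Defs.v *)
From HB Require Import structures.
From mathcomp Require Import all_boot all_order all_algebra perm.
From mathcomp Require Import all_classical all_reals all_analysis.

Set Implicit Arguments.
Unset Strict Implicit.
Unset Printing Implicit Defensive.

Import Order.TTheory GRing.Theory Num.Theory.
Import numFieldNormedType.Exports.

Local Open Scope classical_set_scope.
Local Open Scope ring_scope.

HB.instance Definition _ (T : finType) := isPointed.Build (perm_type T) (perm_one T).
HB.instance Definition _ (T : finType) := @isMeasurable.Build default_measure_display
  (perm_type T) discrete_measurable discrete_measurable0
  discrete_measurableC discrete_measurableU.

(* Matrices carry the product sigma-algebra, generated by the entries; for real
   entries this is the Borel sigma-algebra. *)
Definition measure_matrix_display : measure_display -> measure_display.
Proof. exact. Qed.

Section measurable_matrix.
Context {d} {T : sigmaRingType d} {m n : nat}.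

Definition matrix_measurable : set (set 'M[T]_(m, n)) :=
  <<s \bigcup_(ij in [set: 'I_m * 'I_n])
        preimage_set_system setT (fun M : 'M[T]_(m, n) => M ij.1 ij.2) measurable >>.

Let matrix_set0 : matrix_measurable set0.
Proof. exact: sigma_algebra0. Qed.

Let matrix_setC A : matrix_measurable A -> matrix_measurable (~` A).
Proof. exact: sigma_algebraC. Qed.

Let matrix_bigcup (F : (set 'M[T]_(m, n))^nat) :
  (forall i, matrix_measurable (F i)) -> matrix_measurable (\bigcup_i F i).
Proof. exact: sigma_algebra_bigcup. Qed.

HB.instance Definition _ := @isMeasurable.Build (measure_matrix_display d)
  'M[T]_(m, n) matrix_measurable matrix_set0 matrix_setC matrix_bigcup.
End measurable_matrix.

Section conditioning_and_total_variation.
Context d (T : measurableType d) (R : realType).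
Local Open Scope ereal_scope.

Definition cond_prob (P : set T -> \bar R) (E : set T) : set T -> \bar R :=
  fun A => P (A `&` E) / P E.

Definition tv_distance (mu nu : set T -> \bar R) : \bar R :=
  ereal_sup [set `|mu A - nu A| | A in measurable].

End conditioning_and_total_variation.

Section hard_distribution.
Variables (n s l : nat).

(* The edge slots are numbered by 'I_('C(n, 2)) in an arbitrary way; slot e is
   the pair {tl e, hd e}, oriented from its tail to its head. *)
Definition edge_orientation (tl hd : 'I_('C(n, 2)) -> 'I_n) : Prop :=
  (forall e, tl e != hd e) /\
  (forall u v : 'I_n, u != v ->
     exists! e, [set tl e; hd e]%SET = [set u; v]%SET).

Variables (tl hd : 'I_('C(n, 2)) -> 'I_n).
Implicit Types (p : 'S_n) (e : 'I_('C(n, 2))).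

(* Vertices and positions are numbered from 0, so that position j here is
   position j + 1 in 1-based numbering. *)
Definition block p (i : nat) : {set 'I_n} :=
  [set p j | j : 'I_n & (s * i <= j < s * i + s)%N]%SET.

Definition non_crossing p e : bool :=
  [exists i : 'I_l,
    [|| (tl e \in block p i) && (hd e \in block p i),
        (tl e \in block p i) && (hd e \in block p (i.+1 %% l))
      | (hd e \in block p i) && (tl e \in block p (i.+1 %% l))]].

Definition crossing p e : bool :=
  [exists i : 'I_n, exists j : 'I_n,
    [&& val i == 0%N, val j == n./2 & [set tl e; hd e]%SET == [set p i; p j]%SET]].

Definition present p (b : bool) e : bool :=
  non_crossing p e || b && crossing p e.

Section weights.
Variable R : realType.

(* The second argument of normal_prob is the standard deviation, whereas the
   second parameter of N(8 n^(2/5), n^(4/5) / log n) is the variance. *)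
Definition weight_law p e : set (measurableTypeR R) -> \bar R :=
  if crossing p e then normal_prob 0 1
  else normal_prob (8 * n%:R `^ (2 / 5)) (Num.sqrt (n%:R `^ (4 / 5) / ln n%:R)).

Definition weighted_incidence p (b : bool) (w : 'I_('C(n, 2)) -> R) :
    'M[R]_('C(n, 2), n) :=
  \matrix_(e, u)
    if present p b e then
      if u == hd e then w e else if u == tl e then - w e else 0
    else 0.

Section random_graph.
Context d (Omega : measurableType d) (P : probability Omega R).
Variables (pi : {RV P >-> 'S_n}) (yes : {RV P >-> bool}).
Variable W : 'I_('C(n, 2)) -> {RV P >-> measurableTypeR R}.

Definition given p (b : bool) : set Omega :=
  [set x | pi x = p /\ yes x = b].

(* The values of W e on the event that slot e is absent are irrelevant. *)
Record hard_distribution : Prop := {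
  uniform_permutation : forall p, P [set x | pi x = p] = (n`!%:R^-1)%:E ;
  crossing_coin : forall p,
    cond_prob P [set x | pi x = p] [set x | yes x] = (2^-1)%:E ;
  independent_weights : forall p b (A : 'I_('C(n, 2)) -> set (measurableTypeR R)),
    (forall e, measurable (A e)) ->
    cond_prob P (given p b) [set x | forall e, present p b e -> A e (W e x)] =
    (\prod_(e | present p b e) weight_law p e (A e))%E }.

Definition sketch k (Phi : 'M[R]_(k, 'C(n, 2))) (x : Omega) : 'M[R]_(k, n) :=
  Phi *m weighted_incidence (pi x) (yes x) (fun e => W e x).

Definition sketch_law k (Phi : 'M[R]_(k, 'C(n, 2))) p (b : bool) :
    set 'M[measurableTypeR R]_(k, n) -> \bar R :=
  pushforward (cond_prob P (given p b)) (sketch Phi).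

End random_graph.
End weights.
End hard_distribution.

(* Main.v *)
(* Let b_e be the sketch of slot e with unit weight, so that the sketch is the sum
   of the w_e b_e over the present slots. If b_c = sum f_e b_e for the crossing
   slot c, with e ranging over the non-crossing slots, then adding the crossing
   edge with weight t has the same effect as shifting the means of the w_e by
   t f_e, and the chi-square divergence between normal vectors of variance
   sigma^2 shows that the total variation distance is
   O(sqrt (sum f_e^2) / sigma).

   By duality, a flow f with sum f_e^2 <= r exists when <b_c, X>^2 is at most r
   times the sum of the <b_e, X>^2, for every potential X. Inside a vertex set S
   take the largest slot weights at most 1 for which every slot has leverage at
   most kappa: as the leverages add up to at most k #|S|, few slots have weight
   less than 1. The trace of (G^-1 G_x)^2, where G is the Gram matrix of the
   weighted slots and G_x its part at the vertex x, exceeds k by little for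
   most x; this yields that for most pairs x, y of S the value of X at x can be
   recomputed from the values of X outside x and y, at a cost that is at most the
   energy of X away from x and y.

   Cut every block into groups. For most permutations there is one group in each
   block on the way from one end x of the crossing slot to the other end y, such
   that any two consecutive groups together with x and y form a set S that is
   good for x and y: a family of groups without such a chain contains a matching
   of bad pairs of groups, and that is unlikely. Recomputing X at x from
   consecutive pairs of groups transports the value at x to the value at y, and
   every step is paid for by the energy of the slots near two blocks, times
   kappa. With s = t^8 and kappa = t^-4, the flow has energy O(kappa l). *)

Require Import Defs.
From mathcomp Require Import all_boot all_order all_algebra perm.
From mathcomp Require Import ring lra zify.
From mathcomp Require Import all_classical all_reals all_analysis measurable_realfun.

Set Implicit Arguments.
Unset Strict Implicit.
Unset Printing Implicit Defensive.

Import Order.TTheory GRing.Theory Num.Theory.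
Local Open Scope ring_scope.

(** * Leverages and the removal of a vertex *)

(** Potentials on S form a space of dimension k #|S|, while S spans about #|S|^2 / 2 slots, so a
    typical slot is nearly redundant; all bounds grow out of this gap. The crossing slot itself is
    never available. Hence y is removed before x, so that the value recomputed at x uses neither y
    nor that slot. Maximal weights, rather than the weights of one particular system, are needed
    because they grow with S: two recomputations from overlapping pairs of groups can then be
    compared inside their common group.

    Cauchy-Schwarz along the chain costs a factor of the order of l, every link gains kappa, and a
    slot serves at most two links; hence the order kappa l. As the variance is l / ln n, what must
    vanish is kappa ln n. Two densities of failures must vanish as well: kappa k for the removals
    and k / (kappa s) for the light slots. With k <= t^2 and s = t^8 the choice kappa = t^-4 makes
    both of order t^-2.

    The term in eta only makes the Gram matrices invertible. It is disposed of at the end: there are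
    finitely many permutations, so one small eta serves all of them. *)

Section star_trace.
Variables (R : realFieldType) (N k : nat) (F V : finType).

Lemma mxtrace_gram (K : 'M[R]_N) (a : F -> 'rV[R]_N) (A B : pred F) :
  K^T = K ->
  \tr (K *m (\sum_(f | A f) (a f)^T *m a f) *m K
         *m (\sum_(f | B f) (a f)^T *m a f)) =
  \sum_(f | A f) \sum_(g | B g) (a f *m K *m (a g)^T) 0 0 ^+ 2.
Proof.
move=> sK; rewrite [K *m _]mulmx_sumr !mulmx_suml raddf_sum.
apply: eq_bigr => f _ /=.
rewrite mulmx_sumr raddf_sum; apply: eq_bigr => g _ /=.
have -> : K *m ((a f)^T *m a f) *m K *m ((a g)^T *m a g) =
    (K *m (a f)^T) *m (a f *m K *m (a g)^T *m a g) by rewrite !mulmxA.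
rewrite mxtrace_mulC -(mulmxA _ (a g)) /mxtrace big_ord1 mxE big_ord1 expr2.
congr (_ * _).
by rewrite -[in LHS](trmxK (a g)) -{1}sK -!trmx_mul mxE.
Qed.

Variables (v : F -> 'rV[R]_N).
Let G := \sum_f (v f)^T *m v f.
Hypothesis G_unit : G \in unitmx.
Let H := invmx G.

Let gram_sym (A : pred F) :
  (\sum_(f | A f) (v f)^T *m v f)^T = \sum_(f | A f) (v f)^T *m v f.
Proof. by rewrite raddf_sum; apply: eq_bigr => f _ /=; rewrite trmx_mul trmxK. Qed.

Let H_sym : H^T = H.
Proof. by rewrite /H trmx_inv gram_sym. Qed.

Let mxtrace_HQHQ_ge0 (Q : 'M[R]_N) : Q^T = Q -> 0 <= \tr (H *m Q *m H *m Q).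
Proof.
move=> sQ.
(* [H = H G H] is a Gram matrix as well, which turns the trace into a sum of squares. *)
have HE : H = \sum_f (v f *m H)^T *m (v f *m H).
  under eq_bigr => f _ do rewrite trmx_mul H_sym -mulmxA (mulmxA (v f)^T).
  by rewrite -mulmx_sumr -mulmx_suml -/G mulmxA mulVmx// mul1mx.
have -> : \tr (H *m Q *m H *m Q) = \tr (Q *m H *m Q *m H).
  by rewrite -!mulmxA mxtrace_mulC -!mulmxA.
rewrite HE mxtrace_gram//; apply: sumr_ge0 => f _; apply: sumr_ge0 => g _.
exact: sqr_ge0.
Qed.

(* The k eigenvectors of H S with eigenvalue 1 spanned by E are split off from
   tr (H S H S); what remains bounds the squares of the other eigenvalues. *)
Lemma star_energy_le (t : R) (star : pred F) (E : 'M[R]_(N, k)) (X : 'cV[R]_N)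
    (S := \sum_(f | star f) (v f)^T *m v f) (q := (X^T *m S *m X) 0 0)
    (e := (X^T *m G *m X) 0 0) :
  (forall f, ~~ star f -> v f *m E = 0) ->
  E^T *m G *m E \in unitmx -> E^T *m G *m X = 0 ->
  2 * t * q <= \tr (H *m S *m H *m S) - k%:R + t ^+ 2 * e ^+ 2.
Proof.
move=> vE gU EX.
have SE : S *m E = G *m E.
  rewrite /S /G !mulmx_suml [RHS](bigID star)/=.
  rewrite [X in _ = _ + X]big1 ?addr0// => f nf.
  by rewrite -mulmxA vE// mulmx0.
have ET_S : E^T *m S = E^T *m G.
  by apply: trmx_inj; rewrite !trmx_mul !trmxK !gram_sym SE.
set g := E^T *m G *m E in gU.
(* For the form [b] below, [P] carries the eigenvalue 1 of [H *m S] on the span of [E], and [D] the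
   direction of [X]. The claim is [0 <= b Q Q] at [Q = S - P - t *: D], expanded. *)
set P := G *m E *m invmx g *m E^T *m G.
set D := G *m X *m X^T *m G.
have sg : g^T = g by rewrite /g !trmx_mul trmxK gram_sym mulmxA.
have sP : P^T = P.
  by rewrite /P !trmx_mul !trmxK gram_sym trmx_inv sg !mulmxA.
have sD : D^T = D by rewrite /D !trmx_mul !trmxK gram_sym !mulmxA.
pose b (A B : 'M[R]_N) := \tr (H *m A *m H *m B).
have bC A B : b A B = b B A.
  by rewrite /b -(mulmxA (H *m A)) mxtrace_mulC mulmxA.
have HP : H *m P = E *m invmx g *m E^T *m G.
  by rewrite /P !mulmxA mulVmx// mul1mx.
have HD : H *m D = X *m X^T *m G by rewrite /D !mulmxA mulVmx// mul1mx.
have trk : \tr (E *m invmx g *m E^T *m G) = k%:R.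
  rewrite -!mulmxA mxtrace_mulC -!mulmxA (mulmxA E^T G E) -/g mulVmx//.
  by rewrite mxtrace1.
have HSE : H *m S *m E = E by rewrite -mulmxA SE mulmxA mulVmx// mul1mx.
have bSP : b S P = k%:R.
  by rewrite /b -(mulmxA (H *m S)) HP !mulmxA HSE.
have bPP : b P P = k%:R.
  rewrite /b -(mulmxA (H *m P)) HP.
  have -> : E *m invmx g *m E^T *m G *m (E *m invmx g *m E^T *m G) =
      E *m invmx g *m g *m invmx g *m E^T *m G by rewrite /g !mulmxA.
  by rewrite mulmxKV//.
have bPD : b P D = 0.
  rewrite /b -(mulmxA (H *m P)) HP HD.
  have -> : E *m invmx g *m E^T *m G *m (X *m X^T *m G) =
      E *m invmx g *m (E^T *m G *m X) *m X^T *m G by rewrite !mulmxA.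
  by rewrite EX mulmx0 !mul0mx mxtrace0.
have tr00 (A : 'M[R]_1) : \tr A = A 0 0 by rewrite /mxtrace big_ord1.
have bSD : b S D = q.
  rewrite /b -(mulmxA (H *m S)) HD.
  have -> : H *m S *m (X *m X^T *m G) = H *m S *m X *m (X^T *m G).
    by rewrite !mulmxA.
  by rewrite mxtrace_mulC !mulmxA (mulmxK G_unit) tr00.
have bDD : b D D = e ^+ 2.
  rewrite /b -(mulmxA (H *m D)) HD.
  have -> : X *m X^T *m G *m (X *m X^T *m G) = X *m (X^T *m G *m X *m (X^T *m G)).
    by rewrite !mulmxA.
  rewrite mxtrace_mulC -(mulmxA (X^T *m G *m X)) tr00 mxE big_ord1 expr2.
  by rewrite /e.
have /mxtrace_HQHQ_ge0 : (S - P - t *: D)^T = S - P - t *: D.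
  by rewrite !linearB/= linearZ/= gram_sym sP sD.
suff -> : \tr (H *m (S - P - t *: D) *m H *m (S - P - t *: D)) =
   b S S + b P P + t ^+ 2 * b D D - b S P - b P S - t * b S D - t * b D S
     + t * b P D + t * b D P.
  by rewrite (bC P S) (bC D S) (bC D P) bSP bPP bPD bSD bDD -/(b S S); lra.
rewrite /b !(mulmxBr, mulmxBl) -!(scalemxAr, scalemxAl) !(raddfB, raddfD)/=.
by rewrite -?(scalemxAr, scalemxAl) ?linearZ/= ?linearZ/=; ring.
Qed.

(** Over all pairs of rows the squares (v_f H v_g)^2 add up to tr (H G H G) = N. The star traces
    together count a pair of distinct rows at most once and a diagonal pair at most twice, the
    second time only for [isE]; the excess over N is therefore a sum of squared leverages. *)
Lemma sum_star_trace_le (star : V -> pred F) (isE : pred F) :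
  (#|V| * k = N)%N ->
  (forall f g, f != g -> #|[pred x | star x f && star x g]| <= 1)%N ->
  (forall f, #|[pred x | star x f]| <= 1 + isE f)%N ->
  \sum_x (\tr (H *m (\sum_(f | star x f) (v f)^T *m v f)
            *m H *m (\sum_(f | star x f) (v f)^T *m v f)) - k%:R)
  <= \sum_(f | isE f) (v f *m H *m (v f)^T) 0 0 ^+ 2.
Proof.
move=> VN fg ff.
under eq_bigr => x _ do rewrite (mxtrace_gram _ _ _ H_sym).
rewrite sumrB sumr_const -mulrnA mulnC VN.
have NE : N%:R = \sum_f \sum_g (v f *m H *m (v g)^T) 0 0 ^+ 2.
  by rewrite -(mxtrace_gram v predT predT H_sym) -/G mulVmx// mul1mx mulVmx// mxtrace1.
rewrite lerBlDr NE.
under eq_bigr => x _ do under eq_bigr => f _ do rewrite big_mkcond.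
under eq_bigr => x _ do rewrite big_mkcond.
rewrite exchange_big/= [X in _ <= X + _]big_mkcond/= -big_split/=.
apply: ler_sum => f _.
under eq_bigr => x _ do rewrite (fun_if (fun z : R => z)).
have -> : \sum_x (if star x f then
     \sum_g (if star x g then (v f *m H *m (v g)^T) 0 0 ^+ 2 else 0) else 0) =
   \sum_g (v f *m H *m (v g)^T) 0 0 ^+ 2 *+ #|[pred x | star x f && star x g]|.
  rewrite (eq_bigr (fun x => \sum_g
     (if star x f && star x g then (v f *m H *m (v g)^T) 0 0 ^+ 2 else 0))).
    rewrite exchange_big/=; apply: eq_bigr => g _.
    by rewrite -big_mkcond/= sumr_const.
  by move=> x _; case: (star x f) => //=; rewrite big1.
rewrite (bigD1 f)//= [X in _ <= _ + X](bigD1 f)//= addrA.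
apply: lerD.
  have -> : #|[pred x | star x f && star x f]| = #|[pred x | star x f]|.
    by apply: eq_card => x; rewrite !inE andbb.
  have := ff f; case: (isE f) => /= h.
    by rewrite -mulr2n ler_wpMn2l// sqr_ge0.
  by rewrite add0r -[leRHS]mulr1n ler_wpMn2l// sqr_ge0.
apply: ler_sum => g gf; rewrite -[leRHS]mulr1n ler_wpMn2l ?sqr_ge0// fg// eq_sym//.
Qed.

End star_trace.

(** * Potentials, leverages and maximal slot weights *)

Section weighted_graph.
Variables (R : realType) (k n : nat) (E : finType).
Variables (tl hd : E -> 'I_n) (Phi : 'I_k -> E -> R).
Hypothesis slot_inj : forall e e',
  [set tl e; hd e]%SET = [set tl e'; hd e']%SET -> e = e'.

(** The pairing of the unit-weight sketch of [e] with a potential [X], which gives every vertex a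
    vector of k coordinates. *)
Definition drop (e : E) (X : 'M[R]_(k, n)) : R :=
  \sum_i Phi i e * (X i (hd e) - X i (tl e)).

Definition slot_row (e : E) : 'rV[R]_(k * n) :=
  mxvec (\matrix_(i, u) (Phi i e * ((u == hd e)%:R - (u == tl e)%:R))).

Lemma dot_mxvec (A B : 'M[R]_(k, n)) :
  (mxvec A *m (mxvec B)^T) 0 0 = \sum_i \sum_u A i u * B i u.
Proof.
rewrite mxE (reindex _ (curry_mxvec_bij k n))/=.
rewrite pair_bigA/=; apply: eq_bigr => -[i u] _ /=.
by rewrite mxE !mxvecE.
Qed.

Lemma slot_rowE e X : (slot_row e *m (mxvec X)^T) 0 0 = drop e X.
Proof.
rewrite dot_mxvec; apply: eq_bigr => i _.
under eq_bigr => u _ do rewrite mxE -mulrA mulrBl.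
rewrite -mulr_sumr sumrB; congr (_ * (_ - _)).
  rewrite (bigD1 (hd e))//= eqxx mul1r big1 ?addr0// => u /negPf ->.
  by rewrite mul0r.
rewrite (bigD1 (tl e))//= eqxx mul1r big1 ?addr0// => u /negPf ->.
by rewrite mul0r.
Qed.

Definition incident (x : 'I_n) (e : E) := (tl e == x) || (hd e == x).

Variable eta : R.
Hypothesis eta0 : 0 < eta.

Definition sqnorm (X : 'M[R]_(k, n)) (u : 'I_n) : R := \sum_i X i u ^+ 2.

(* The term in eta grounds every vertex, so that the form is positive definite. *)
Definition energy (w : E -> R) (X : 'M[R]_(k, n)) : R :=
  \sum_e w e * drop e X ^+ 2 + eta * \sum_u sqnorm X u.

Section fixed_weights.
Variable w : E -> R.
Hypothesis w0 : forall e, 0 <= w e.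

(** The grounding enters as additional rows, so that [energy] is the quadratic form of a single Gram
    matrix and the trace identities apply to it. *)
Definition gen_row (f : E + 'I_(k * n)) : 'rV[R]_(k * n) :=
  match f with
  | inl e => Num.sqrt (w e) *: slot_row e
  | inr j => Num.sqrt eta *: delta_mx 0 j
  end.

Let v := gen_row.
Let G := \sum_f (v f)^T *m v f.

Let quadE (A : pred (E + 'I_(k * n))) (x : 'rV[R]_(k * n)) :
  (x *m (\sum_(f | A f) (v f)^T *m v f) *m x^T) 0 0 =
  \sum_(e | A (inl e)) w e * drop e (vec_mx x) ^+ 2
  + eta * \sum_(j | A (inr j)) x 0 j ^+ 2.
Proof.
have quad1 f : (x *m ((v f)^T *m v f) *m x^T) 0 0 = (v f *m x^T) 0 0 ^+ 2.
  rewrite mulmxA -mulmxA mxE big_ord1 expr2; congr (_ * _).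
  by rewrite -[x in LHS]trmxK -trmx_mul mxE.
rewrite mulmx_sumr mulmx_suml summxE.
under eq_bigr => f _ do rewrite quad1.
rewrite big_sumType/=; congr (_ + _).
  apply: eq_bigr => e _.
  rewrite -scalemxAl mxE exprMn sqr_sqrtr//.
  by rewrite -[x in x^T]vec_mxK slot_rowE.
rewrite mulr_sumr; apply: eq_bigr => j _.
by rewrite -scalemxAl mxE exprMn sqr_sqrtr ?(ltW eta0)// -rowE !mxE.
Qed.

Let sum_coord (x : 'rV[R]_(k * n)) :
  \sum_j x 0 j ^+ 2 = \sum_u sqnorm (vec_mx x) u.
Proof.
rewrite (reindex _ (curry_mxvec_bij k n))/= exchange_big pair_bigA/=.
by apply: eq_bigr => -[i u] _; rewrite mxE.
Qed.

Lemma gram_energy x : (x *m G *m x^T) 0 0 = energy w (vec_mx x).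
Proof. by rewrite /G (quadE predT) sum_coord. Qed.

Lemma energy_ge0 X : 0 <= energy w X.
Proof.
apply: addr_ge0.
  by apply: sumr_ge0 => e _; rewrite mulr_ge0 ?sqr_ge0.
rewrite mulr_ge0 ?(ltW eta0)//; apply: sumr_ge0 => u _.
by apply: sumr_ge0 => i _; rewrite sqr_ge0.
Qed.

Let G_def (x : 'rV[R]_(k * n)) : (x *m G *m x^T) 0 0 <= 0 -> x = 0.
Proof.
rewrite /G (quadE predT)/= => h.
have h1 : 0 <= \sum_e w e * drop e (vec_mx x) ^+ 2.
  by apply: sumr_ge0 => e _; rewrite mulr_ge0 ?sqr_ge0.
have h2 : \sum_j x 0 j ^+ 2 <= 0.
  by rewrite -(pmulr_rle0 _ eta0); lra.
apply/rowP => j; rewrite mxE; apply/eqP; rewrite -sqrf_eq0 eq_le sqr_ge0 andbT.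
apply: le_trans h2; rewrite (bigD1 j)//= lerDl; apply: sumr_ge0 => i _.
exact: sqr_ge0.
Qed.

Lemma gram_unit : G \in unitmx.
Proof.
rewrite -row_free_unit; apply: inj_row_free => x xG.
by apply: G_def; rewrite xG mul0mx mxE.
Qed.

Let H := invmx G.

Let G_sym : G^T = G.
Proof. by rewrite raddf_sum; apply: eq_bigr => f _ /=; rewrite trmx_mul trmxK. Qed.

Let quad_sym (x y : 'rV[R]_(k * n)) : (x *m G *m y^T) 0 0 = (y *m G *m x^T) 0 0.
Proof.
have -> : y *m G *m x^T = (x *m G *m y^T)^T.
  by rewrite !trmx_mul trmxK G_sym mulmxA.
by rewrite [RHS]mxE.
Qed.

Let quad_sub t (x y : 'rV[R]_(k * n)) : ((x - t *: y) *m G *m (x - t *: y)^T) 0 0 =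
  (x *m G *m x^T) 0 0 - 2 * t * (x *m G *m y^T) 0 0
  + t ^+ 2 * (y *m G *m y^T) 0 0.
Proof.
rewrite [_^T]linearB/= [(t *: y)^T]linearZ/= !(mulmxBl, mulmxBr).
rewrite -!(scalemxAl, scalemxAr).
have := quad_sym x y; move: (x *m G *m x^T) (x *m G *m y^T) (y *m G *m x^T).
by move: (y *m G *m y^T) => a b c d h; rewrite !mxE h; ring.
Qed.

Let H_sym : H^T = H. Proof. by rewrite /H trmx_inv G_sym. Qed.

Definition leverage (e : E) : R := (v (inl e) *m H *m (v (inl e))^T) 0 0.

Let quadH (x : 'rV[R]_(k * n)) :
  (x *m H *m x^T) 0 0 = energy w (vec_mx (x *m H)).
Proof.
rewrite -gram_energy trmx_mul H_sym !mulmxA (mulmxKV gram_unit)//.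
Qed.

Lemma leverage_ge0 e : 0 <= leverage e.
Proof. by rewrite /leverage quadH energy_ge0. Qed.

Let drop_leverage e : w e * drop e (vec_mx (slot_row e *m H)) = leverage e.
Proof.
rewrite /leverage /v /gen_row linearZ/= -!scalemxAl -scalemxAr scalerA -expr2.
rewrite sqr_sqrtr// mxE -slot_rowE vec_mxK trmx_mul H_sym mulmxA.
by [].
Qed.

Lemma quadH_ge0 (x : 'rV[R]_(k * n)) : 0 <= (x *m H *m x^T) 0 0.
Proof. by rewrite quadH energy_ge0. Qed.

Lemma leverageE e : leverage e = w e * (slot_row e *m H *m (slot_row e)^T) 0 0.
Proof.
rewrite /leverage /v /gen_row linearZ/= -!scalemxAl -scalemxAr scalerA -expr2.
by rewrite sqr_sqrtr// mxE.
Qed.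

(** The hypothesis is tested at the potential G^-1 b_e, where it reads w q^2 <= kappa q with q = b_e
    G^-1 b_e^T. *)
Lemma leverage_le e kappa :
  (forall X, w e * drop e X ^+ 2 <= kappa * energy w X) -> 0 <= kappa ->
  leverage e <= kappa.
Proof.
move=> /(_ (vec_mx (slot_row e *m H))) h kappa0.
move: h; rewrite -quadH.
have := drop_leverage e; rewrite leverageE.
set q := (_ *m _) 0 0; set z := drop _ _ => wzq.
have q0 : 0 <= q by rewrite /q quadH energy_ge0.
have [we0|we0] := eqVneq (w e) 0; first by rewrite we0 !mul0r => _.
have -> : z = q by apply: (mulfI we0).
have [->|qN0] := eqVneq q 0; first by rewrite !mulr0 => _.
by rewrite expr2 mulrA ler_pM2r// lt_def qN0.
Qed.

(** Cauchy-Schwarz for the positive definite form G, applied to X and G^-1 b_e. *)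
Lemma drop_sqr_le e X :
  drop e X ^+ 2 <= (slot_row e *m H *m (slot_row e)^T) 0 0 * energy w X.
Proof.
set q := (_ *m _) 0 0; set x := mxvec X; set y := slot_row e *m H.
have yG : y *m G = slot_row e by rewrite /y mulmxKV// gram_unit.
have xGy : (x *m G *m y^T) 0 0 = drop e X.
  rewrite quad_sym yG -/(slot_row e) slot_rowE//.
have yGy : (y *m G *m y^T) 0 0 = q.
  by rewrite yG /y trmx_mul H_sym mulmxA.
have xGx : (x *m G *m x^T) 0 0 = energy w X by rewrite gram_energy mxvecK.
have key t : 0 <= energy w X - 2 * t * drop e X + t ^+ 2 * q.
  rewrite -xGx -xGy -yGy -quad_sub// gram_energy energy_ge0//.
have q0 : 0 <= q by rewrite /q quadH energy_ge0.
have [q1|q1] := eqVneq q 0.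
  have [->|d0] := eqVneq (drop e X) 0; first by rewrite expr0n q1 mul0r.
  (* For [q = 0] the expression in [key] is affine in t, and this t makes it negative. *)
  have := key ((energy w X + 1) / drop e X).
  rewrite q1 mulr0 addr0 -mulrA divfK//.
  have := energy_ge0 X; lra.
have := key (drop e X / q); rewrite -(ler_pM2l (_ : 0 < q)) ?mulr0; last first.
  by rewrite lt_def q1.
have -> : q * (energy w X - 2 * (drop e X / q) * drop e X + (drop e X / q) ^+ 2 * q)
  = q * energy w X - drop e X ^+ 2 by field.
lra.
Qed.

Let scale_gram a (x : 'rV[R]_(k * n)) :
  (a *: x)^T *m (a *: x) = a ^+ 2 *: (x^T *m x).
Proof. by rewrite [_^T]linearZ/= -scalemxAl -scalemxAr scalerA. Qed.

Let Gsplit : G = \sum_e (v (inl e))^T *m v (inl e) + eta%:M.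
Proof.
rewrite /G big_sumType/=; congr (_ + _).
rewrite -scalemx1 mx1_sum_delta scaler_sumr; apply: eq_bigr => j _.
by rewrite scale_gram sqr_sqrtr ?(ltW eta0)// trmx_delta mul_delta_mx.
Qed.

Let slot_row_index e i u :
  slot_row e 0 (mxvec_index i u) = Phi i e * ((u == hd e)%:R - (u == tl e)%:R).
Proof. by rewrite mxvecE mxE. Qed.

Let sum_mxvec (f : 'I_(k * n) -> R) :
  \sum_j f j = \sum_i \sum_u f (mxvec_index i u).
Proof.
rewrite (reindex _ (curry_mxvec_bij k n))/= pair_bigA/=.
by apply: eq_bigr => -[i u].
Qed.

(** All rows together, slots and groundings, have leverage k n, the trace of the identity. At a
    vertex outside [S] only the grounding rows act, so each of these has leverage exactly 1;
    cancelling them leaves at most k #|S| for the slots. *)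
Lemma sum_leverage (S : {set 'I_n}) :
  (forall e, w e != 0 -> (tl e \in S) && (hd e \in S)) ->
  \sum_e leverage e <= (k * #|S|)%:R.
Proof.
move=> wS.
pose c f := (v f *m H *m (v f)^T) 0 0.
have c_ge0 f : 0 <= c f by rewrite /c quadH energy_ge0.
have : \sum_f c f = (k * n)%:R.
  have <- : \tr (H *m G) = (k * n)%:R by rewrite mulVmx ?gram_unit// mxtrace1.
  rewrite /G mulmx_sumr raddf_sum; apply: eq_bigr => f _ /=.
  by rewrite mulmxA mxtrace_mulC mulmxA /mxtrace big_ord1.
rewrite big_sumType/= => h.
have -> : \sum_e leverage e = \sum_j (1 - c (inr j)).
  rewrite sumrB sumr_const card_ord -h; set a := \sum_e _; rewrite addrK.
  by [].
rewrite sum_mxvec.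
have -> : (k * #|S|)%:R = \sum_(i < k) \sum_(u < n) ((u \in S)%:R : R).
  rewrite sumr_const card_ord natrM mulrC mulr_natr; congr (_ *+ _).
  rewrite -sum1_card natr_sum big_mkcond; apply: eq_bigr => u _.
  by case: ifP.
apply: ler_sum => i _; apply: ler_sum => u _.
have [uS|uS] := boolP (u \in S); first by rewrite lerBlDr lerDl c_ge0.
rewrite lerBlDr add0r.
set j := mxvec_index i u.
have vG : v (inr j) *m G = eta *: v (inr j).
  rewrite Gsplit mulmxDr mul_mx_scalar mulmx_sumr big1 ?add0r// => e _.
  rewrite mulmxA /v/= !linearZ/= -!scalemxAl.
  have [->|we] := eqVneq (w e) 0; first by rewrite sqrtr0 !scale0r.
  have -> : delta_mx 0 j *m (slot_row e)^T = 0 :> 'M[R]_1.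
    apply/matrixP => a b; rewrite -rowE !mxE !ord1 slot_row_index.
    have /andP[tS hS] := wS e we.
    have -> : (u == hd e) = false by apply: contraNF uS => /eqP ->.
    have -> : (u == tl e) = false by apply: contraNF uS => /eqP ->.
    by rewrite subrr mulr0.
  by rewrite mul0mx !scaler0.
have vH : v (inr j) *m H = eta^-1 *: v (inr j).
  apply: (can_inj (mulmxK gram_unit)); rewrite mulmxKV ?gram_unit//.
  by rewrite -scalemxAl vG scalerA mulVf ?gt_eqF// scale1r.
rewrite /c vH -scalemxAl /v/= [(_ *: _)^T]linearZ/= -scalemxAl -scalemxAr !scalerA.
rewrite -mulrA -expr2 sqr_sqrtr ?(ltW eta0)// mulVf ?gt_eqF// scale1r.
by rewrite -rowE !mxE !eqxx.
Qed.

Definition star (x : 'I_n) (f : E + 'I_(k * n)) : bool :=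
  match f with
  | inl e => incident x e
  | inr j => [exists i, j == mxvec_index i x]
  end.

Let Ex (x : 'I_n) : 'M[R]_(k * n, k) := \matrix_(j, i) (j == mxvec_index i x)%:R.

Let star_gram x := \sum_(f | star x f) (v f)^T *m v f.

Let star_trace x := \tr (H *m star_gram x *m H *m star_gram x).

Lemma mxvec_index_inj i i' (u u' : 'I_n) :
  (mxvec_index i u == mxvec_index i' u' :> 'I_(k * n)) = (i == i') && (u == u').
Proof.
have [g gK _] := curry_mxvec_bij k n.
apply/eqP/idP => [h|/andP[/eqP-> /eqP->]//].
have : g (uncurry (@mxvec_index k n) (i, u)) = g (uncurry (@mxvec_index k n) (i', u')).
  by rewrite /= h.
by rewrite !gK// => -[-> ->]; rewrite !eqxx.
Qed.

Let mul_Ex x (z : 'rV[R]_k) i u :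
  (z *m (Ex x)^T) 0 (mxvec_index i u) = z 0 i * (u == x)%:R.
Proof.
rewrite mxE (bigD1 i)//= big1 ?addr0.
  by rewrite !mxE mxvec_index_inj eqxx.
by move=> i' ii'; rewrite !mxE mxvec_index_inj eq_sym (negPf ii') mulr0.
Qed.

Let star_Ex x f : ~~ star x f -> v f *m Ex x = 0.
Proof.
case: f => [e|j] /= nx; rewrite -scalemxAl; apply/rowP => i; rewrite !mxE.
  rewrite (bigD1 (mxvec_index i x))//= big1 ?addr0; last first.
    by move=> j /negPf jx; rewrite [Ex x _ _]mxE jx mulr0.
  rewrite [Ex x _ _]mxE eqxx mulr1 slot_row_index.
  move: nx; rewrite /incident negb_or ![_ == x]eq_sym => /andP[/negPf-> /negPf->].
  by rewrite subrr !mulr0.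
rewrite (bigD1 (mxvec_index i x))//= big1 ?addr0; last first.
  by move=> j' /negPf jx; rewrite [Ex x _ _]mxE jx mulr0.
rewrite [delta_mx _ _ _ _]mxE eqxx/=.
case: eqVneq => [jx|_]; last by rewrite mul0r mulr0.
by case/negP: nx; apply/existsP; exists i; rewrite -jx.
Qed.

Let Ex_unit x : (Ex x)^T *m G *m Ex x \in unitmx.
Proof.
rewrite -row_free_unit; apply: inj_row_free => z hz.
have : z *m (Ex x)^T = 0.
  apply: G_def; rewrite trmx_mul trmxK !mulmxA -(mulmxA z) -(mulmxA z).
  by rewrite hz mul0mx mxE.
move=> /rowP h; apply/rowP => i; have := h (mxvec_index i x).
by rewrite mul_Ex eqxx mulr1 !mxE.
Qed.

Let star_quad x (X : 'M[R]_(k, n)) :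
  (mxvec X *m star_gram x *m (mxvec X)^T) 0 0 =
  \sum_(e | incident x e) w e * drop e X ^+ 2 + eta * sqnorm X x.
Proof.
rewrite /star_gram quadE mxvecK; congr (_ + eta * _).
rewrite big_mkcond sum_mxvec; apply: eq_bigr => i _ /=.
rewrite (bigD1 x)//= big1 ?addr0.
  rewrite ifT ?mxvecE//; by apply/existsP; exists i.
move=> u ux; case: ifPn => // /existsP[i' ]; rewrite mxvec_index_inj.
by rewrite (negPf ux) andbF.
Qed.

(* The values at x can be replaced by values that only depend on the rest of X,
   at a cost that is bounded by the energy of X away from x. *)
Definition removable (x : 'I_n) : Prop := forall X : 'M[R]_(k, n),
  exists2 X' : 'M[R]_(k, n), (forall u i, u != x -> X' i u = X i u) &
  \sum_(e | incident x e) w e * drop e X' ^+ 2 + eta * sqnorm X' x <=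
  \sum_(e | ~~ incident x e) w e * drop e X ^+ 2
  + eta * \sum_(u | u != x) sqnorm X u.

Let star_trace_ge x : k%:R <= star_trace x.
Proof.
have := @star_energy_le R (k * n) k _ v gram_unit 0 (star x) (Ex x) 0
  (@star_Ex x) (Ex_unit x).
by rewrite mulmx0 => /(_ erefl); rewrite /star_trace /star_gram; lra.
Qed.

(** [x'] changes [X] at x alone so as to be G-orthogonal to the coordinates at x, that is, to have
    least energy. A small excess of the trace then keeps the part of the energy at x below one half
    of the total, hence below the part away from x. *)
Let star_trace_removable x : star_trace x - k%:R <= 4^-1 -> removable x.
Proof.
move=> hx X.
pose g := (Ex x)^T *m G *m Ex x.
pose z := - (mxvec X *m G *m Ex x *m invmx g).
pose x' := mxvec X + z *m (Ex x)^T.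
have x'0 : (Ex x)^T *m G *m x'^T = 0.
  apply: trmx_inj; rewrite trmx0 !trmx_mul !trmxK G_sym mulmxA.
  rewrite !mulmxDl.
  have -> : z *m (Ex x)^T *m G *m Ex x = z *m g by rewrite /g !mulmxA.
  by rewrite /z mulNmx mulmxKV ?subrr//; exact: Ex_unit.
have x'E i u : vec_mx x' i u = X i u + z 0 i * (u == x)%:R.
  by rewrite mxE [x' _ _]mxE mxvecE mul_Ex.
exists (vec_mx x') => [u i ux|]; first by rewrite x'E (negPf ux) mulr0 addr0.
have sameD e : ~~ incident x e -> drop e (vec_mx x') = drop e X.
  rewrite /incident negb_or => /andP[tx hx']; apply: eq_bigr => i _.
  by rewrite !x'E (negPf tx) (negPf hx') !mulr0 !addr0.
have sameN u : u != x -> sqnorm (vec_mx x') u = sqnorm X u.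
  move=> ux; apply: eq_bigr => i _.
  by rewrite x'E (negPf ux) mulr0 addr0.
set q := (X in X <= _); set b := (X in _ <= X).
have eE : energy w (vec_mx x') = q + b.
  rewrite /energy (bigID (incident x))/= [X in eta * X](bigD1 x)//= mulrDr.
  rewrite addrACA /q /b; congr (_ + (_ + eta * _)); apply: eq_bigr => //.
  by move=> e ex; rewrite sameD.
have q0 : 0 <= q.
  rewrite addr_ge0// ?mulr_ge0 ?(ltW eta0)//; apply: sumr_ge0 => *.
    by rewrite mulr_ge0// sqr_ge0.
  exact: sqr_ge0.
have b0 : 0 <= b.
  rewrite addr_ge0// ?mulr_ge0 ?(ltW eta0)//; apply: sumr_ge0 => *.
    by rewrite mulr_ge0// sqr_ge0.
  by apply: sumr_ge0 => *; exact: sqr_ge0.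
have [e0|eN0] := eqVneq (q + b) 0; first by lra.
(* With t = 1 / (2 e), where e = q + b is the whole energy, the inequality becomes q / e <= 1/4 +
   1/4. *)
have := @star_energy_le R (k * n) k _ v gram_unit (2 * (q + b))^-1 (star x)
  (Ex x) x'^T (@star_Ex x) (Ex_unit x) x'0.
rewrite trmxK -/(star_gram x) -/G gram_energy eE.
have := star_quad x (vec_mx x'); rewrite vec_mxK -/q => ->.
rewrite -/H -/(star_trace x).
have -> : ((2 * (q + b))^-1) ^+ 2 * (q + b) ^+ 2 = 4^-1 by field.
have -> : 2 * (2 * (q + b))^-1 * q = q / (q + b) by field.
move=> h; have : q / (q + b) <= 2^-1 by lra.
rewrite ler_pdivrMr; first by lra.
by rewrite lt_def eN0 addr_ge0.
Qed.

Let is_slot (f : E + 'I_(k * n)) : bool := if f is inl _ then true else false.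

Let star2 f f' : f != f' -> (#|[pred x | star x f && star x f']| <= 1)%N.
Proof.
move=> ff'; apply/card_le1_eqP => x y; rewrite !inE.
have coord j x0 y0 : star x0 (inr j) -> star y0 (inr j) -> x0 = y0.
  move=> /existsP[i /eqP->] /existsP[i'].
  by rewrite mxvec_index_inj => /andP[_ /eqP].
case: f f' ff' => [e|j] [e'|j'] ff' /andP[xf xf'] /andP[yf yf'].
- apply: contraNeq ff' => xy; apply/eqP; congr inl; apply: slot_inj.
  have st e0 : incident x e0 -> incident y e0 -> [set tl e0; hd e0]%SET = [set x; y]%SET.
    move=> /orP[/eqP a|/eqP a] /orP[/eqP b|/eqP b].
    + by move: xy; rewrite -a -b eqxx.
    + by rewrite a b.
    + by rewrite a b finset.setUC.
    + by move: xy; rewrite -a -b eqxx.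
  by rewrite !st.
- exact: (coord j').

- exact: (coord j).
- exact: (coord j).
Qed.

Let star1 f : (#|[pred x | star x f]| <= 1 + is_slot f)%N.
Proof.
case: f => [e|j].
  have : [pred x | incident x e] \subset [:: tl e; hd e].
    by apply/fintype.subsetP => x; rewrite !inE ![x == _]eq_sym.
  by move=> /subset_leq_card/leq_trans; apply; rewrite (leq_trans (card_size _)).
rewrite addn0; apply/card_le1_eqP => x y; rewrite !inE.
move=> /existsP[i /eqP->] /existsP[i'].
by rewrite mxvec_index_inj => /andP[_ /eqP].
Qed.

(** Markov's inequality: a vertex that is not removable has trace excess above 1/4, while all
    excesses are nonnegative and add up to at most the sum of squared leverages, which is at most
    kappa c. *)
Lemma card_not_removable (kappa c : R) (B : pred 'I_n) :
  (forall e, leverage e <= kappa) -> \sum_e leverage e <= c ->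
  (forall x, B x -> ~ removable x) -> 0 <= kappa ->
  #|B|%:R <= 4 * kappa * c.
Proof.
move=> lk lc Bx k0.
have : \sum_x (star_trace x - k%:R) <=
    \sum_(f | is_slot f)
      (v f *m H *m (v f)^T) 0 0 ^+ 2.
  apply: (@sum_star_trace_le R (k * n) k _ 'I_n v gram_unit star).
  - by rewrite card_ord mulnC.
  - exact: star2.
  - exact: star1.
rewrite big_sumType/= [X in _ <= _ + X -> _]big_pred0// addr0 => h.
have {}h : \sum_x (star_trace x - k%:R) <= kappa * c.
  apply: le_trans h _; apply: le_trans (ler_wpM2l k0 lc).
  rewrite mulr_sumr; apply: ler_sum => e _.
  by rewrite expr2 -/(leverage e) ler_wpM2r// leverage_ge0.
suff : 4^-1 * #|B|%:R <= kappa * c by lra.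
apply: le_trans h; rewrite (bigID B)/= mulr_natr -sumr_const.
rewrite -[leLHS]addr0 lerD//; last first.
  by apply: sumr_ge0 => x _; rewrite subr_ge0 star_trace_ge.
apply: ler_sum => x xB; rewrite leNgt; apply/negP => /ltW/star_trace_removable.
exact: Bx.
Qed.

End fixed_weights.
Lemma energy_le (w w' : E -> R) X :
  (forall e, w e <= w' e) -> energy w X <= energy w' X.
Proof.
by move=> ww'; rewrite lerD2r; apply: ler_sum => e _; rewrite ler_wpM2r// sqr_ge0.
Qed.

Variable kappa : R.
Hypothesis kappa0 : 0 < kappa.

Definition inside (S : {set 'I_n}) (e : E) := (tl e \in S) && (hd e \in S).

Definition feasible (S : {set 'I_n}) (w : E -> R) : Prop :=
  [/\ forall e, 0 <= w e <= 1, forall e, w e != 0 -> inside S e &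
      forall e X, w e * drop e X ^+ 2 <= kappa * energy w X].

(* Feasible weights are closed under pointwise suprema, so there are largest
   ones, and they grow with S. *)
Definition max_weight (S : {set 'I_n}) (e : E) : R :=
  sup [set x | exists2 w, feasible S w & x = w e]%classic.

Lemma feasible0 S : feasible S (fun=> 0).
Proof.
split => [e|e|e X]; rewrite ?lexx ?ler01 ?eqxx//.
by rewrite mul0r mulr_ge0 ?energy_ge0// ltW.
Qed.

Let has_sup_weight S e :
  has_sup [set x | exists2 w, feasible S w & x = w e]%classic.
Proof.
split; first by exists 0, (fun=> 0) => //; exact: feasible0.
by exists 1 => _ [w [/(_ e)/andP[_ w1] _ _] ->].
Qed.

Lemma feasible_le S w e : feasible S w -> w e <= max_weight S e.
Proof. by move=> fw; apply: ub_le_sup; [case: (has_sup_weight S e)|exists w]. Qed.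

Lemma max_weight_le S e r :
  (forall w, feasible S w -> w e <= r) -> max_weight S e <= r.
Proof.
move=> h; apply: ge_sup; first by case: (has_sup_weight S e).
by move=> _ [w fw ->]; exact: h.
Qed.

(** The constraint at [e] bounds [w e] by [kappa * energy w X / drop e X ^+ 2], and this bound is
    monotone in [w]; it therefore survives a pointwise supremum. *)
Lemma max_weight_feasible S : feasible S (max_weight S).
Proof.
split=> [e|e|e X].
- rewrite (feasible_le e (feasible0 S))/=; apply: max_weight_le => w [].
  by move=> /(_ e)/andP[].
- move=> eN0; apply: contraNT eN0 => eS; rewrite eq_le.
  rewrite (feasible_le e (feasible0 S))/= andbT; apply: max_weight_le => w [_].
  by move=> /(_ e)/contraNT-/(_ eS)/eqP->.
- have [d0|d0] := eqVneq (drop e X) 0.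
    rewrite d0 expr0n mulr0; apply: mulr_ge0; first exact: ltW.
    by apply: energy_ge0 => e'; exact: (feasible_le e' (feasible0 S)).
  have d2 : 0 < drop e X ^+ 2 by rewrite lt_def sqrf_eq0 d0 sqr_ge0.
  rewrite -ler_pdivlMr//; apply: max_weight_le => w fw; rewrite ler_pdivlMr//.
  case: (fw) => _ _ h; apply: le_trans (h e X) _.
  by rewrite ler_wpM2l ?(ltW kappa0)// energy_le// => e'; exact: feasible_le.
Qed.

Lemma max_weight_ge0 S e : 0 <= max_weight S e.
Proof. exact: (feasible_le e (feasible0 S)). Qed.

Lemma max_weight_le1 S e : max_weight S e <= 1.
Proof. by have [/(_ e)/andP[]] := max_weight_feasible S. Qed.

Lemma max_weight_subset (S S' : {set 'I_n}) e :
  S \subset S' -> max_weight S e <= max_weight S' e.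
Proof.
move=> /fintype.subsetP SS'; apply: max_weight_le => w [w1 w2 w3].
apply: feasible_le; split => // e' /w2/andP[? ?].
by rewrite /inside !SS'.
Qed.

Lemma leverage_max_weight_le S e : leverage (max_weight S) e <= kappa.
Proof.
apply: leverage_le; rewrite ?(ltW kappa0)//; first exact: max_weight_ge0.
by have [_ _] := max_weight_feasible S; exact.
Qed.

Lemma sum_leverage_max_weight S :
  \sum_e leverage (max_weight S) e <= (k * #|S|)%:R.
Proof.
apply: sum_leverage => [|e]; first exact: max_weight_ge0.
by have [_ + _] := max_weight_feasible S; exact.
Qed.

(* A weight that is smaller than 1 cannot be increased, so its leverage is
   kappa; the leverages add up to at most k #|S|. *)
Lemma card_light (S : {set 'I_n}) :
  #|[pred e | inside S e & max_weight S e < 1]|%:R * kappa <= (k * #|S|)%:R.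
Proof.
apply: le_trans (sum_leverage_max_weight S).
set B := [pred e | _ & _]; rewrite (bigID B)/= mulr_natl -sumr_const.
rewrite -[leLHS]addr0 lerD//; last first.
  by apply: sumr_ge0 => e _; apply: leverage_ge0 => // e'; exact: max_weight_ge0.
apply: ler_sum => e /andP[eS e1].
have w0 := max_weight_ge0 S.
set w := max_weight S in e1 w0 *.
have fw : feasible S w by exact: max_weight_feasible.
have CS := drop_sqr_le w0 e; move: CS.
have lev := leverageE w0 e; move: lev.
set q := (_ *m _) 0 0 => lev CS.
have q0 : 0 <= q by rewrite /q quadH_ge0.
rewrite lev leNgt; apply/negP => wq.
(* The increase of the weight of [e] that keeps it at most 1 and [(w e + t) * q] at most kappa; the
   denominator is [q + 1] because [q] may be 0. *)
pose t := Order.min (1 - w e) ((kappa - w e * q) / (q + 1)).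
have q10 : 0 < q + 1 by lra.
have t0 : 0 < t.
  by rewrite lt_min subr_gt0 e1 divr_gt0// subr_gt0.
have t1 : w e + t <= 1.
  have : t <= 1 - w e by rewrite ge_min lexx.
  lra.
have tq : (w e + t) * q <= kappa.
  have : t <= (kappa - w e * q) / (q + 1) by rewrite ge_min lexx orbT.
  rewrite ler_pdivlMr// => ?; nra.
pose w' e' := if e' == e then w e + t else w e'.
have ww' e' : w e' <= w' e'.
  by rewrite /w'; case: eqVneq => [ee|//]; rewrite ?ee lerDl ltW.
have fw' : feasible S w'.
  split => [e'|e'|e' X]; rewrite /w'; case: (eqVneq e' e) => [ee|_]; rewrite ?ee//.
  - by rewrite t1 andbT addr_ge0// ltW.
  - by rewrite w0; exact: max_weight_le1.
  - by case: fw => _ + _; exact.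
  - apply: (@le_trans _ _ (kappa * energy w X)); last first.
      by rewrite ler_wpM2l ?(ltW kappa0)//; exact: energy_le.
    apply: (@le_trans _ _ ((w e + t) * q * energy w X)).
      by rewrite -mulrA ler_wpM2l// addr_ge0// ltW.
    by rewrite ler_wpM2r// energy_ge0.
  - apply: (@le_trans _ _ (kappa * energy w X)); first by case: fw.
    by rewrite ler_wpM2l ?(ltW kappa0)//; exact: energy_le.
have := feasible_le e fw'; rewrite /w' eqxx -/w; lra.
Qed.

(* Removing y and then x; the slot joining x and y is never paid for. *)
Definition extendable (S : {set 'I_n}) (x y : 'I_n) : Prop :=
  forall X : 'M[R]_(k, n),
  exists2 X' : 'M[R]_(k, n), (forall u i, u != x -> X' i u = X i u) &
  \sum_(e | incident x e && ~~ incident y e) max_weight S e * drop e X' ^+ 2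
  + eta * sqnorm X' x <=
  \sum_(e | ~~ incident x e && ~~ incident y e) max_weight S e * drop e X ^+ 2
  + eta * \sum_u sqnorm X u.

Lemma drop_eq (x : 'I_n) (X X' : 'M[R]_(k, n)) e :
  (forall u i, u != x -> X' i u = X i u) -> ~~ incident x e ->
  drop e X' = drop e X.
Proof.
move=> XX'; rewrite /incident negb_or => /andP[tx hx].
by apply: eq_bigr => i _; rewrite !XX'.
Qed.

Lemma sqnorm_ge0 X u : 0 <= sqnorm X u.
Proof. by apply: sumr_ge0 => i _; exact: sqr_ge0. Qed.

(** At most 4 kappa k #|S| vertices y are not removable, and each of them spoils at most #|S| pairs.
    For any other y, deleting the slots at y at most doubles the leverage bound, since X can be
    corrected at y while its energy at most doubles; hence at most 8 kappa k #|S| vertices x fail.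
    The constant is 4 + 8. *)
Lemma sum_not_extendable (S : {set 'I_n}) :
  \sum_(y in S) \sum_(x in S) (`[< ~ extendable S x y >])%:R
  <= 12 * kappa * k%:R * #|S|%:R ^+ 2 :> R.
Proof.
pose w := max_weight S.
have w0 : forall e, 0 <= w e by exact: max_weight_ge0.
pose B y := `[< ~ removable w y >].
have cB : #|[pred y | B y]|%:R <= 4 * kappa * (k * #|S|)%:R :> R.
  apply: (card_not_removable w0); last by rewrite ltW.
  - exact: leverage_max_weight_le.
  - exact: sum_leverage_max_weight.
  - by move=> x /asboolP.
have cy y : ~~ B y -> \sum_(x in S) (`[< ~ extendable S x y >])%:R
    <= 8 * kappa * (k * #|S|)%:R :> R.
  move=> /asboolPn/contrapT rem_y.
  pose w' e := if incident y e then 0 else w e.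
  have w'0 e : 0 <= w' e by rewrite /w'; case: ifP.
  have lev' e : leverage w' e <= 2 * kappa.
    apply: leverage_le => // [X|]; last by rewrite mulr_ge0// ltW.
    have e0 : 0 <= energy w' X by rewrite energy_ge0.
    rewrite /w'; case: ifPn => [_|ye].
      by rewrite mul0r; apply: mulr_ge0 => //; rewrite mulr_ge0// ltW.
    have [X' XX'] := rem_y X.
    set q := (X in X <= _); set b := (X in _ <= X) => qb.
    have [_ _ /(_ e X')] := max_weight_feasible S.
    rewrite (drop_eq XX' ye) -/w => /le_trans; apply.
    rewrite (mulrC 2) -mulrA ler_wpM2l ?(ltW kappa0)//.
    have -> : energy w X' = q + b.
      rewrite /energy (bigID (incident y))/= [X in eta * X](bigD1 y)//= mulrDr.
      rewrite addrACA /q /b; congr (_ + (_ + eta * _)); apply: eq_bigr => //.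
        by move=> e' ye'; rewrite (drop_eq XX').
      by move=> u uy; apply: eq_bigr => i _; rewrite XX'.
    have bE : b <= energy w' X.
      rewrite /b /energy lerD//.
        rewrite big_mkcond; apply: ler_sum => e' _; rewrite /w'.
        by case: (incident y e') => //=; rewrite mul0r.
      rewrite ler_wpM2l ?(ltW eta0)// [leRHS](bigD1 y)//= lerDr.
      exact: sqnorm_ge0.
    by rewrite mulr2n mulrDl mul1r; lra.
  have sum' : \sum_e leverage w' e <= (k * #|S|)%:R.
    apply: sum_leverage => // e; rewrite /w'; case: ifP => [|_]; first by rewrite eqxx.
    by have [_ + _] := max_weight_feasible S; exact.
  have -> : \sum_(x in S) (`[< ~ extendable S x y >])%:R =
      #|[pred x in S | `[< ~ extendable S x y >]]|%:R :> R.
    rewrite -sum1_card natr_sum big_mkcondr; apply: eq_bigr => x _.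
    by case: asboolP.
  have -> : 8 * kappa = 4 * (2 * kappa) by ring.
  apply: (card_not_removable w'0 lev' sum'); last by rewrite mulr_ge0// ltW.
  move=> x /andP[_ /asboolP nex] rem_x; apply: nex => X.
  have [X' XX' h] := rem_x X; exists X' => //.
  have sumE (P : pred E) (Z : 'M[R]_(k, n)) : \sum_(e | P e) w' e * drop e Z ^+ 2 =
      \sum_(e | P e && ~~ incident y e) w e * drop e Z ^+ 2.
    rewrite big_mkcondr; apply: eq_bigr => e _; rewrite /w'.
    by case: (incident y e) => //=; rewrite mul0r.
  rewrite !sumE in h; apply: le_trans h _; rewrite lerD2l ler_wpM2l ?(ltW eta0)//.
  by rewrite [leRHS](bigD1 x)//= lerDr sqnorm_ge0.
apply: (@le_trans _ _ (\sum_(y in S) ((B y)%:R * #|S|%:R + 8 * kappa * (k * #|S|)%:R))).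
  apply: ler_sum => y yS; have [By|nBy] := boolP (B y).
    rewrite mul1r ler_wpDr//; first by rewrite !mulr_ge0// ltW.
    rewrite -sum1_card natr_sum; apply: ler_sum => x _.
    by case: (`[< _ >]) => //=; rewrite ler01.
  by rewrite mul0r add0r cy.
rewrite big_split/= sumr_const -mulr_suml.
have : \sum_(y in S) (B y)%:R <= 4 * kappa * (k * #|S|)%:R :> R.
  apply: le_trans cB; rewrite -sum1_card natr_sum big_mkcond [leRHS]big_mkcond/=.
  apply: ler_sum => y _; have -> : (y \in [pred y | B y]) = B y by [].

  by case: (y \in S); case: (B y); rewrite ?ler01 ?lexx.
rewrite (natrM R k) -[X in _ -> _ + X <= _]mulr_natr.
move: (#|S|%:R) (ler0n R #|S|) => c c0 h.
have : 0 <= 4 * kappa * (k%:R * c) - \sum_(y in S) (B y)%:R by rewrite subr_ge0.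
set z := \sum_(y in S) _ => hz.
have -> : 12 * kappa * k%:R * c ^+ 2 = 4 * kappa * (k%:R * c) * c + 8 * kappa * (k%:R * c) * c.
  by ring.
by rewrite lerD2r ler_wpM2r.
Qed.

End weighted_graph.

(** * Chains of vertex groups *)

Lemma sqr_sum_le (R : realFieldType) (N : nat) (a : nat -> R) :
  (\sum_(j < N) a j) ^+ 2 <= N%:R * \sum_(j < N) a j ^+ 2.
Proof.
elim: N => [|N IH]; first by rewrite !big_ord0 expr0n mulr0.
rewrite !big_ord_recr/=.
have T0 : 0 <= \sum_(j < N) a j ^+ 2 by apply: sumr_ge0 => *; exact: sqr_ge0.
move: IH T0 (ler0n R N); rewrite -natr1.
move: (\sum_(j < N) a j) (\sum_(j < N) a j ^+ 2) (a N) (N%:R) => S T b c IH T0 c0.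
have [c00|cN0] := eqVneq c 0.
  have -> : S = 0.
    by apply/eqP; rewrite -sqrf_eq0 eq_le sqr_ge0 andbT; rewrite c00 mul0r in IH.
  rewrite c00; nra.
have cp : 0 < c by rewrite lt_def cN0.
have : 2 * S * b <= T + c * b ^+ 2.
  rewrite -(ler_pM2l cp); have := sqr_ge0 (S - c * b).
  have -> : (S - c * b) ^+ 2 = S ^+ 2 - c * (2 * S * b) + c * (c * b ^+ 2) by ring.
  rewrite (mulrDr c); lra.
rewrite sqrrD; nra.
Qed.

Section chain.
Variables (R : realType) (k n : nat) (E : finType).
Variables (tl hd : E -> 'I_n) (Phi : 'I_k -> E -> R).
Hypothesis slot_inj : forall e e',
  [set tl e; hd e]%SET = [set tl e'; hd e']%SET -> e = e'.
Variables (eta kappa : R).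
Hypothesis eta0 : 0 < eta.
Hypothesis kappa0 : 0 < kappa.
Hypothesis kappa_le : kappa <= 2^-1.

Local Notation drop := (drop tl hd Phi).
Local Notation incident := (incident tl hd).
Local Notation inside := (inside tl hd).
Local Notation max_weight := (max_weight tl hd Phi eta kappa).
Local Notation extendable := (extendable tl hd Phi eta kappa).
Local Notation energy := (energy tl hd Phi eta).
Local Notation sqnorm := (@sqnorm R k n).

Definition joins (x y : 'I_n) (e : E) := [set tl e; hd e]%SET == [set x; y]%SET.

Lemma joinsE x y e : x != y -> joins x y e = incident x e && incident y e.
Proof.
move=> xy; apply/idP/idP.
  move=> /eqP/finset.setP h; move: (h x) (h y); rewrite !inE !eqxx orbT/= /incident.
  by rewrite ![_ == x]eq_sym ![_ == y]eq_sym => -> ->.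
move=> /andP[/orP[/eqP a|/eqP a] /orP[/eqP b|/eqP b]]; apply/eqP.
- by move: xy; rewrite -a -b eqxx.
- by rewrite a b.
- by rewrite a b finset.setUC.
- by move: xy; rewrite -a -b eqxx.
Qed.

Lemma joins_uniq x y e e' : joins x y e -> joins x y e' -> e = e'.
Proof. by move=> /eqP h /eqP h'; apply: slot_inj; rewrite h h'. Qed.

(** At weight 1 the feasibility constraint bounds the squared drop itself by kappa times the energy
    inside [S]. *)
Definition heavy (S : {set 'I_n}) (x y : 'I_n) : Prop :=
  forall e, joins x y e -> max_weight S e = 1.

Lemma dropB e (X Y : 'M[R]_(k, n)) : drop e (X - Y) = drop e X - drop e Y.
Proof. by rewrite -sumrB; apply: eq_bigr => i _; rewrite !mxE; ring. Qed.

Let w0 S e : 0 <= max_weight S e. Proof. exact: max_weight_ge0. Qed.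

Variables (x y : 'I_n) (J : nat) (A : nat -> {set 'I_n}) (L : pred E) (e0 : E).
Hypothesis xy : x != y.
Hypothesis e0xy : joins x y e0.
Hypothesis J0 : (0 < J)%N.
Hypothesis heavyA : forall j, (j <= J)%N -> heavy (x |: (y |: A j)) x y.
Hypothesis extA : forall j, (j < J)%N ->
  extendable (x |: (y |: (A j :|: A j.+1))) x y.
Hypothesis localA : forall j e, (j < J)%N -> inside (A j :|: A j.+1) e -> L e.
Hypothesis multA : forall e,
  (#|[pred j : 'I_J | inside (A j :|: A j.+1) e]| <= 2)%N.
Hypothesis localx : forall e, incident x e -> inside (x |: A 0) e -> L e.
Hypothesis localy : forall e, incident y e -> inside (y |: A J) e -> L e.

Let W j := x |: (y |: (A j :|: A j.+1)).

Let inside_sub (S S' : {set 'I_n}) e :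
  (forall u, incident u e -> u \in S -> u \in S') -> inside S e -> inside S' e.
Proof.
by move=> h /andP[tS hS]; rewrite /inside !h// /incident eqxx ?orbT.
Qed.

Let max_weight_inside S e : max_weight S e != 0 -> inside S e.
Proof. by have [_ + _] := max_weight_feasible tl hd Phi eta0 kappa0 S; exact. Qed.

(** The potentials [Y j] agree with X off x. Consecutive ones differ only at x, so the difference
    has energy only on the slots at x, and both of its terms are controlled there in the common
    group. The last one is compared with the energy around y directly. *)
Lemma chain_drop_le (X : 'M[R]_(k, n)) :
  drop e0 X ^+ 2 <= 12 * kappa * J.+1%:R *
    (3 * (\sum_(e | L e) drop e X ^+ 2) + J.+1%:R * (eta * \sum_u sqnorm X u)).
Proof.
set EL := \sum_(e | L e) _; set ND := eta * _.
have EL0 : 0 <= EL by apply: sumr_ge0 => *; exact: sqr_ge0.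
have ND0 : 0 <= ND.
  by rewrite mulr_ge0 ?(ltW eta0)//; apply: sumr_ge0 => *; exact: sqnorm_ge0.
have /choice[Z hZ] : forall j, exists Z : 'M[R]_(k, n),
    (forall u i, u != x -> Z i u = X i u) /\
    ((j < J)%N -> \sum_(e | incident x e && ~~ incident y e)
         max_weight (W j) e * drop e Z ^+ 2 + eta * sqnorm Z x <=
       \sum_(e | ~~ incident x e && ~~ incident y e)
         max_weight (W j) e * drop e X ^+ 2 + ND).
  move=> j; have [jJ|_] := boolP (j < J)%N; last by exists X.
  by have [Z Z1 Z2] := extA jJ X; exists Z.
pose Y j := if j is i.+1 then Z i else X.
have YX j u i : u != x -> Y j i u = X i u.
  by case: j => [|j] //= ux; have [/(_ u i ux)] := hZ j.
(* Budgets: [Y 0] is X itself and is charged to all local slots, while [Y i.+1] is charged only to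
   the slots inside the two groups from which it was computed. *)
pose Q j := if j is i.+1 then
    \sum_(e | inside (A i :|: A i.+1) e) drop e X ^+ 2 + ND else EL + ND.
have sq e V : 0 <= drop e V ^+ 2 := sqr_ge0 _.
(* [Y j] is controlled on the slots between x and A j.-1, A j. *)
have hY j B : (j <= J)%N -> ((B == A j) || (B == A j.-1)) ->
    \sum_(e | incident x e && ~~ incident y e)
      max_weight (x |: (y |: B)) e * drop e (Y j) ^+ 2 + eta * sqnorm (Y j) x
    <= Q j.
  move=> jJ Bj; case: j jJ Bj => [|j] jJ Bj.
    have {}Bj : B = A 0 by case/orP: Bj => /eqP.
    rewrite /Y /Q -/EL lerD//; last first.
      rewrite /ND ler_wpM2l ?(ltW eta0)// (bigD1 x)//= lerDl.
      by apply: sumr_ge0 => *; exact: sqnorm_ge0.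
    rewrite big_mkcond [leRHS]big_mkcond; apply: ler_sum => e _.
    case: ifPn => [/andP[xe ye]|_]; last by case: ifP.
    have [->|wN0] := eqVneq (max_weight (x |: (y |: B)) e) 0.
      by rewrite mul0r; case: ifP.
    rewrite ifT.
      by rewrite ler_piMl// max_weight_le1.
    apply: localx => //; rewrite -Bj.
    apply: inside_sub (max_weight_inside wN0) => u ue; rewrite !inE.
    by case/or3P => [->|/eqP uy|->]; rewrite ?orbT//; rewrite -uy ue in ye.
  have [_ /(_ jJ) hj] := hZ j; rewrite /Y /Q.
  (* Passing from one group to the pair of groups only raises the weights. *)
  apply: le_trans (_ : _ <= \sum_(e | incident x e && ~~ incident y e)
         max_weight (W j) e * drop e (Z j) ^+ 2 + eta * sqnorm (Z j) x) _.
    rewrite lerD2r; apply: ler_sum => e _; rewrite ler_wpM2r//.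
    apply: max_weight_subset => //; rewrite /W; apply: finset.setUS; apply: finset.setUS.
    by case/orP: Bj => /eqP ->; rewrite ?finset.subsetUl ?finset.subsetUr.
  apply: le_trans hj _; rewrite lerD2r.
  rewrite big_mkcond [leRHS]big_mkcond; apply: ler_sum => e _.
  case: ifPn => [/andP[xe ye]|_]; last by case: ifP.
  have [->|wN0] := eqVneq (max_weight (W j) e) 0.
    by rewrite mul0r; case: ifP.
  rewrite ifT.
    by rewrite ler_piMl// max_weight_le1.
  apply: inside_sub (max_weight_inside wN0) => u ue; rewrite !inE.
  by case/or3P => [/eqP ux|/eqP uy|//]; [rewrite -ux ue in xe|rewrite -uy ue in ye].
have Q0 j : 0 <= Q j.
  case: j => [|j]; first exact: addr_ge0.
  by apply: addr_ge0 => //; apply: sumr_ge0.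
have splitE (f : E -> R) : \sum_e f e = f e0 +
    \sum_(e | incident x e && ~~ incident y e) f e + \sum_(e | ~~ incident x e) f e.
  rewrite (bigID (incident x))/= (bigID (incident y))/=; congr (_ + _ + _).
  rewrite (big_pred1 e0)// => e; apply/andP/eqP => [[xe ye]|->].
    by apply: (@joins_uniq x y) => //; rewrite joinsE// xe ye.
  by apply/andP; rewrite -joinsE.
(* The energy of the difference contains its squared drop at [e0] with weight at most 1. As kappa <=
   1/2, that term is absorbed on the left, which doubles the constant. *)
have hd_ j : (j < J)%N ->
    (drop e0 (Y j.+1) - drop e0 (Y j)) ^+ 2 <= 4 * kappa * (Q j + Q j.+1).
  move=> jJ; rewrite -dropB; set D := Y j.+1 - Y j.
  pose S := x |: (y |: A j).
  have Dx u i : u != x -> D i u = 0 by move=> ux; rewrite !mxE !YX// subrr.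
  have dD e : ~~ incident x e -> drop e D = 0.
    move=> xe; rewrite (drop_eq _ (_ : forall u i, u != x -> D i u = (0 : 'M[R]_(k, n)) i u) xe).
      by apply: big1 => i _; rewrite !mxE subrr mulr0.
    by move=> u i ux; rewrite Dx// mxE.
  have [_ _ /(_ e0 D)] := max_weight_feasible tl hd Phi eta0 kappa0 S.
  rewrite (heavyA (ltnW jJ) e0xy) mul1r => fe.
  have h1 : _ <= Q j.+1 := hY j.+1 (A j) jJ (introT orP (or_intror (eqxx _))).
  have h0 : _ <= Q j := hY j (A j) (ltnW jJ) (introT orP (or_introl (eqxx _))).
  rewrite -/S in h0 h1; have := Q0 j; have := Q0 j.+1.
  move: (Q j) (Q j.+1) h0 h1 => q0 q1 h0 h1 q10 q00.
  have eD : energy (max_weight S) D <= drop e0 D ^+ 2 + 2 * (q0 + q1).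
    rewrite /energy splitE [\sum_(e | ~~ incident x e) _]big1 ?addr0; last first.
      by move=> e xe; rewrite dD// expr0n mulr0.
    rewrite (bigD1 x)//= [X in _ + eta * (_ + X)]big1 ?addr0; last first.
      by move=> u ux; apply: big1 => i _; rewrite Dx// expr0n.
    rewrite -addrA lerD//.
      by rewrite ler_piMl// max_weight_le1.
    apply: le_trans (_ : _ <= 2 * (
      \sum_(e | incident x e && ~~ incident y e)
         max_weight S e * drop e (Y j) ^+ 2 +
      \sum_(e | incident x e && ~~ incident y e)
         max_weight S e * drop e (Y j.+1) ^+ 2) +
      2 * (eta * (sqnorm (Y j) x + sqnorm (Y j.+1) x))) _; last by lra.
    rewrite -big_split lerD//.
      rewrite mulr_sumr; apply: ler_sum => e _.
      rewrite /= -mulrDr [leRHS]mulrCA ler_wpM2l// dropB/=.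
      by have := sqr_ge0 (drop e (Z j) + drop e (Y j)); nra.
    rewrite [leRHS]mulrCA ler_wpM2l ?(ltW eta0)// -big_split mulr_sumr.
    apply: ler_sum => i _; rewrite !mxE/=.
    by have := sqr_ge0 (Z j i x + Y j i x); nra.
  have h2 := le_trans fe (ler_wpM2l (ltW kappa0) eD).
  have h3 := ler_wpM2r (sq e0 D) kappa_le.
  by rewrite mulrDr in h2; lra.
(* [Y J] is the first potential whose slots away from x are used too: those at y or inside the last
   group are local, so [Q 0] pays for them. *)
have hlast : drop e0 (Y J) ^+ 2 <= 2 * kappa * (Q 0 + Q J).
  pose S := x |: (y |: A J).
  have [_ _ /(_ e0 (Y J))] := max_weight_feasible tl hd Phi eta0 kappa0 S.
  rewrite (heavyA (leqnn J) e0xy) mul1r => fe.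
  have hJ : _ <= Q J := hY J (A J) (leqnn J) (introT orP (or_introl (eqxx _))).
  rewrite -/S in hJ.
  have eD : energy (max_weight S) (Y J) <= drop e0 (Y J) ^+ 2 + (Q 0 + Q J).
    rewrite /energy splitE (bigD1 x)//= mulrDr.
    have -> : \sum_(u < n | u != x) sqnorm (Y J) u = \sum_(u < n | u != x) sqnorm X u.
      by apply: eq_bigr => u ux; apply: eq_bigr => i _; rewrite YX.
    rewrite -!addrA lerD//.
      by rewrite ler_piMl// max_weight_le1.
    have hL : \sum_(e | ~~ incident x e) max_weight S e * drop e (Y J) ^+ 2 <= EL.
      rewrite /EL big_mkcond [leRHS]big_mkcond; apply: ler_sum => e _.
      case: ifPn => xe; last by case: ifP.
      have [->|wN0] := eqVneq (max_weight S e) 0; first by rewrite mul0r; case: ifP.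
      have eS : inside (y |: A J) e.
        apply: inside_sub (max_weight_inside wN0) => u ue; rewrite !inE.
        by case/or3P => [/eqP ux|->|->]; rewrite ?orbT//; rewrite -ux ue in xe.
      rewrite ifT.
        have -> : drop e (Y J) = drop e X by apply: drop_eq xe => u i; exact: YX.
        by rewrite ler_piMl// max_weight_le1.
      have [ye|ye] := boolP (incident y e); first exact: localy.
      apply: (@localA J.-1); first by rewrite prednK.
      apply: inside_sub eS => u ue; rewrite !inE prednK//.
      by case/orP => [/eqP uy|->]; rewrite ?orbT//; rewrite -uy ue in ye.
    have hN : eta * (\sum_(u < n | u != x) sqnorm X u) <= ND.
      rewrite /ND ler_wpM2l ?(ltW eta0)// [leRHS](bigD1 x)//= lerDr.
      exact: sqnorm_ge0.
    by move: hJ; rewrite {1 2}/Q; lra.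
  have h2 := le_trans fe (ler_wpM2l (ltW kappa0) eD).
  have h3 := ler_wpM2r (sq e0 (Y J)) kappa_le.
  by rewrite mulrDr in h2; lra.
(* The factor 3 is 1 for [Q 0] plus 2 for the pairs of groups, by [multA]. *)
have sumQ : \sum_(j < J.+1) Q j <= 3 * EL + J.+1%:R * ND.
  rewrite big_ord_recl/= big_split/= sumr_const card_ord.
  have : \sum_(i < J) \sum_(e | inside (A i :|: A i.+1) e) drop e X ^+ 2 <= 2 * EL.
    under eq_bigr => i _ do rewrite big_mkcond.
    rewrite exchange_big/= mulr_sumr [leRHS]big_mkcond; apply: ler_sum => e _.
    rewrite -big_mkcond/= sumr_const; have [Le|nLe] := boolP (L e).
      by rewrite mulr_natl; apply: ler_wpMn2l => //; exact: multA.
    suff -> : #|[pred j : 'I_J | inside (A j :|: A j.+1) e]| = 0%N by [].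
    apply: eq_card0 => j; rewrite inE; apply: contraNF nLe => /localA; apply.
    exact: ltn_ord.
  rewrite -natr1 mulrDl mul1r -[ND *+ J]mulr_natl; lra.
(* The final term subtracts the drop of [Y J], so that the telescoping sum is minus the drop of X
   alone. *)
pose a j := if (j < J)%N then drop e0 (Y j.+1) - drop e0 (Y j) else - drop e0 (Y J).
have aE : \sum_(j < J.+1) a j = - drop e0 X.
  rewrite big_ord_recr/= /a ltnn.
  rewrite (eq_bigr (fun j : 'I_J => drop e0 (Y j.+1) - drop e0 (Y j))).
    by rewrite -(big_mkord xpredT (fun j => drop e0 (Y j.+1) - drop e0 (Y j))) telescope_sumr//=; ring.
  by move=> j _; rewrite ltn_ord.
have := sqr_sum_le J.+1 a; rewrite aE sqrrN => /le_trans; apply.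
rewrite [leRHS](_ : _ = J.+1%:R * (12 * kappa * (3 * EL + J.+1%:R * ND))); last ring.
rewrite ler_wpM2l//.
(* 12 = 8 + 4: the differences cost 4 kappa for each of two neighbouring budgets, and the last term
   costs 2 kappa for [Q 0] and for [Q J]. *)
apply: (@le_trans _ _ (12 * kappa * \sum_(j < J.+1) Q j)); last first.
  by rewrite ler_wpM2l// mulr_ge0// (ltW kappa0).
rewrite big_ord_recr/=.
have h1 : \sum_(j < J) a j ^+ 2 <= 4 * kappa * (\sum_(j < J.+1) Q j + \sum_(j < J.+1) Q j).
  rewrite {1}big_ord_recr [X in _ + X]big_ord_recl/=.
  apply: (@le_trans _ _ (\sum_(j < J) 4 * kappa * (Q j + Q j.+1))).
    by apply: ler_sum => j _; rewrite /a ltn_ord; exact: hd_.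
  rewrite -mulr_sumr ler_wpM2l// ?mulr_ge0 ?(ltW kappa0)// big_split/=.
  have := Q0 0; have := Q0 J; lra.
have h2 : a J ^+ 2 <= 2 * kappa * (\sum_(j < J.+1) Q j + \sum_(j < J.+1) Q j).
  rewrite /a ltnn sqrrN; apply: (le_trans hlast).
  apply: ler_wpM2l; first by rewrite mulr_ge0 ?(ltW kappa0).
  apply: lerD.
    by rewrite big_ord_recl lerDl; apply: sumr_ge0 => i _; exact: Q0.
  by rewrite big_ord_recr/= lerDr; apply: sumr_ge0 => i _; exact: Q0.
lra.
Qed.

End chain.

(** * Chains in a random permutation *)

Section exchangeability.
Variables (R : realFieldType) (T I : finType).

Lemma natr_card (U : finType) (P : pred U) :
  #|P|%:R = \sum_u (P u)%:R :> R.
Proof.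
rewrite -sum1_card natr_sum big_mkcond/=; apply: eq_bigr => u _.
by rewrite unfold_in; case: (P u).
Qed.

(* A uniformly random injection I -> T maps (i0, j0) to a uniformly random
   ordered pair of distinct elements of the image of J. *)
Lemma exchange_count (J : {set I}) (i0 j0 : I) (B : {set T} -> T -> T -> bool)
    (beta : R) :
  i0 \in J -> j0 \in J -> i0 != j0 -> 0 <= beta ->
  (forall S : {set T}, #|S| = #|J| ->
    \sum_(y in S) \sum_(x in S) (B S x y && (x != y))%:R <= beta) ->
  (#|J| * #|J|.-1)%:R *
    #|[pred v : {ffun I -> T} | injectiveb v && B (v @: J) (v i0) (v j0)]|%:R
  <= beta * (#|T| ^ #|I|)%:R.
Proof.
move=> i0J j0J ij0 beta0 HB.
pose c i j : R := \sum_(v : {ffun I -> T} | injectiveb v) (B (v @: J) (v i) (v j))%:R.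
have cE i j : i \in J -> j \in J -> i != j -> c i j = c i0 j0.
  move=> iJ jJ ij.
  have tJ a b t : a \in J -> b \in J -> (tperm a b t \in J) = (t \in J).
    by move=> aJ bJ; case: tpermP => [->|->|//]; rewrite ?aJ ?bJ.
  (* [s] preserves [J] and takes (i0, j0) to (i, j). Relabelling by it shows that the count does not
     depend on the pair, so the count may be averaged over all ordered pairs in [J]. *)
  pose s1 := tperm i0 i; pose s := (s1 * tperm (s1 j0) j)%g.
  have sJ t : (s t \in J) = (t \in J).
    by rewrite permM !tJ// /s1 tJ.
  have si0 : s i0 = i.
    rewrite permM /s1 tpermL tpermD//; last by rewrite eq_sym.
    by rewrite -[X in _ != X](tpermL i0 i) (inj_eq perm_inj) eq_sym.
  have sj0 : s j0 = j by rewrite permM tpermL.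
  pose h (p : {perm I}) (v : {ffun I -> T}) := [ffun t => v (p t)].
  have hK : cancel (h s) (h s^-1%g) by move=> v; apply/ffunP => t; rewrite !ffunE permKV.
  have hK' : cancel (h s^-1%g) (h s) by move=> v; apply/ffunP => t; rewrite !ffunE permK.
  rewrite /c [RHS](reindex (h s))/=; last by exists (h s^-1%g) => v _; [exact: hK|exact: hK'].
  apply: eq_big => v; last first.
    move=> _; rewrite !ffunE si0 sj0; congr ((B _ _ _)%:R).
    apply/finset.setP => x; apply/imsetP/imsetP => -[t tj ->].
      by exists (s^-1%g t); [rewrite -sJ permKV|rewrite ffunE permKV].
    by exists (s t); [rewrite sJ|rewrite ffunE].
  apply/injectiveP/injectiveP => vi a b.
    by rewrite !ffunE => /vi/perm_inj.
  move=> vab; rewrite -(permKV s a) -(permKV s b); congr (s _).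
  by apply: vi; rewrite !ffunE !permKV.
have -> : #|[pred v : {ffun I -> T} | injectiveb v && B (v @: J) (v i0) (v j0)]|%:R
    = c i0 j0.
  rewrite natr_card /c big_mkcond/= [RHS]big_mkcond/=; apply: eq_bigr => v _.
  by case: (injectiveb v) => //; rewrite mulr0n.
have -> : (#|J| * #|J|.-1)%:R * c i0 j0 = \sum_(j in J) \sum_(i in J | i != j) c i j.
  rewrite (eq_bigr (fun=> #|J|.-1%:R * c i0 j0)).
    by rewrite sumr_const -[RHS]mulr_natl natrM mulrA.
  move=> j jJ; rewrite (eq_bigr (fun=> c i0 j0)); last first.
    by move=> i /andP[iJ ij]; exact: cE.
  rewrite sumr_const -[LHS]mulr_natl; congr (_%:R * _).
  rewrite (cardD1 j J) jJ add1n/=; apply: eq_card => i; rewrite !inE.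
  by rewrite andbC.
rewrite /c.
under eq_bigr => j _ do rewrite exchange_big.
rewrite exchange_big/=.
apply: (@le_trans _ _ (\sum_(v : {ffun I -> T} | injectiveb v) beta)); last first.
  rewrite sumr_const -[leLHS]mulr_natr ler_wpM2l// ler_nat -card_ffun.
  exact: max_card.
apply: ler_sum => v /injectiveP vi.
apply: le_trans (HB (v @: J) (card_imset _ vi)).
rewrite big_imset/=; last by move=> ? ? _ _; exact: vi.
apply: ler_sum => j jJ; rewrite big_imset/=; last by move=> ? ? _ _; exact: vi.
rewrite big_mkcondr/=; apply: ler_sum => i iJ.
by rewrite (inj_eq vi); case: (i != j); rewrite ?andbT// andbF.
Qed.
End exchangeability.

(** * Counting permutations by their values on few positions *)

Section permutations.
Variables (T Z : finType).

Lemma card_perm_fiber (D : {set T}) (p0 : {perm T}) :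
  (#|[pred p : {perm T} | [forall i in D, p i == p0 i]]| <= (#|T| - #|D|)`!)%N.
Proof.
rewrite -(cardsC D) addKn -card_perm.
rewrite -(card_imset _ (@mulIg _ p0^-1%g)); apply: subset_leq_card.
apply/fintype.subsetP => _ /imsetP[p pD ->]; rewrite unfold_in; apply/fintype.subsetP => i.
rewrite !inE permM; apply: contraNN => iD.
by have /forall_inP/(_ i iD)/eqP -> := pD; rewrite permK.
Qed.

Lemma card_perm_determined (D : {set T}) (g : {perm T} -> Z) (Q : pred Z) :
  (forall p p', g p = g p' -> {in D, p =1 p'}) ->
  (#|[pred p | Q (g p)]| <= #|Q| * (#|T| - #|D|)`!)%N.
Proof.
move=> gD.
rewrite -[leqLHS]sum1_card (partition_big g Q)//= -sum_nat_const.
apply: leq_sum => z Qz; rewrite sum1_card.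
have [p0 p0z|h] := pickP (fun p => g p == z); last first.
  by rewrite eq_card0// => p; rewrite unfold_in h andbF.
apply: leq_trans _ (card_perm_fiber D p0); apply: subset_leq_card.
apply/fintype.subsetP => p; rewrite !unfold_in => /andP[_ /eqP pz].
by apply/forall_inP => i iD; apply/eqP; apply: gD => //; rewrite pz -(eqP p0z).
Qed.
End permutations.

(* König-type dichotomy: a maximal set of disjoint pairs is a vertex cover. *)
Lemma matching_or_cover (A B : finType) (r : A -> B -> bool) (q : nat) :
  (exists (f : 'I_q -> A) (g : 'I_q -> B),
     [/\ injective f, injective g & forall i, r (f i) (g i)]) \/
  (exists (S : {set A}) (S' : {set B}), [/\ (#|S| < q)%N, (#|S'| < q)%N &
     forall a b, r a b -> (a \in S) || (b \in S')]).
Proof.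
elim: q => [|q [[f [g [fI gI rfg]]]|[S [S' [Sq S'q h]]]]].
- have e0 X : 'I_0 -> X by case.
  by left; exists (@e0 A), (@e0 B); split => -[].
- pose S := [set f i | i in 'I_q]; pose S' := [set g i | i in 'I_q].
  have [[a b] /and3P[rab aS bS']|none] :=
      pickP (fun ab => [&& r ab.1 ab.2, ab.1 \notin S & ab.2 \notin S']).
    left; exists (fun i => if unlift ord_max i is Some j then f j else a).
    exists (fun i => if unlift ord_max i is Some j then g j else b).
    split.
    + move=> i j; case: unliftP => [i' ->|->]; case: unliftP => [j' ->|->]//.
      * by move/fI => ->.
      * by move=> fa; case/imsetP: aS; exists i'.
      * by move=> fa; case/imsetP: aS; exists j'.
    + move=> i j; case: unliftP => [i' ->|->]; case: unliftP => [j' ->|->]//.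
      * by move/gI => ->.
      * by move=> fa; case/imsetP: bS'; exists i'.
      * by move=> fa; case/imsetP: bS'; exists j'.
    + by move=> i; case: unliftP.
  right; exists S, S'; split.
  + by rewrite ltnS -[leqRHS]card_ord leq_imset_card.
  + by rewrite ltnS -[leqRHS]card_ord leq_imset_card.
  + move=> a b rab; have := none (a, b); rewrite /= rab/=.
    by case: (a \in S); case: (b \in S').
- by right; exists S, S'; split => //; rewrite ltnS ltnW.
Qed.

(** The bound 1 - t^2 / n for the probability that t independent uniform draws from n are distinct,
    cleared of denominators; for t^2 > n truncated subtraction makes it trivial. *)
Lemma ffact_ge (n t : nat) : (n ^ t * (n - t ^ 2) <= n ^_ t * n)%N.
Proof.
elim: t => [|t IH]; first by rewrite ffactn0 expn0 subn0.
have [tn|nt] := leqP (t.+1 ^ 2) n; last first.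
  by rewrite (eqP (ltnW nt : n - t.+1 ^ 2 == 0)%N) muln0.
rewrite ffactnSr -(@leq_pmul2r n); last by apply: leq_trans tn; rewrite expn_gt0.
apply: (@leq_trans (n ^ t * (n - t ^ 2) * (n - t) * n)); last first.
  by rewrite (mulnAC (n ^_ t)) !leq_mul2r IH !orbT.
rewrite leq_mul2r; apply/orP; right.
suff h : (n * (n - t.+1 ^ 2) <= (n - t ^ 2) * (n - t))%N.
  by rewrite expnS mulnAC mulnC -mulnA leq_mul2l h orbT.
rewrite -(subnK tn) addnK; move: (n - t.+1 ^ 2)%N => a.
have -> : (a + t.+1 ^ 2 - t ^ 2 = a + 2 * t + 1)%N by nia.
have -> : (a + t.+1 ^ 2 - t = a + t ^ 2 + t + 1)%N by nia.
nia.
Qed.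

(** The values of a random permutation at t positions may be treated as independent uniform ones at
    the cost of a factor 2, as long as t^2 <= n / 2. *)
Lemma expn_fact_le (n t : nat) : (0 < n)%N -> (2 * t ^ 2 <= n)%N ->
  (n ^ t * (n - t)`! <= 2 * n`!)%N.
Proof.
move=> n0 tn; have := ffact_ge n t => h.
have tn' : (t <= n)%N by nia.
rewrite -(ffact_fact tn') mulnA leq_mul2r; apply/orP; right.
rewrite -(@leq_pmul2r n)//; nia.
Qed.

(** * Density of the bad pairs of groups *)

Section bad_tuples.
Variables (R : realType) (k n : nat) (E : finType).
Variables (tl hd : E -> 'I_n) (Phi : 'I_k -> E -> R).
Hypothesis tl_hd : forall e, tl e != hd e.
Hypothesis slot_inj : forall e e',
  [set tl e; hd e]%SET = [set tl e'; hd e']%SET -> e = e'.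
Variables (eta kappa : R).
Hypothesis eta0 : 0 < eta.
Hypothesis kappa0 : 0 < kappa.

Local Notation inside := (inside tl hd).
Local Notation joins := (joins tl hd).
Local Notation max_weight := (max_weight tl hd Phi eta kappa).
Local Notation extendable := (extendable tl hd Phi eta kappa).
Local Notation heavy := (heavy tl hd Phi eta kappa).

(** A pair that is not heavy is joined by a slot of weight below 1, each slot joins two ordered
    pairs, and [card_light] bounds the number of such slots. *)
Lemma sum_not_heavy (S : {set 'I_n}) :
  \sum_(y in S) \sum_(x in S) (`[< ~ heavy S x y >] && (x != y))%:R
  <= 2 * (k%:R / kappa) * #|S|%:R :> R.
Proof.
pose light e := inside S e && (max_weight S e < 1).
have pairs e : \sum_(y in S) \sum_(x in S) (joins x y e && (x != y))%:R <= 2 :> R.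
  rewrite pair_big_dep/=.
  have -> : 2 = \sum_(z <- [:: (hd e, tl e); (tl e, hd e)]) 1 :> R.
    by rewrite !big_cons big_nil addr0.
  have uz : uniq [:: (hd e, tl e); (tl e, hd e)].
    by rewrite /= inE andbT xpair_eqE negb_and eq_sym tl_hd.
  rewrite big_uniq//= big_mkcond [leRHS]big_mkcond; apply: ler_sum => -[y x] _ /=.
  case: ifP => _; last by case: ifP.
  case: (boolP (joins x y e && (x != y))) => [/andP[xye xy]|_]; last by case: ifP.
  rewrite ifT// !inE !xpair_eqE.
  move: xye; rewrite joinsE// => /andP[/orP[/eqP a|/eqP a] /orP[/eqP b|/eqP b]].
  - by move: xy; rewrite -a -b eqxx.
  - by rewrite -a -b !eqxx.
  - by rewrite -a -b !eqxx orbT.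
  - by move: xy; rewrite -a -b eqxx.
apply: (@le_trans _ _ (\sum_(e | light e) 2)); last first.
  rewrite sumr_const -[leLHS]mulr_natr -mulrA ler_wpM2l//.
  have := card_light tl hd Phi eta0 kappa0 S.
  by rewrite -ler_pdivlMr// natrM mulrAC.
apply: (@le_trans _ _ (\sum_(e | light e)
  \sum_(y in S) \sum_(x in S) (joins x y e && (x != y))%:R)); last first.
  by apply: ler_sum.
rewrite [leRHS]exchange_big/=; apply: ler_sum => y yS.
rewrite [leRHS]exchange_big/=; apply: ler_sum => x xS.
case: (boolP (x != y)) => xy; rewrite ?andbF ?andbT; last first.
  by apply: sumr_ge0 => e _; rewrite ler0n.
case: asboolP => [/existsNP[e /not_implyP[je we]]|_]; last first.
  by apply: sumr_ge0 => e _; rewrite ler0n.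
rewrite (bigD1 e)/=.
  by rewrite je/= lerDl; apply: sumr_ge0 => e' _; rewrite ler0n.
rewrite /light lt_neqAle max_weight_le1// andbT; apply/andP; split; last exact/eqP.
move/eqP/finset.setP: je => h; rewrite /inside; move: (h (tl e)) (h (hd e)).
rewrite !inE !eqxx orbT/= => /esym/orP[/eqP->|/eqP->] /esym/orP[/eqP->|/eqP->];
  by rewrite ?xS ?yS.
Qed.

Variable m : nat.
Local Notation K := ('I_m + 'I_m)%type.

Definition lset (u : {ffun K -> 'I_n}) : {set 'I_n} := [set u (inl i) | i : 'I_m].
Definition rset (u : {ffun K -> 'I_n}) : {set 'I_n} := [set u (inr i) | i : 'I_m].

Definition good_pair (x y : 'I_n) (u : {ffun K -> 'I_n}) : Prop :=
  [/\ heavy (x |: (y |: lset u)) x y, heavy (x |: (y |: rset u)) x y &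
      extendable (x |: (y |: (lset u :|: rset u))) x y].

(** Both ends and both groups form one map on an index type, to which exchangeability applies: the
    ends become a random pair of elements of the image. *)
Definition tuple_of x y (u : {ffun K -> 'I_n}) : {ffun option (option K) -> 'I_n} :=
  [ffun o => match o with None => x | Some None => y | Some (Some c) => u c end].

Definition bad_pair x y u : bool :=
  injectiveb (tuple_of x y u) && `[< ~ good_pair x y u >].

(** The first term is 2 k / (kappa (m + 1)) for each of the two heaviness conditions. The second is
    12 kappa k times (2m + 2) / (2m + 1) <= 2, for extendability. *)
Definition bad_density : R := 4 * (k%:R / (kappa * m.+1%:R)) + 24 * kappa * k%:R.

(** A union bound over the three ways to be bad. [exchange_count] is applied with the two ends and
    the left group, the two ends and the right group, and the whole index type. *)
Lemma sum_bad_pair :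
  \sum_x \sum_y #|[pred u | bad_pair x y u]|%:R
    <= bad_density * (n ^ (2 * m + 2))%:R :> R.
Proof.
pose I : finType := option (option K).
pose i0 : I := None; pose j0 : I := Some None.
pose Jl : {set I} := i0 |: (j0 |: [set Some (Some (inl i)) | i : 'I_m]).
pose Jr : {set I} := i0 |: (j0 |: [set Some (Some (inr i)) | i : 'I_m]).
have cI : #|I| = (2 * m + 2)%N.
  by rewrite !card_option card_sum !card_ord; lia.
have cardJ (f : 'I_m -> K) : injective f ->
    #|i0 |: (j0 |: [set Some (Some (f i)) | i : 'I_m])| = m.+2.
  move=> fI; rewrite !cardsU1 card_imset; last by move=> a b [] /fI.
  rewrite card_ord !inE/=.
  by rewrite !(introF imsetP) // => -[].
have cJl : #|Jl| = m.+2 by apply: cardJ => a b [].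
have cJr : #|Jr| = m.+2 by apply: cardJ => a b [].
pose Bh (S : {set 'I_n}) x y := `[< ~ heavy S x y >].
pose Be (S : {set 'I_n}) x y := `[< ~ extendable S x y >].
pose cnt (J : {set I}) (B : {set 'I_n} -> 'I_n -> 'I_n -> bool) : R :=
  #|[pred v : {ffun I -> 'I_n} | injectiveb v && B (v @: J) (v i0) (v j0)]|%:R.
have heavyJ (J : {set I}) : #|J| = m.+2 -> i0 \in J -> j0 \in J ->
    cnt J Bh <= 2 * (k%:R / (kappa * m.+1%:R)) * (n ^ (2 * m + 2))%:R.
  move=> cJ iJ jJ; have h2 : 0 < m.+2%:R * m.+1%:R :> R by rewrite mulr_gt0.
  rewrite -(ler_pM2l h2).
  have := @exchange_count R _ _ J i0 j0 Bh (2 * (k%:R / kappa) * m.+2%:R) iJ jJ.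
  rewrite cJ cI card_ord natrM => /(_ isT) h.
  apply: le_trans (h _ _) _.
  - by rewrite !mulr_ge0// ltW// invr_gt0.
  - by move=> S <-; exact: sum_not_heavy.
  - rewrite le_eqVlt; apply/orP; left; apply/eqP; field.
    by rewrite (gt_eqF kappa0) andbT nat1r pnatr_eq0.
have extJ : cnt [set: I]%SET Be <= 24 * kappa * k%:R * (n ^ (2 * m + 2))%:R.
  have cT : #|[set: I]%SET| = (2 * m).+2 by rewrite cardsT cI addn2.
  have h2 : 0 < (2 * m).+2%:R * (2 * m).+1%:R :> R by rewrite mulr_gt0.
  rewrite -(ler_pM2l h2).
  have := @exchange_count R _ _ [set: I]%SET i0 j0 Be (12 * kappa * k%:R * (2 * m).+2%:R ^+ 2)
    (finset.in_setT _) (finset.in_setT _).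
  rewrite cT cI card_ord natrM => /(_ isT) h.
  apply: le_trans (h _ _) _.
  - by rewrite !mulr_ge0// ltW.
  - move=> S <-; apply: le_trans (sum_not_extendable Phi slot_inj eta0 kappa0 S).
    apply: ler_sum => y _; apply: ler_sum => x _; rewrite /Be ler_nat.
    by case: (`[< _ >]); case: (x != y).
  - rewrite [leRHS]mulrA ler_wpM2r//.
    have -> : 12 * kappa * k%:R * (2 * m).+2%:R ^+ 2 =
      (12 * kappa * k%:R * (2 * m).+2%:R) * (2 * m).+2%:R by ring.
    have -> : (2 * m).+2%:R * (2 * m).+1%:R * (24 * kappa * k%:R) =
      (12 * kappa * k%:R * (2 * m).+2%:R) * (2 * (2 * m).+1%:R) by ring.
    rewrite ler_wpM2l//; first by rewrite !mulr_ge0// ltW.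
    by rewrite -natrM ler_nat; lia.
have imJ (f : 'I_m -> K) x y (u : {ffun K -> 'I_n}) :
    tuple_of x y u @: (i0 |: (j0 |: [set Some (Some (f i)) | i : 'I_m])) =
    x |: (y |: [set u (f i) | i : 'I_m]).
  rewrite !imsetU1 !ffunE; congr (_ |: (_ |: _)); rewrite -imset_comp.
  by apply: eq_imset => i; rewrite /= ffunE.
have imT x y (u : {ffun K -> 'I_n}) :
    tuple_of x y u @: [set: I]%SET = x |: (y |: (lset u :|: rset u)).
  apply/finset.setP => z; apply/imsetP/idP => [[[[[i|i]|]|] _ ->]|].
  - have ul : u (inl i) \in lset u by apply/imsetP; exists i.
    by rewrite ffunE !inE ul !orbT.
  - have ur : u (inr i) \in rset u by apply/imsetP; exists i.
    by rewrite ffunE !inE ur !orbT.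
  - by rewrite ffunE !inE eqxx orbT.
  - by rewrite ffunE !inE eqxx.
  - rewrite !inE => /or4P[/eqP->|/eqP->|/imsetP[i _ ->]|/imsetP[i _ ->]].
    + by exists i0; rewrite ?ffunE.
    + by exists j0; rewrite ?ffunE.
    + by exists (Some (Some (inl i))); rewrite ?ffunE.
    + by exists (Some (Some (inr i))); rewrite ?ffunE.
apply: (@le_trans _ _ (cnt Jl Bh + cnt Jr Bh + cnt [set: I]%SET Be)); last first.
  have := heavyJ Jl cJl; have := heavyJ Jr cJr; rewrite !inE !eqxx ?orbT.
  move=> /(_ isT isT) h1 /(_ isT isT) h2.
  apply: le_trans (lerD (lerD h2 h1) extJ) _; rewrite -!mulrDl /bad_density.
  by rewrite le_eqVlt; apply/orP; left; apply/eqP; congr (_ * _); ring.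
rewrite /cnt !natr_card -!big_split/=.
pose h (z : ('I_n * 'I_n) * {ffun K -> 'I_n}) := tuple_of z.1.1 z.1.2 z.2.
pose h' (v : {ffun I -> 'I_n}) := ((v i0, v j0), [ffun c => v (Some (Some c))]).
have hK : cancel h h'.
  by move=> [[x y] u]; rewrite /h' /h !ffunE; congr pair; apply/ffunP => c; rewrite !ffunE.
have h'K : cancel h' h.
  by move=> v; apply/ffunP => -[[c|]|]; rewrite /h !ffunE.
rewrite [leRHS](reindex h)/=; last by exists h' => ? _; [exact: hK|exact: h'K].
under eq_bigr => x _ do under eq_bigr => y _ do rewrite natr_card.
under eq_bigr => x _ do rewrite pair_big/=.
rewrite pair_big/= [leLHS](reindex (fun z : ('I_n * 'I_n) * {ffun K -> 'I_n} =>
  (z.1.1, (z.1.2, z.2))))/=; last first.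
  by exists (fun z => ((z.1, z.2.1), z.2.2)) => [[[x y] u]|[x [y u]]].
apply: ler_sum => -[[x y] u] _ /=.
rewrite /h/= /bad_pair /Jl /Jr !imJ imT !ffunE -/(lset u) -/(rset u).
case: (injectiveb _) => //=; rewrite ?addr0//.
case: asboolP => [ng|_]; last by rewrite !addr_ge0 ?ler0n.
rewrite /Bh /Be; case: asboolP => [_|/contrapT g1].
  by rewrite -addrA lerDl addr_ge0 ?ler0n.
case: asboolP => [_|/contrapT g2].
  by rewrite add0r lerDl ler0n.
case: asboolP => [_|/contrapT g3]; first by rewrite !add0r.
by case: ng.
Qed.

End bad_tuples.

(** * Permutations that admit a chain of groups *)

Section good_permutations.
Variables (R : realType) (k n : nat) (E : finType).
Variables (tl hd : E -> 'I_n) (Phi : 'I_k -> E -> R).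
Hypothesis tl_hd : forall e, tl e != hd e.
Hypothesis slot_inj : forall e e',
  [set tl e; hd e]%SET = [set tl e'; hd e']%SET -> e = e'.
Variables (eta kappa : R).
Hypothesis eta0 : 0 < eta.
Hypothesis kappa0 : 0 < kappa.

Local Notation heavy := (heavy tl hd Phi eta kappa).
Local Notation extendable := (extendable tl hd Phi eta kappa).

Variables (m q J C : nat).
Local Notation K := ('I_m + 'I_m)%type.
Local Notation bad_pair := (@bad_pair R k n E tl hd Phi eta kappa m).
Local Notation bad_density := (bad_density k kappa m).

Variables (px py : 'I_n) (pos : nat -> 'I_C -> 'I_m -> 'I_n).
Hypothesis pxy : px != py.
Hypothesis pos_inj : forall j j' c c' i i', (j <= J)%N -> (j' <= J)%N ->
  pos j c i = pos j' c' i' -> [/\ j = j', c = c' & i = i'].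
Hypothesis pos_px : forall j c i, (j <= J)%N -> pos j c i != px.
Hypothesis pos_py : forall j c i, (j <= J)%N -> pos j c i != py.

Definition group (p : 'S_n) j c : {set 'I_n} := [set p (pos j c i) | i : 'I_m].

Definition has_chain (p : 'S_n) : Prop := exists ch : nat -> 'I_C,
  (forall j, (j <= J)%N ->
     heavy (p px |: (p py |: group p j (ch j))) (p px) (p py)) /\
  (forall j, (j < J)%N -> extendable
     (p px |: (p py |: (group p j (ch j) :|: group p j.+1 (ch j.+1))))
     (p px) (p py)).

Let tup (p : 'S_n) j c c' : {ffun K -> 'I_n} :=
  [ffun s => match s with inl i => p (pos j c i) | inr i => p (pos j.+1 c' i) end].

Variable beta : R.
Hypothesis beta0 : 0 < beta.

Let M : R := (n ^ (2 * m))%:R.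
(** Ends for which more than a share beta of the pairs of groups is bad. They are set apart, by
    Markov's inequality, because several bad pairs behave independently only once the ends are
    fixed. *)
Let wide x y : bool := beta * M < #|[pred u | bad_pair x y u]|%:R.

Let N0 : (0 < n)%N. Proof. by case: n px => // -[]. Qed.

Let M0 : 0 < M. Proof. by rewrite ltr0n expn_gt0 N0. Qed.

Let bad_density_ge0 : 0 <= bad_density.
Proof. by rewrite addr_ge0// !mulr_ge0// ?invr_ge0 ?mulr_ge0// ltW. Qed.

Let card_wide : #|[pred z | wide z.1 z.2]|%:R <= bad_density / beta * (n ^ 2)%:R.
Proof.
have := sum_bad_pair Phi tl_hd slot_inj eta0 kappa0 m.
rewrite pair_big/= expnD natrM -/M mulrA mulrAC => h.
rewrite mulrAC ler_pdivlMr// -(ler_pM2r M0); apply: le_trans h.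
rewrite (natr_card R (fun z => wide z.1 z.2)) !mulr_suml; apply: ler_sum => -[x y] _ /=.
by have [wxy|_] := boolP (wide x y); rewrite ?mul0r// mul1r ltW.
Qed.

Let card_perm_wide : (8 <= n)%N ->
  #|[pred p : 'S_n | wide (p px) (p py)]|%:R <= 2 * (bad_density / beta) * n`!%:R.
Proof.
move=> n8.
have := @card_perm_determined _ _ [set px; py]%SET (fun p : 'S_n => (p px, p py))
  (fun z => wide z.1 z.2).
rewrite cards2 pxy card_ord => /(_ _)/= h.
have {}h : (#|[pred p : 'S_n | wide (p px) (p py)]| <=
    #|[pred z | wide z.1 z.2]| * (n - 2)`!)%N.
  by apply: h => p p' [? ?] i; rewrite !inE => /orP[] /eqP->.
have := expn_fact_le N0 (_ : (2 * 2 ^ 2 <= n)%N) => /(_ n8) h2.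
rewrite -(ler_nat R) natrM in h; apply: le_trans h _.
apply: le_trans (ler_wpM2r _ card_wide) _ => //.
rewrite [leRHS](_ : _ = bad_density / beta * (2 * n`!)%:R); last first.
  by rewrite natrM; ring.
rewrite -[leLHS](mulrA (bad_density / beta)) -natrM.
by rewrite ler_wpM2l ?ler_nat// divr_ge0// ltW.
Qed.

(** For a fixed matching the q pairs of groups occupy disjoint positions. Given ends that are not
    wide, each pair is bad with probability at most beta, and [expn_fact_le] accounts for the factor
    2. *)
Let card_perm_matching j (f g : {ffun 'I_q -> 'I_C}) :
  (j < J)%N -> injective f -> injective g ->
  (2 * (2 * m * q + 2) ^ 2 <= n)%N ->
  #|[pred p : 'S_n | ~~ wide (p px) (p py) &&
      [forall i, bad_pair (p px) (p py) (tup p j (f i) (g i))]]|%:R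
  <= 2 * beta ^+ q * n`!%:R.
Proof.
move=> jJ fI gI hn.
pose Q (z : ('I_n * 'I_n) * {ffun 'I_q -> {ffun K -> 'I_n}}) :=
  ~~ wide z.1.1 z.1.2 && [forall i, bad_pair z.1.1 z.1.2 (z.2 i)].
pose gm (p : 'S_n) := ((p px, p py), [ffun i => tup p j (f i) (g i)]).
pose posf (z : 'I_q * K) := match z.2 with
  | inl i => pos j (f z.1) i | inr i => pos j.+1 (g z.1) i end.
have posfI : injective posf.
  have ltj := ltnW jJ; move=> [a [i|i]] [b [i'|i']]; rewrite /posf/=.
  - by move=> /(pos_inj ltj ltj)[_ /fI-> ->].
  - by move=> /(pos_inj ltj jJ)[/eqP]; rewrite ltn_eqF.
  - by move=> /(pos_inj jJ ltj)[/eqP]; rewrite gtn_eqF.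
  - by move=> /(pos_inj jJ jJ)[_ /gI-> ->].
pose D := px |: (py |: [set posf z | z : 'I_q * K]).
have cD : #|D| = (2 * m * q + 2)%N.
  rewrite /D !cardsU1 card_imset// card_prod card_sum !card_ord !inE (negPf pxy)/=.
  rewrite !(introF imsetP).
  - by lia.
  - by move=> [[a [i|i]] _ /esym/eqP]; apply/negP; rewrite ?pos_py// ltnW.
  - by move=> [[a [i|i]] _ /esym/eqP]; apply/negP; rewrite ?pos_px// ltnW.
have h : (#|[pred p | Q (gm p)]| <= #|Q| * (n - (2 * m * q + 2))`!)%N.
  rewrite -cD -[X in (X - _)%N]card_ord; apply: card_perm_determined => p p' pp'.
  have [e1 e2 e3] : [/\ p px = p' px, p py = p' py &
      forall z, p (posf z) = p' (posf z)].
    case: pp' => e1 e2 /ffunP e3; split => // -[a s].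
    have := e3 a; rewrite !ffunE => /ffunP/(_ s); rewrite !ffunE.
    by case: s.
  by move=> i; rewrite !inE => /or3P[/eqP->|/eqP->|/imsetP[z _ ->]].
have cQ : #|Q|%:R <= (n ^ 2)%:R * (beta * M) ^+ q.
  have -> : (n ^ 2)%:R * (beta * M) ^+ q =
      \sum_(z : 'I_n * 'I_n) (beta * M) ^+ q.
    by rewrite sumr_const card_prod card_ord mulnn -[RHS]mulr_natl.
  rewrite natr_card -(pair_bigA _ (fun z U => (Q (z, U))%:R))/=.
  apply: ler_sum => -[x y] _.
  have [wxy|nwxy] := boolP (wide x y).
    rewrite big1; first by rewrite exprn_ge0// mulr_ge0// ltW.
    by move=> U _; rewrite /Q/= wxy.
  rewrite -natr_card.
  have -> : #|[pred U | Q (x, y, U)]| = (#|[pred u | bad_pair x y u]| ^ q)%N.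
    rewrite -[X in (_ ^ X)%N]card_ord -card_ffun_on; apply: eq_card => U.
    rewrite !inE /Q/= nwxy/=; apply/forallP/ffun_onP => hU i; have := hU i;
      by rewrite !inE.
  rewrite natrX; apply: lerXn2r; rewrite ?nnegrE ?ler0n//.
    by rewrite mulr_ge0// ltW.
  by rewrite leNgt.
have h2 := expn_fact_le N0 hn.
have h' : #|[pred p | Q (gm p)]|%:R <=
    (n ^ 2)%:R * (beta * M) ^+ q * (n - (2 * m * q + 2))`!%:R :> R.
  move: h; rewrite -(ler_nat R) natrM => /le_trans; apply.
  by rewrite ler_wpM2r.
have -> : #|[pred p : 'S_n | ~~ wide (p px) (p py) &&
      [forall i, bad_pair (p px) (p py) (tup p j (f i) (g i))]]|
    = #|[pred p | Q (gm p)]|.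
  apply: eq_card => p; rewrite !inE /Q/=; congr (_ && _).
  by apply: eq_forallb => i; rewrite ffunE.
apply: le_trans h' _.
rewrite [leRHS](_ : _ = beta ^+ q * (2 * n`!)%:R); last by rewrite natrM; ring.
rewrite [leLHS](_ : _ = beta ^+ q * (n ^ (2 * m * q + 2) * (n - (2 * m * q + 2))`!)%:R).
  by rewrite ler_wpM2l ?ler_nat// exprn_ge0// ltW.
by rewrite exprMn /M natrM expnD natrM !natrX -exprM; ring.
Qed.

(* Choose in every block a group outside the two small covers given by the
   pairs of blocks on its left and on its right. *)
Let chain_or_matching (p : 'S_n) : (0 < J)%N -> (2 * q <= C.+1)%N -> (0 < q)%N ->
  has_chain p \/ exists (j : 'I_J) (f g : {ffun 'I_q -> 'I_C}),
   [/\ injective f, injective g &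
    forall i, bad_pair (p px) (p py) (tup p j (f i) (g i))].
Proof.
move=> J0 qC q0.
have [ex|nex] := pselect (exists (j : 'I_J) (f g : {ffun 'I_q -> 'I_C}),
   [/\ injective f, injective g &
    forall i, bad_pair (p px) (p py) (tup p j (f i) (g i))]); first by right.
left.
have cov j : exists SS : {set 'I_C} * {set 'I_C},
    [/\ (#|SS.1| < q)%N, (#|SS.2| < q)%N & (j < J)%N -> forall a b,
    bad_pair (p px) (p py) (tup p j a b) -> (a \in SS.1) || (b \in SS.2)].
  have [jJ|Jj] := ltnP j J; last first.
    by exists (finset.set0, finset.set0); rewrite cards0.
  have [[f [g [fI gI fg]]]|[S [S' [Sq S'q h]]]] :=
      matching_or_cover (fun a b => bad_pair (p px) (p py) (tup p j a b)) q.
    exfalso; apply: nex; exists (Ordinal jJ), (finfun f), (finfun g); split.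
    - by move=> a b; rewrite !ffunE => /fI.
    - by move=> a b; rewrite !ffunE => /gI.
    - by move=> i; rewrite !ffunE.
  by exists (S, S').
have [SS hSS] := choice cov.
(* Group j is the left member of pair j and the right member of pair j - 1, so it has to avoid one
   cover of each. Two covers of fewer than q groups leave one over, as 2 q - 2 < C. At j = 0 the
   truncated predecessor only excludes more groups. *)
pose T j := (SS j).1 :|: (SS j.-1).2.
have exc j : exists c : 'I_C, c \notin T j.
  have [hj1 _ _] := hSS j; have [_ hj2 _] := hSS j.-1.
  have : (#|T j| < #|'I_C|)%N.
    rewrite card_ord (leq_ltn_trans (leq_card_setU _ _))//.
    by move: hj1 hj2 => /=; lia.
  move=> cT; apply/existsP; rewrite -negb_forall; apply: contraL cT => /forallP cT.
  by rewrite -leqNgt subset_leq_card//; apply/fintype.subsetP => c _; rewrite cT.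
have [ch hch] := choice exc.
have good j : (j < J)%N -> good_pair tl hd Phi eta kappa (p px) (p py) (tup p j (ch j) (ch j.+1)).
  move=> jJ; apply: contrapT => ng.
  have [_ _ /(_ jJ (ch j) (ch j.+1))] := hSS j.
  have := hch j; have := hch j.+1; rewrite !inE !negb_or/=.
  move=> /andP[_ /negPf->] /andP[/negPf-> _] /(_ _)/wrap[]//.
  apply/andP; split; last exact/asboolP.
  have tE o : tuple_of (p px) (p py) (tup p j (ch j) (ch j.+1)) o =
    p (match o with None => px | Some None => py | Some (Some (inl i)) => pos j (ch j) i
       | Some (Some (inr i)) => pos j.+1 (ch j.+1) i end).
    by rewrite ffunE; case: o => [[[i|i]|]|]//; rewrite ffunE.
  apply/injectiveP => a b; rewrite !tE => /perm_inj.
  have ltj := ltnW jJ.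
  case: a b => [[[i|i]|]|] [[[i'|i']|]|]//.
  - by move=> /(pos_inj ltj ltj)[_ _ ->].
  - by move=> /(pos_inj ltj jJ)[/eqP]; rewrite ltn_eqF.
  - by move=> /eqP; rewrite (negPf (pos_py _ _ ltj)).
  - by move=> /eqP; rewrite (negPf (pos_px _ _ ltj)).
  - by move=> /(pos_inj jJ ltj)[/eqP]; rewrite gtn_eqF.
  - by move=> /(pos_inj jJ jJ)[_ _ ->].
  - by move=> /eqP; rewrite (negPf (pos_py _ _ jJ)).
  - by move=> /eqP; rewrite (negPf (pos_px _ _ jJ)).
  - by move=> /eqP; rewrite eq_sym (negPf (pos_py _ _ ltj)).
  - by move=> /eqP; rewrite eq_sym (negPf (pos_py _ _ jJ)).
  - by move=> /eqP; rewrite eq_sym (negPf pxy).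
  - by move=> /eqP; rewrite eq_sym (negPf (pos_px _ _ ltj)).
  - by move=> /eqP; rewrite eq_sym (negPf (pos_px _ _ jJ)).
  - by move=> /eqP; rewrite (negPf pxy).
have lsetE j c c' : lset (tup p j c c') = group p j c.
  by apply: eq_imset => i; rewrite ffunE.
have rsetE j c c' : rset (tup p j c c') = group p j.+1 c'.
  by apply: eq_imset => i; rewrite ffunE.
exists ch; split => [j jJ|j jJ].
  have [jJ'|Jj] := ltnP j J.
    by have [+ _ _] := good j jJ'; rewrite lsetE.
  (* The last group opens no pair; its heaviness comes from the right half of the pair before it. *)
  have jE : j = J.-1.+1 by lia.
  have jJ1 : (J.-1 < J)%N by rewrite prednK.
  by have [_ + _] := good J.-1 jJ1; rewrite rsetE jE.
by have [_ _] := good j jJ; rewrite lsetE rsetE.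
Qed.

(** A union bound over the wide ends, the J consecutive pairs of blocks, and the at most C^q times
    C^q choices of the two sides of a matching. *)
Lemma card_not_chain : (0 < J)%N -> (2 * q <= C.+1)%N -> (0 < q)%N ->
  (8 <= n)%N -> (2 * (2 * m * q + 2) ^ 2 <= n)%N ->
  #|[pred p : 'S_n | `[< ~ has_chain p >]]|%:R <=
  (2 * (bad_density / beta) + J%:R * (C ^ (2 * q))%:R * (2 * beta ^+ q)) * n`!%:R.
Proof.
move=> J0 qC q0 n8 hn.
apply: (@le_trans _ _ (#|[pred p : 'S_n | wide (p px) (p py)]|%:R +
  \sum_(j < J) \sum_(f : {ffun 'I_q -> 'I_C}) \sum_(g : {ffun 'I_q -> 'I_C})
  (if injectiveb f && injectiveb g then
  #|[pred p : 'S_n | ~~ wide (p px) (p py) &&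
      [forall i, bad_pair (p px) (p py) (tup p j (f i) (g i))]]|%:R else 0))).
  pose B (p : 'S_n) (j : 'I_J) (f g : {ffun 'I_q -> 'I_C}) : R :=
    if injectiveb f && injectiveb g then (~~ wide (p px) (p py) &&
      [forall i, bad_pair (p px) (p py) (tup p j (f i) (g i))])%:R else 0.
  have B0 p j f g : 0 <= B p j f g by rewrite /B; case: ifP.
  rewrite [leRHS](_ : _ = \sum_(p : 'S_n) ((wide (p px) (p py))%:R +
      \sum_j \sum_f \sum_g B p j f g)); last first.
    rewrite big_split/= -natr_card; congr (_ + _).
    rewrite [RHS]exchange_big; apply: eq_bigr => j _.
    rewrite [RHS]exchange_big; apply: eq_bigr => f _.
    rewrite [RHS]exchange_big; apply: eq_bigr => g _.
    rewrite /B; case: ifP => _; last by rewrite big1.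
    by rewrite natr_card.
  rewrite natr_card; apply: ler_sum => p _.
  have S0 : 0 <= \sum_j \sum_f \sum_g B p j f g.
    by do 3! apply: sumr_ge0 => ? _.
  rewrite /=; case: asboolP => [nch|_]; last by rewrite addr_ge0.
  have [wp|nwp] := boolP (wide (p px) (p py)); first by rewrite lerDl.
  rewrite add0r; case: (chain_or_matching p J0 qC q0) => // -[j [f [g [fI gI fg]]]].
  have le1 (I : finType) (F : I -> R) i : (forall i, 0 <= F i) -> F i <= \sum_i F i.
    by move=> F0; rewrite (bigD1 i)//= lerDl; apply: sumr_ge0.
  apply: (@le_trans _ _ (B p j f g)).
    rewrite /B; move/injectiveP: fI => ->; move/injectiveP: gI => ->.
    by rewrite nwp/=; have -> : [forall i, bad_pair (p px) (p py) (tup p j (f i) (g i))]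
      by exact/forallP.
  apply: le_trans (le1 _ (fun g => B p j f g) g (B0 p j f)) _.
  apply: le_trans (le1 _ (fun f => \sum_g B p j f g) f _) _.
    by move=> f'; apply: sumr_ge0.
  apply: (le1 _ (fun j => \sum_f \sum_g B p j f g) j) => j'.
  by do 2! apply: sumr_ge0 => ? _.
rewrite [leRHS]mulrDl lerD//; first exact: card_perm_wide.
have b0 : 0 <= 2 * beta ^+ q * n`!%:R.
  by rewrite !mulr_ge0// exprn_ge0// ltW.
rewrite [leRHS](_ : _ = \sum_(j < J) \sum_(f : {ffun 'I_q -> 'I_C})
    \sum_(g : {ffun 'I_q -> 'I_C}) 2 * beta ^+ q * n`!%:R).
  apply: ler_sum => j _; apply: ler_sum => f _; apply: ler_sum => g _.
  by case: ifPn => // /andP[/injectiveP fI /injectiveP gI]; exact: card_perm_matching.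
rewrite !sumr_const !card_ffun !card_ord -!mulrnA -[RHS]mulr_natr.
by rewrite mul2n -addnn expnD mulnA (natrM R _ J); ring.
Qed.

End good_permutations.

(** Testing the hypothesis on the kernel of M puts b in the row space, say b = z M. The coefficients
    <a_e, z> then have squares adding up to S = z M z^T = <b, z>, and the hypothesis at z reads S^2
    <= r S. *)
Lemma bounded_functional_comb (R : realFieldType) (N : nat) (E : finType)
    (b : 'rV[R]_N) (a : E -> 'rV[R]_N) (L : pred E) (r : R) :
  0 <= r ->
  (forall x : 'rV[R]_N, (b *m x^T) 0 0 ^+ 2 <=
     r * \sum_(e | L e) (a e *m x^T) 0 0 ^+ 2) ->
  exists2 f : E -> R, b = \sum_(e | L e) f e *: a e &
    \sum_(e | L e) f e ^+ 2 <= r.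
Proof.
move=> r0 hb; pose M := \sum_(e | L e) (a e)^T *m a e.
have quad (x : 'rV[R]_N) : (x *m M *m x^T) 0 0 = \sum_(e | L e) (a e *m x^T) 0 0 ^+ 2.
  rewrite mulmx_sumr mulmx_suml summxE; apply: eq_bigr => e _.
  rewrite mulmxA -mulmxA mxE big_ord1 expr2; congr (_ * _).
  by rewrite -[x in LHS]trmxK -trmx_mul mxE.
have : (b <= M)%MS.
  rewrite submxE; apply/eqP/matrixP => i j; rewrite ord1 [RHS]mxE.
  pose c := (col j (cokermx M))^T.
  have Mc : M *m c^T = 0 by rewrite trmxK colE mulmxA mulmx_coker mul0mx.
  have := hb c; rewrite -quad -mulmxA Mc mulmx0 [X in _ * X]mxE mulr0 => b0.
  have : (b *m c^T) 0 0 = 0.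
    by apply/eqP; rewrite -sqrf_eq0 eq_le b0 sqr_ge0.
  move=> <-; rewrite [LHS]mxE [RHS]mxE; apply: eq_bigr => i' _.
  by rewrite trmxK [in RHS]mxE.
move=> /submxP[z bz].
exists (fun e => (a e *m z^T) 0 0).
  rewrite bz mulmx_sumr; apply: eq_bigr => e _.
  rewrite mulmxA [z *m _]mx11_scalar mul_scalar_mx; congr (_ *: _).
  by rewrite -[z in LHS]trmxK -trmx_mul mxE.
rewrite -quad; have := hb z; rewrite -quad -bz.
set S := (b *m z^T) 0 0 => hS.
have S0 : 0 <= S.
  by rewrite /S bz quad; apply: sumr_ge0 => *; exact: sqr_ge0.
have [->|SN0] := eqVneq S 0.
  exact: r0.
by rewrite -(@ler_pM2r _ S) ?lt_def ?SN0// -expr2.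
Qed.

(** * The groups on the way between the two ends of the crossing slot *)

Section positions.
Variables (R : realType) (n s l h k C m : nat).
Variables (tl hd : 'I_('C(n, 2)) -> 'I_n) (Phi : 'M[R]_(k, 'C(n, 2))).
Hypothesis orient : edge_orientation tl hd.
Hypothesis s0 : (0 < s)%N.
Hypothesis h3 : (3 <= h)%N.
Hypothesis lE : l = (2 * h)%N.
Hypothesis nE : n = (s * l)%N.

Lemma orientation_neq e : tl e != hd e. Proof. by case: orient. Qed.

Lemma orientation_inj e e' :
  [set tl e; hd e]%SET = [set tl e'; hd e']%SET -> e = e'.
Proof.
case: orient => tlhd ex ee'; have [e1 [_ u]] := ex _ _ (tlhd e').
by rewrite -(u e ee') -(u e' erefl).
Qed.

Let h0 : (0 < h)%N. Proof. exact: leq_trans h3. Qed.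
Let n0 : (0 < n)%N. Proof. by rewrite nE lE !muln_gt0 s0 h0. Qed.
Let n2 : (s * h < n)%N. Proof. by rewrite nE lE ltn_pmul2l// ltn_Pmull. Qed.

Definition first_pos : 'I_n := Ordinal n0.
Definition mid_pos : 'I_n := Ordinal n2.
(** The index is shifted by one block because block 0 contains an end: groups 0, ..., h - 2 lie in
    blocks 1, ..., h - 1, and the other end opens block h. In this range the number is a valid
    position, so the default of [insubd] does not occur. *)
Definition group_pos (j : nat) (c : 'I_C) (i : 'I_m) : 'I_n :=
  insubd first_pos (s * j.+1 + c * m + i)%N.

Local Notation J := h.-2.

Hypothesis mC : (m * C <= s)%N.

Let offset (c : 'I_C) (i : 'I_m) : (c * m + i < s)%N.
Proof. by have := ltn_ord c; have := ltn_ord i; nia. Qed.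

Lemma group_posE j c i : (j <= J)%N -> val (group_pos j c i) = (s * j.+1 + (c * m + i))%N.
Proof.
move=> jJ; rewrite val_insubd addnA ifT//; have := offset c i.
have : (j.+2 <= h)%N by lia.
by rewrite nE lE -addnA; nia.
Qed.

Let divE j c i : (j <= J)%N -> (group_pos j c i %/ s)%N = j.+1.
Proof.
by move=> jJ; rewrite group_posE// mulnC divnMDl// divn_small ?addn0.
Qed.

Lemma group_pos_inj j j' c c' i i' : (j <= J)%N -> (j' <= J)%N ->
  group_pos j c i = group_pos j' c' i' -> [/\ j = j', c = c' & i = i'].
Proof.
move=> jJ jJ' e.
have jj : j = j' by have := divE c i jJ; rewrite e divE// => -[].
have : val (group_pos j c i) = val (group_pos j' c' i') by rewrite e.
rewrite !group_posE// -jj => /addnI e'.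
have m0 : (0 < m)%N by exact: leq_ltn_trans (leq0n _) (ltn_ord i).
have cc : c = c'.
  apply: val_inj; have : ((c * m + i) %/ m = (c' * m + i') %/ m)%N by rewrite e'.
  by rewrite !divnMDl// !divn_small// !addn0.
by split => //; apply/val_inj/eqP; rewrite -(eqn_add2l (c * m)) e' cc.
Qed.

Lemma group_pos_first j c i : (j <= J)%N -> group_pos j c i != first_pos.
Proof.
move=> jJ; apply/eqP => e; have := divE c i jJ; rewrite e/= div0n//.
Qed.

Lemma group_pos_mid j c i : (j <= J)%N -> group_pos j c i != mid_pos.
Proof.
move=> jJ; apply/eqP => e; have := divE c i jJ; rewrite e/= mulKn//; lia.
Qed.

Lemma first_mid : first_pos != mid_pos.
Proof.
by apply/eqP => -[] /esym/eqP; rewrite muln_eq0 !gtn_eqF.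
Qed.

Lemma crossingE p e : crossing tl hd p e = joins tl hd (p first_pos) (p mid_pos) e.
Proof.
have n2E : n./2 = (s * h)%N by rewrite nE lE mulnCA mul2n doubleK.
apply/existsP/idP => [[i /existsP[j /and3P[/eqP i0 /eqP j0 ij]]]|je].
  have -> : first_pos = i by apply: val_inj.
  by have -> : mid_pos = j by apply: val_inj; rewrite /= j0 n2E.
exists first_pos; apply/existsP; exists mid_pos.
by rewrite /= n2E !eqxx.
Qed.

Lemma has_crossing p : exists e, crossing tl hd p e.
Proof.
case: orient => _ /(_ (p first_pos) (p mid_pos)); rewrite (inj_eq perm_inj).
by move=> /(_ first_mid)[e [/eqP pe _]]; exists e; rewrite crossingE.
Qed.

Lemma crossing_uniq p e e' : crossing tl hd p e -> crossing tl hd p e' -> e = e'.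
Proof. by rewrite !crossingE; apply: joins_uniq; exact: orientation_inj. Qed.

Let block_index (p : 'S_n) (u : 'I_n) : nat := ((p^-1)%g u %/ s)%N.

Let in_block p u i : (u \in block s p i) = (block_index p u == i).
Proof.
rewrite /block_index; apply/imsetP/eqP => [[j + ->]|<-].
  rewrite inE permK => /andP[h1 h2].
  by apply/eqP; rewrite eqn_leq leq_divRL// -ltnS ltn_divLR//; lia.
exists ((p^-1)%g u); last by rewrite permKV.
by rewrite inE (mulnC s) leq_divM/= -mulSnr ltn_ceil.
Qed.

Let group_index p j c u : (j <= J)%N -> u \in group group_pos p j c -> block_index p u = j.+1.
Proof.
by move=> jJ /imsetP[i _ ->]; rewrite /block_index permK divE.
Qed.

Let local_adj p e i : (i.+1 < l)%N ->
  [|| block_index p (tl e) == i | block_index p (tl e) == i.+1] ->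
  [|| block_index p (hd e) == i | block_index p (hd e) == i.+1] ->
  non_crossing s l tl hd p e.
Proof.
move=> il ti hi; apply/existsP.
have [tE|/negPf tN] := eqVneq (block_index p (tl e)) i; last first.
  move: ti; rewrite tN/= => /eqP tE.
  have [hE|/negPf hN] := eqVneq (block_index p (hd e)) i; last first.
    move: hi; rewrite hN/= => /eqP hE.
    by exists (Ordinal il); rewrite !in_block tE hE eqxx.
  by exists (Ordinal (ltnW il)); rewrite !in_block tE hE/= modn_small// !eqxx !orbT.
case/orP: hi => /eqP hE; exists (Ordinal (ltnW il)); rewrite !in_block tE hE/=.
  by rewrite eqxx.
by rewrite modn_small// !eqxx !orbT.
Qed.

Variables (eta kappa : R).
Hypothesis eta0 : 0 < eta.
Hypothesis kappa0 : 0 < kappa.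
Hypothesis kappa_le : kappa <= 2^-1.

Lemma has_chain_drop_le (p : 'S_n) e0 (X : 'M[R]_(k, n)) :
  has_chain tl hd Phi eta kappa J first_pos mid_pos group_pos p ->
  crossing tl hd p e0 ->
  drop tl hd Phi e0 X ^+ 2 <= 12 * kappa * h.-1%:R *
    (3 * (\sum_(e | non_crossing s l tl hd p e) drop tl hd Phi e X ^+ 2)
     + h.-1%:R * (eta * \sum_u sqnorm X u)).
Proof.
move=> [ch [hch1 hch2]]; rewrite crossingE => e0j.
have -> : h.-1 = J.+1 by lia.
apply: (chain_drop_le (A := fun j => group group_pos p j (ch j))
  (x := p first_pos) (y := p mid_pos) orientation_inj eta0 kappa0 kappa_le) => //.
- by rewrite (inj_eq perm_inj) first_mid.
- by lia.
- move=> j e jJ /andP[te he].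
  have two u : u \in group group_pos p j (ch j) :|: group group_pos p j.+1 (ch j.+1) ->
      (block_index p u == j.+1) || (block_index p u == j.+2).
    by rewrite inE => /orP[/(group_index (ltnW jJ))->|/(group_index jJ)->]; rewrite eqxx ?orbT.
  by apply: (@local_adj p e j.+1); [lia|exact: two|exact: two].
- move=> e.
  (* The block of the tail alone leaves at most two values of j. *)
  apply: (@leq_trans #|[pred j : 'I_J | (j.+1 == block_index p (tl e)) || (j.+2 == block_index p (tl e))]|).
    apply: subset_leq_card; apply/fintype.subsetP => j; rewrite !inE => /andP[+ _].
    rewrite inE => /orP[/group_index->|/group_index->]; rewrite ?eqxx ?orbT//.
    by rewrite ltnW.
  set b := block_index _ _.
  apply: (@leq_trans #|[pred j : 'I_J | val j \in [:: b.-1; b.-2]]|).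
    apply: subset_leq_card; apply/fintype.subsetP => j; rewrite !inE.
    by case/orP => /eqP <-; rewrite eqxx ?orbT.
  have cb (x y : nat) : (#|[pred j : 'I_J | val j \in [:: x; y]]| <= 2)%N.
    rewrite cardE -(size_map val); apply: (@uniq_leq_size _ _ [:: x; y]).
      by rewrite (map_inj_uniq val_inj) enum_uniq.
    by move=> _ /mapP[j + ->]; rewrite mem_enum.
  exact: cb.
- move=> e _ /andP[te he].
  have two u : u \in p first_pos |: group group_pos p 0 (ch 0%N) ->
      (block_index p u == 0%N) || (block_index p u == 1%N).
    rewrite inE => /orP[|/(group_index (leq0n _))->]; last by rewrite orbT.
    by rewrite inE => /eqP ->; rewrite /block_index permK/= div0n.
  by apply: (@local_adj p e 0%N); [lia|exact: two|exact: two].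
- move=> e _ /andP[te he].
  have two u : u \in p mid_pos |: group group_pos p J (ch J) ->
      (block_index p u == J.+1) || (block_index p u == J.+2).
    rewrite inE => /orP[|/(group_index (leqnn _))->]; last by rewrite eqxx.
    rewrite inE => /eqP ->; rewrite /block_index permK/= mulKn//.
    by apply/orP; right; apply/eqP; lia.
  by apply: (@local_adj p e J.+1); [lia|exact: two|exact: two].
Qed.

End positions.

Lemma drop_flow (R : realType) (k n : nat) (E : finType) (tl hd : E -> 'I_n)
    (Phi : 'I_k -> E -> R) (L : pred E) (e0 : E) (r : R) : 0 <= r ->
  (forall X, drop tl hd Phi e0 X ^+ 2 <= r * \sum_(e | L e) drop tl hd Phi e X ^+ 2) ->
  exists2 f : E -> R,
    slot_row tl hd Phi e0 = \sum_(e | L e) f e *: slot_row tl hd Phi e &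
    \sum_(e | L e) f e ^+ 2 <= r.
Proof.
move=> r0 h; apply: bounded_functional_comb => // x.
rewrite -(vec_mxK x) slot_rowE; under eq_bigr => e _ do rewrite slot_rowE.
exact: h.
Qed.

(* If no eta in a null sequence worked for a permutation p, one small eta would
   fail for all such p at once. *)
Lemma uniform_threshold (R : realFieldType) (P : finType) (A : R -> P -> Prop) :
  (forall p, exists2 e : R, 0 < e & forall e', 0 < e' <= e -> A e' p) ->
  exists2 e : R, 0 < e & forall p, A e p.
Proof.
move=> h.
have /choice[f hf] : forall p, exists e : R, 0 < e /\ forall e', 0 < e' <= e -> A e' p.
  by move=> p; have [e e0 he] := h p; exists e.
have S0 : 0 <= \sum_p (f p)^-1.
  by apply: sumr_ge0 => p _; rewrite invr_ge0 ltW//; case: (hf p).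
have S1 : 0 < 1 + \sum_p (f p)^-1 by rewrite ltr_wpDr.
exists (1 + \sum_p (f p)^-1)^-1 => [|p]; first by rewrite invr_gt0.
have [fp0 hp] := hf p; apply: hp; rewrite invr_gt0 S1/= invf_ple//.
rewrite (bigD1 p)//= addrCA lerDl addr_ge0//.
by apply: sumr_ge0 => p' _; rewrite invr_ge0 ltW//; case: (hf p').
Qed.

Lemma few_bad_permutations (R : realType) : exists2 K : R, 0 <= K &
  forall (n s l k : nat) (tl hd : 'I_('C(n, 2)) -> 'I_n)
    (Phi : 'M[R]_(k, 'C(n, 2))) (t : R),
  edge_orientation tl hd -> (4 <= s)%N -> l = (s ^ 4)%N -> n = (s ^ 5)%N ->
  ~~ odd n -> 0 < t -> t ^+ 8 = s%:R -> k%:R <= t ^+ 2 ->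
  exists2 B : {set 'S_n}, #|B|%:R <= K / t * n`!%:R &
    forall p e0, p \notin B -> crossing tl hd p e0 ->
    exists2 f : 'I_('C(n, 2)) -> R,
      slot_row tl hd Phi e0 =
        \sum_(e | non_crossing s l tl hd p e) f e *: slot_row tl hd Phi e &
      \sum_(e | non_crossing s l tl hd p e) f e ^+ 2 <= 36 * t ^- 4 * l%:R.
Proof.
(* 2q groups per block: t^-q has to beat the number of blocks, about t^32. The
   number q is kept abstract since (2q)^(2q) is not to be computed. *)
have [q q33] : exists q, (33 <= q)%N by exists 33.
pose C := (2 * q)%N.
(* The first summand comes from the wide ends, the second from the matchings. *)
exists (2 * (4 * C%:R + 24) + 2 * (C ^ (2 * q))%:R) => [|n s l k tl hd Phi t].
  by rewrite addr_ge0// mulr_ge0// addr_ge0// mulr_ge0.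
move=> orient s4 lE nE n_even t0 tE kt.
have s_even : ~~ odd s by move: n_even; rewrite nE oddX.
pose h := (s ^ 4)./2.
have lh : l = (2 * h)%N by rewrite lE /h mul2n even_halfK// oddX.
have h3 : (3 <= h)%N.
  have : (4 ^ 4 <= s ^ 4)%N by rewrite leq_exp2r.
  by rewrite -lE lh; lia.
have nsl : n = (s * l)%N by rewrite nE lE expnS.
pose m := (s %/ C)%N.
have mC : (m * C <= s)%N by exact: leq_divM.
have t1 : 1 <= t.
  rewrite leNgt; apply/negP => tlt1.
  have : t ^+ 8 <= 1 by rewrite exprn_ile1// ltW.
  by rewrite tE lern1; lia.
have t4 : 2 <= t ^+ 4.
  rewrite leNgt; apply/negP => t4lt.
  have : t ^+ 4 * t ^+ 4 < 2 * 2.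
    by rewrite ltr_pM// exprn_ge0// ltW.
  by rewrite -exprD tE -natrM ltr_nat; lia.
pose kappa := t ^- 4.
have kappa0 : 0 < kappa by rewrite invr_gt0 exprn_gt0.
have kappa2 : kappa <= 2^-1 by rewrite lef_pV2 ?posrE ?exprn_gt0.
have s0 : (0 < s)%N by lia.
pose r := 36 * kappa * l%:R.
have r0 : 0 <= r by rewrite /r !mulr_ge0// ltW.
pose nc p := non_crossing s l tl hd p.
pose good (p : 'S_n) := forall e0, crossing tl hd p e0 -> forall X,
   drop tl hd Phi e0 X ^+ 2 <= r * \sum_(e | nc p e) drop tl hd Phi e X ^+ 2.
pose chain eta := has_chain (C := C) (m := m) tl hd Phi eta kappa h.-2
  (first_pos s0 h3 lh nsl) (mid_pos s0 h3 lh nsl) (group_pos s0 h3 lh nsl (m := m)).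
(* [good] does not mention eta. Where it fails, the positive gap [g - r * EL] exceeds [eta * N] for
   all small eta, which contradicts the bound given by a chain. *)
have [eta eta0 heta] : exists2 eta : R, 0 < eta & forall p, chain eta p -> good p.
  apply: uniform_threshold => p.
  have [gp|] := pselect (good p); first by exists 1.
  move=> /existsNP[e0 /not_implyP[ce0 /existsNP[X /negP]]].
  rewrite -ltNge => gap.
  set g := drop _ _ _ _ _ ^+ 2 in gap; set EL := \sum_(e | _) _ in gap.
  pose N := 12 * kappa * h.-1%:R ^+ 2 * \sum_u sqnorm X u.
  have N0 : 0 <= N.
    by rewrite !mulr_ge0 ?exprn_ge0 ?(ltW kappa0)//; apply: sumr_ge0 => u _; exact: sqnorm_ge0.
  have gap0 : 0 < g - r * EL by rewrite subr_gt0.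
  exists ((g - r * EL) / (N + 1)) => [|eta /andP[eta0 etag] chp].
    by rewrite divr_gt0// ltr_wpDl.
  exfalso.
  have := has_chain_drop_le orient mC eta0 kappa0 kappa2 X chp ce0.
  rewrite -/g -/EL.
  have EL0 : 0 <= EL by apply: sumr_ge0 => *; exact: sqr_ge0.
  have -> : 12 * kappa * h.-1%:R * (3 * EL + h.-1%:R * (eta * \sum_u sqnorm X u))
     = 36 * kappa * h.-1%:R * EL + eta * N by rewrite /N; ring.
  have hl : 36 * kappa * h.-1%:R * EL <= r * EL.
    apply: ler_wpM2r => //; apply: ler_wpM2l; first by rewrite mulr_ge0// ltW.
    by rewrite ler_nat lh (leq_trans (leq_pred _))// leq_pmull.
  move: etag; rewrite ler_pdivlMr ?ltr_wpDl//.
  by rewrite mulrDr mulr1; lra.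
pose B := [set p : 'S_n | `[< ~ chain eta p >]]%SET.
exists B => [|p e0 pB ce0]; last first.
  have gp : good p by apply: heta; move: pB; rewrite inE => /asboolPn/contrapT.
  by apply: drop_flow => // X; exact: gp.
(* A matching inspects at most s positions besides the ends, far fewer than the square root of n =
   s^5, as [expn_fact_le] demands. *)
have ms : (2 * m * q <= s)%N by move: mC; rewrite /C mulnCA mulnA.
(* Here beta = 1 / t: the density of bad pairs is of order t^-2, so Markov's inequality still leaves
   only a share of order 1 / t of wide ends. *)
have hcard : #|[pred p : 'S_n | `[< ~ chain eta p >]]|%:R <=
    (2 * (bad_density k kappa m / t^-1) +
     h.-2%:R * (C ^ (2 * q))%:R * (2 * t^-1 ^+ q)) * n`!%:R.
  apply: (card_not_chain Phi (orientation_neq orient) (orientation_inj orient) eta0 kappa0).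
  - exact: first_mid.
  - by move=> j j' c c' i i'; exact: (group_pos_inj mC).
  - by move=> j c i; exact: (group_pos_first s0 h3 lh nsl mC).
  - by move=> j c i; exact: (group_pos_mid s0 h3 lh nsl mC).
  - by rewrite invr_gt0.
  - by rewrite -subn2 subn_gt0; exact: h3.
  - by rewrite /C ltnW.
  - by move: q33; clear; lia.
  - by rewrite nE (@leq_trans (4 ^ 5))// leq_exp2r.
  - rewrite nE; apply: (@leq_trans (2 * (s + 2) ^ 2)).
      by rewrite leq_mul2l/= leq_exp2r// leq_add2r.
    apply: (@leq_trans (2 * (2 * s) ^ 2)).
      by rewrite leq_mul2l/= leq_exp2r// mul2n -addnn leq_add2l ltnW// ltnW.
    rewrite expnMn mulnA (expnD s 3 2) leq_mul2r; apply/orP; right.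
    by rewrite (@leq_trans (4 ^ 3))// leq_exp2r.
rewrite cardsE; apply: le_trans hcard _; rewrite ler_wpM2r//.
have tN0 : t != 0 by rewrite gt_eqF.
(* Both terms are of order t^-2: k t^4 / (m + 1) <= C t^6 / s because C (m + 1) exceeds s = t^8, and
   kappa k <= t^-4 t^2. *)
have hbd : bad_density k kappa m <= (4 * C%:R + 24) * t ^- 2.
  rewrite /bad_density [leRHS]mulrDl lerD//.
    rewrite -mulrA ler_wpM2l// /kappa.
    have -> : k%:R / (t ^- 4 * m.+1%:R) = k%:R * t ^+ 4 / m.+1%:R.
      by field; rewrite tN0 nat1r pnatr_eq0.
    rewrite ler_pdivrMr//.
    apply: (@le_trans _ _ (t ^+ 2 * t ^+ 4)).
      by rewrite ler_wpM2r// exprn_ge0// ltW.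
    have -> : C%:R * t ^- 2 * m.+1%:R = (m.+1 * C)%:R * t ^- 2 by rewrite natrM; ring.
    rewrite ler_pdivlMr ?exprn_gt0// -!exprD tE ler_nat ltnW// ltn_ceil//.
    by rewrite /C muln_gt0/=; move: q33; clear; lia.
  rewrite -mulrA ler_wpM2l// /kappa.
  apply: (@le_trans _ _ (t ^- 4 * t ^+ 2)).
    by rewrite ler_wpM2l// invr_ge0 exprn_ge0// ltW.
  by rewrite le_eqVlt; apply/orP; left; apply/eqP; field.
rewrite [leRHS]mulrDl; apply: lerD.
  rewrite -mulrA ler_wpM2l// invrK.
  apply: le_trans (ler_wpM2r (ltW t0) hbd) _.
  by rewrite le_eqVlt; apply/orP; left; apply/eqP; field.
have hC : 0 <= (C ^ (2 * q))%:R :> R by [].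
move: ((C ^ (2 * q))%:R) hC => K K0.
have hl : h.-2%:R <= t ^+ 32.
  rewrite (exprM t 8 4) tE -natrX ler_nat -lE lh.
  by apply: (leq_trans (leq_pred _)); rewrite (leq_trans (leq_pred _))// leq_pmull.
have tq : t^-1 ^+ q <= t^-1 ^+ 33.
  by rewrite ler_wiXn2l ?invr_ge0 ?(ltW t0)// invf_le1.
apply: (@le_trans _ _ (t ^+ 32 * K * (2 * t^-1 ^+ 33))).
  apply: ler_pM.
  - by rewrite mulr_ge0.
  - by rewrite mulr_ge0// exprn_ge0// invr_ge0 ltW.
  - by rewrite ler_wpM2r.
  - by rewrite ler_wpM2l.
by rewrite le_eqVlt; apply/orP; left; apply/eqP; field.
Qed.

Import numFieldNormedType.Exports.
Local Open Scope classical_set_scope.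
Local Open Scope ring_scope.

(** * Shifting the means of a Gaussian vector *)

(** The density p agrees almost everywhere with the Radon-Nikodym derivative, for which the change
    of variables holds. *)
Lemma ge0_integral_density d (T : measurableType d) (R : realType)
    (mu : {sigma_finite_measure set T -> \bar R})
    (nu : {finite_measure set T -> \bar R}) (p : T -> R) (g : T -> \bar R) :
  measurable_fun [set: T] p ->
  (forall A, measurable A -> nu A = (\int[mu]_(x in A) (p x)%:E)%E) ->
  measurable_fun [set: T] g -> (forall x, 0 <= g x)%E ->
  (\int[nu]_x g x = \int[mu]_x (g x * (p x)%:E))%E.
Proof.
move=> mp nuE mg g0.
have numu : nu `<< mu.
  apply/null_content_dominatesP => A mA muA0; rewrite nuE//.
  apply: null_set_integral => //; apply: measurable_funTS; exact/measurable_EFinP.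
rewrite -(Radon_Nikodym_SigmaFinite.change_of_variables numu g0 measurableT mg).
have mf := measurable_int _ (Radon_Nikodym_SigmaFinite.f_integrable numu).
apply: ae_eq_integral => //.
- exact: emeasurable_funM.
- by apply: emeasurable_funM => //; exact/measurable_EFinP.
- apply: ae_eqe_mul2l; apply: integral_ae_eq => //.
  + exact: Radon_Nikodym_SigmaFinite.f_integrable.
  + exact/measurable_EFinP.
  + by move=> A AE mA; rewrite -Radon_Nikodym_SigmaFinite.f_integral// nuE.
Qed.

(** * Chi-square divergence and total variation *)

Section chi_square.
Context {R : realType}.

(* Q has a density with respect to P, and the chi-square divergence of Q from P
   is at most c - 1. *)
Definition chi_square_le d (T : measurableType d) (P Q : set T -> \bar R) (c : R) :=
  exists L : T -> R, [/\ measurable_fun [set: T] L, forall x, 0 <= L x,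
    forall g : T -> \bar R, measurable_fun [set: T] g -> (forall x, 0 <= g x)%E ->
      (\int[Q]_x g x = \int[P]_x (g x * (L x)%:E))%E &
    (\int[P]_x (L x ^+ 2)%:E <= c%:E)%E].

Lemma normal_prob_integral (m s : R) (g : R -> \bar R) :
  measurable_fun [set: R] g -> (forall x, 0 <= g x)%E ->
  (\int[normal_prob m s]_x g x =
   \int[lebesgue_measure]_x (g x * (normal_pdf m s x)%:E))%E.
Proof.
move=> mg g0; apply: (@ge0_integral_density _ _ R lebesgue_measure (normal_prob m s)) => //.
exact: measurable_normal_pdf.
Qed.

Lemma chi_square_normal (m s a : R) : s != 0 ->
  chi_square_le (normal_prob m s) (normal_prob (m + a) s) (expR (a ^+ 2 / s ^+ 2)).
Proof.
move=> s0; pose L x := expR ((x - m) * a / s ^+ 2 - a ^+ 2 / (s ^+ 2 *+ 2)).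
have mL : measurable_fun setT L.
  apply: measurableT_comp => //; apply: measurable_funB => //.
  apply: measurable_funM => //; apply: measurable_funM => //.
  exact: measurable_funB.
have s2 : s ^+ 2 *+ 2 != 0 by rewrite mulrn_eq0/= sqrf_eq0.
have LE x : normal_pdf (m + a) s x = L x * normal_pdf m s x.
  rewrite !normal_pdfE// mulrCA; congr (_ * _).
  rewrite /normal_fun /L -expRD; congr expR.
  by field; rewrite s0.
(* Squaring the likelihood ratio shifts the mean once more: completing the square gives mean m + 2a
   and the constant exp (a^2 / s^2). *)
have L2E x : L x ^+ 2 * normal_pdf m s x =
    expR (a ^+ 2 / s ^+ 2) * normal_pdf (m + a + a) s x.
  rewrite !normal_pdfE// mulrCA [RHS]mulrCA; congr (_ * _).
  rewrite /normal_fun /L expr2 -!expRD; congr expR.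
  by field; rewrite s0.
exists L; split; first exact: mL.
- by move=> x; exact: expR_ge0.
- move=> g mg g0; rewrite !normal_prob_integral//; last first.
    by move=> x; rewrite mule_ge0// lee_fin expR_ge0.
    by apply: emeasurable_funM => //; exact/measurable_EFinP.
  by apply: eq_integral => x _; rewrite LE EFinM muleA.
- rewrite normal_prob_integral//; last first.
    by move=> x; rewrite lee_fin sqr_ge0.
    by apply/measurable_EFinP; exact: measurable_funX.
  under eq_integral => x _ do rewrite -EFinM L2E EFinM.
  rewrite ge0_integralZl//=.
  + by rewrite integral_normal_pdf mule1.
  + by apply/measurable_EFinP; exact: measurable_normal_pdf.
  + by move=> x _; rewrite lee_fin normal_pdf_ge0.

Qed.

Lemma chi_square_prod d1 d2 (T1 : measurableType d1) (T2 : measurableType d2)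
    (P1 Q1 : probability T1 R) (P2 Q2 : probability T2 R) (c1 c2 : R) :
  chi_square_le P1 Q1 c1 -> chi_square_le P2 Q2 c2 ->
  chi_square_le (P1 \x P2)%E (Q1 \x Q2)%E (c1 * c2).
Proof.
move=> [L1 [mL1 L10 L1E L1c]] [L2 [mL2 L20 L2E L2c]].
have mL1' : measurable_fun setT (fun z : T1 * T2 => L1 z.1) by exact: measurableT_comp.
have mL2' : measurable_fun setT (fun z : T1 * T2 => L2 z.2) by exact: measurableT_comp.
exists (fun z => L1 z.1 * L2 z.2); split.
- exact: measurable_funM.
- by move=> z; rewrite mulr_ge0.
- move=> g mg g0.
  have mh : measurable_fun setT (fun z : T1 * T2 => g z * (L2 z.2)%:E)%E.
    by apply: emeasurable_funM => //; exact/measurable_EFinP.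
  rewrite !fubini_tonelli1//; last first.
    by move=> z; rewrite mule_ge0// lee_fin mulr_ge0.
    by apply: emeasurable_funM => //; apply/measurable_EFinP; exact: measurable_funM.
  rewrite /fubini_F.
  under eq_integral => x _.
    rewrite L2E//; last by apply: measurableT_comp => //; exact: pair1_measurable.
    over.
  rewrite L1E//; last first.
    by move=> x; apply: integral_ge0 => y _; rewrite mule_ge0// lee_fin.
    apply: (@measurable_fun_fubini_tonelli_F _ _ T1 T2 R P2 _ mh) => z; by rewrite mule_ge0// lee_fin.
  apply: eq_integral => x _; rewrite -ge0_integralZr//=.
  + by apply: eq_integral => y _; rewrite EFinM -muleA (muleC (L2 y)%:E).
  + exact: (measurableT_comp mh (pair1_measurable x)).
  + by move=> y _; rewrite mule_ge0// lee_fin.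
  + by rewrite lee_fin.
- rewrite fubini_tonelli1//; last first.
    by move=> z; rewrite lee_fin sqr_ge0.
    by apply/measurable_EFinP; apply: measurable_funX; exact: measurable_funM.
  rewrite /fubini_F/=.
  have -> : (\int[P1]_x \int[P2]_y ((L1 x * L2 y) ^+ 2)%:E =
      \int[P1]_x (L1 x ^+ 2)%:E * \int[P2]_y (L2 y ^+ 2)%:E)%E.
    rewrite -ge0_integralZr//=.
    + apply: eq_integral => x _; rewrite -ge0_integralZl//=.
      * by apply: eq_integral => y _; rewrite exprMn EFinM.
      * by apply/measurable_EFinP; exact: measurable_funX.
      * by move=> y _; rewrite lee_fin sqr_ge0.
      * by rewrite lee_fin sqr_ge0.
    + by apply/measurable_EFinP; exact: measurable_funX.
    + by move=> y _; rewrite lee_fin sqr_ge0.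
    + by apply: integral_ge0 => y _; rewrite lee_fin sqr_ge0.
  rewrite EFinM; apply: lee_pmul => //; apply: integral_ge0 => y _;
    by rewrite lee_fin sqr_ge0.
Qed.

(** Instead of Cauchy-Schwarz, |L - 1| <= a / 2 + (L - 1)^2 / (2 a) is integrated, where the
    integral of (L - 1)^2 is at most c - 1; [a] is chosen later. *)
Lemma chi_square_tv d (T : measurableType d) (P Q : probability T R) (c a : R)
    (A : set T) : chi_square_le P Q c -> 0 < a -> measurable A ->
  (`|Q A - P A| <= (a / 2 + (c - 1) / (2 * a))%:E)%E.
Proof.
move=> [L [mL L0 LE Lc]] a0 mA.
(* The term -L / a of the expanded square is moved to the left, where it integrates to 1 / a; all
   integrands are then nonnegative. The inequality is used twice, with h1 and h2 exchanged. *)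
have int_le (h1 h2 : T -> R) : measurable_fun setT h1 -> measurable_fun setT h2 ->
    (forall x, 0 <= h1 x) -> (forall x, 0 <= h2 x) ->
    (forall x, `|h1 x - h2 x| <= `|L x - 1|) ->
    (\int[P]_x (h1 x)%:E + a^-1%:E <=
     \int[P]_x (h2 x)%:E + (a / 2 + (c + 1) / (2 * a))%:E)%E.
  move=> mh1 mh2 h10 h20 h12.
  have intL : (\int[P]_x (L x)%:E = 1)%E.
    have <- : (\int[Q]_x cst 1 x = 1)%E by rewrite integral_cst// mul1e; exact: probability_setT.
    by rewrite (LE (cst 1%E))//; apply: eq_integral => x _; rewrite mul1e.
  have -> : (a^-1%:E = \int[P]_x (a^-1 * L x)%:E)%E.
    under eq_integral do rewrite EFinM.
    rewrite ge0_integralZl ?intL ?mule1//.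
    - exact/measurable_EFinP.
    - by move=> x _; rewrite lee_fin.
    - by rewrite lee_fin invr_ge0 ltW.
  have mL2 : measurable_fun setT (fun x => (2 * a)^-1 * L x ^+ 2).
    by apply: measurable_funM => //; exact: measurable_funX.
  have a20 : 0 <= (2 * a)^-1 by rewrite invr_ge0 mulr_ge0// ltW.
  have a210 : 0 <= a / 2 + (2 * a)^-1 by rewrite addr_ge0// divr_ge0// ltW.
  have L20 x : 0 <= (2 * a)^-1 * L x ^+ 2 by rewrite mulr_ge0// sqr_ge0.
  rewrite -ge0_integralD//; last 4 first.
  - by move=> x _; rewrite lee_fin.
  - exact/measurable_EFinP.
  - by move=> x _; rewrite lee_fin mulr_ge0// invr_ge0 ltW.
  - by apply/measurable_EFinP; exact: measurable_funM.
  apply: (@le_trans _ _ (\int[P]_x ((h2 x)%:E +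
      ((a / 2 + (2 * a)^-1)%:E + ((2 * a)^-1 * L x ^+ 2)%:E)))%E).
    apply: ge0_le_integral => //.
    - by move=> x _; rewrite -EFinD lee_fin addr_ge0// mulr_ge0// invr_ge0 ltW.
    - by apply/measurable_EFinP; apply: measurable_funD => //; exact: measurable_funM.
    - by apply/measurable_EFinP; apply: measurable_funD => //; exact: measurable_funD.
    - move=> x _; rewrite -!EFinD lee_fin.
      have : 0 <= (`|L x - 1| - a) ^+ 2 * (2 * a)^-1 by rewrite mulr_ge0// sqr_ge0.
      have -> : (`|L x - 1| - a) ^+ 2 * (2 * a)^-1 =
          (2 * a)^-1 + (2 * a)^-1 * L x ^+ 2 - a^-1 * L x + a / 2 - `|L x - 1|.
        rewrite sqrrB real_normK ?num_real//; field; exact: lt0r_neq0.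
      have := le_trans (ler_norm _) (h12 x); lra.
  rewrite !ge0_integralD//; last 6 first.
  - by move=> x _; rewrite lee_fin.
  - exact/measurable_EFinP.
  - by move=> x _; rewrite lee_fin.
  - exact/measurable_EFinP.
  - by move=> x _; rewrite -EFinD lee_fin addr_ge0.
  - by apply/measurable_EFinP; exact: measurable_funD.
  rewrite leeD2l// integral_cst// [X in (_ * X)%E](_ : _ = 1%E) ?mule1; last exact: probability_setT.
  under eq_integral do rewrite EFinM.
  rewrite ge0_integralZl//; last 2 first.
  - by apply/measurable_EFinP; exact: measurable_funX.
  - by move=> x _; rewrite lee_fin sqr_ge0.
  have -> : a / 2 + (c + 1) / (2 * a) = a / 2 + (2 * a)^-1 + (2 * a)^-1 * c by ring.
  by rewrite [leRHS]EFinD leeD2l// EFinM lee_wpmul2l.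
have m1A : measurable_fun [set: T] (\1_A : T -> R) by exact: measurable_indic.
have A0 x : 0 <= \1_A x :> R by rewrite indicE.
have PAE : (\int[P]_x (\1_A x)%:E = P A)%E by rewrite integral_indic// setIT.
have QAE : (\int[P]_x (\1_A x * L x)%:E = Q A)%E.
  transitivity (\int[Q]_x (\1_A x)%:E)%E; last by rewrite integral_indic// setIT.
  rewrite (LE (fun x => (\1_A x)%:E)); [|exact/measurable_EFinP|by []].
  by apply: eq_integral => x _; rewrite EFinM.
have mAL : measurable_fun setT (fun x => \1_A x * L x) by exact: measurable_funM.
have AL0 x : 0 <= \1_A x * L x by rewrite mulr_ge0.
have AL1 x : `|\1_A x * L x - \1_A x| <= `|L x - 1|.
  by rewrite indicE; case: (_ \in _); rewrite ?mul1r// !mul0r subrr normr0.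
have := int_le _ _ mAL m1A AL0 A0 AL1; have := int_le _ _ m1A mAL A0 AL0.
rewrite PAE QAE => /(_ (fun x => _)).
have QAf := fin_num_measure Q _ mA; have PAf := fin_num_measure P _ mA.
rewrite -(fineK QAf) -(fineK PAf) -!EFinD !lee_fin => H1 H2.
have {H1} := H1 ltac:(by move=> x; rewrite distrC).
move: H2; have -> : (c + 1) / (2 * a) = (c - 1) / (2 * a) + a^-1.
  by field; exact: lt0r_neq0.
move=> H2 H1; rewrite ler_norml; apply/andP; split; lra.
Qed.

End chi_square.

(** * Model spaces of independent normal coordinates *)

Section gaussian_family.
Context {R : realType}.

Definition has_coordinate_laws d (Y : measurableType d) (lam : set Y -> \bar R)
    (N : nat) (w : 'I_N -> Y -> measurableTypeR R)
    (mu : 'I_N -> set (measurableTypeR R) -> \bar R) :=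
  forall A : 'I_N -> set (measurableTypeR R), (forall i, measurable (A i)) ->
    lam [set y | forall i, A i (w i y)] = (\prod_i mu i (A i))%E.

Lemma chi_square_refl d (Y : measurableType d) (P : probability Y R) :
  chi_square_le P P 1.
Proof.
exists (cst 1); split => //.
- by move=> g mg g0; apply: eq_integral => x _; rewrite mule1.
- under eq_integral do rewrite expr1n.
  by rewrite integral_cst// mul1e [leLHS](_ : _ = 1%E)//; exact: probability_setT.
Qed.

Lemma has_coordinate_laws_prod d (Y : measurableType d) (N : nat)
    (w : 'I_N -> Y -> measurableTypeR R)
    (mu0 : probability (measurableTypeR R) R) (lam : probability Y R)
    (mu : 'I_N -> set (measurableTypeR R) -> \bar R) :
  (forall i, measurable_fun setT (w i)) -> has_coordinate_laws lam w mu ->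
  has_coordinate_laws (mu0 \x lam)%E
    (fun (i : 'I_N.+1) (z : measurableTypeR R * Y) =>
       if unlift ord0 i is Some j then w j z.2 else z.1)
    (fun i => if unlift ord0 i is Some j then mu j else mu0).
Proof.
move=> mw lamw A mA.
have -> : [set z : measurableTypeR R * Y | forall i, A i
    (if unlift ord0 i is Some j then w j z.2 else z.1)] =
    A ord0 `*` [set y | forall j, A (lift ord0 j) (w j y)].
  apply/seteqP; split=> z /= Hz.
    split; first by have := Hz ord0; rewrite unlift_none.
    by move=> j; have := Hz (lift ord0 j); rewrite liftK.
  by move=> i; case: unliftP => [j|] ->; [exact: Hz.2|exact: Hz.1].
rewrite product_measure1E//; last first.
  have -> : [set y | forall j, A (lift ord0 j) (w j y)] =
      \bigcap_(j in [set: 'I_N]) (w j @^-1` A (lift ord0 j)).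
    by apply/seteqP; split=> y /= Hy j; [move=> _; exact: Hy|exact: Hy].
  apply: fin_bigcap_measurable => // j _.
  by rewrite -[X in measurable X]setTI; exact: mw.
rewrite big_ord_recl unlift_none; congr (_ * _)%E.
transitivity (\prod_(j < N) mu j (A (lift ord0 j)))%E.
  by apply: (lamw (fun j => A (lift ord0 j))) => j.
by apply: eq_bigr => j _; rewrite liftK.
Qed.

(** Adding one factor at a time multiplies the chi-square bounds, so the exponents a^2 / s^2 add up
    to the squared length of the shift. The shifted law lives on the same space with the same
    coordinates, as a comparison of densities demands. *)
Lemma gaussian_family (m s : R) : s != 0 -> forall N,
  exists d (Y : measurableType d) (lam : probability Y R)
    (w : 'I_N -> Y -> measurableTypeR R),
  [/\ forall i, measurable_fun setT (w i),
      has_coordinate_laws lam w (fun=> normal_prob m s) &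
      forall f : 'I_N -> R, exists lamf : probability Y R,
        has_coordinate_laws lamf w (fun i => normal_prob (m + f i) s) /\
        chi_square_le lam lamf (expR ((\sum_i f i ^+ 2) / s ^+ 2))].
Proof.
move=> s0; elim=> [|N [d [Y [lam [w [mw lamw shift]]]]]].
  exists _, unit, (dirac tt : probability unit R), (fun i _ => 0).
  have law mu : has_coordinate_laws (dirac tt : probability unit R)
      (fun (i : 'I_0) (_ : unit) => 0 : measurableTypeR R) mu.
    move=> A mA; rewrite big_ord0.
    have -> : [set y : unit | forall i : 'I_0, A i 0] = setT.
      by apply/seteqP; split=> // y _ [].
    exact: probability_setT.
  split => // f; exists (dirac tt : probability unit R); split=> //.
  by rewrite big_ord0 mul0r expR0; exact: chi_square_refl.
pose N0 (a : R) : probability (measurableTypeR R) R := normal_prob a s.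
pose prod (a : R) (l : probability Y R) : probability _ R := (N0 a \x l)%E.
exists _, (measurableTypeR R * Y)%type, (prod m lam),
  (fun i z => if unlift ord0 i is Some j then w j z.2 else z.1).
split.
- move=> i; case: unliftP => [j|] _; last exact: measurable_fst.
  by apply: measurableT_comp => //; exact: measurable_snd.
- have := has_coordinate_laws_prod (N0 m) mw lamw.
  by move=> H A mA; apply: (etrans (H A mA)); apply: eq_bigr => i _; case: unliftP.
- move=> f; have [lamf [lamfw chi]] := shift (fun j => f (lift ord0 j)).
  exists (prod (m + f ord0) lamf); split.
    have := has_coordinate_laws_prod (N0 (m + f ord0)) mw lamfw.
    move=> H A mA; apply: (etrans (H A mA)).
    by apply: eq_bigr => i _; case: unliftP => [j|] ->.
  rewrite big_ord_recl mulrDl expRD; apply: chi_square_prod => //.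
  exact: chi_square_normal.
Qed.

End gaussian_family.

(** * Laws of random matrices and of weight vectors *)

Section matrix_laws.
Context {d} {T : measurableType d} {m n : nat}.

Definition entry_box (A : 'I_m -> 'I_n -> set T) : set 'M[T]_(m, n) :=
  [set M | forall i j, A i j (M i j)].

Lemma measurable_entry i j : measurable_fun [set: 'M[T]_(m, n)] (fun M => M i j).
Proof.
move=> _ A mA; apply: sub_sigma_algebra; exists (i, j) => //; exists A => //.
Qed.

Lemma measurable_fun_entries d' (Y : measurableType d') (f : Y -> 'M[T]_(m, n)) :
  (forall i j, measurable_fun [set: Y] (fun y => f y i j)) ->
  measurable_fun [set: Y] f.
Proof.
move=> mf; apply: (measurability (\bigcup_(ij in [set: 'I_m * 'I_n])
  preimage_set_system setT (fun M : 'M[T]_(m, n) => M ij.1 ij.2) measurable)) => //.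
move=> _ [_ [ij _ [A mA <-] <-]].
have := mf ij.1 ij.2 measurableT A mA.
by rewrite !setTI.
Qed.

Lemma measurable_entry_box A : (forall i j, measurable (A i j)) ->
  measurable (entry_box A).
Proof.
move=> mA; have -> : entry_box A = \bigcap_(ij in [set: 'I_m * 'I_n])
    ((fun M : 'M[T]_(m, n) => M ij.1 ij.2) @^-1` A ij.1 ij.2).
  apply/seteqP; split=> M HM.
    by move=> ij _; exact: HM.
  by move=> i j; exact: (HM (i, j)).
apply: fin_bigcap_measurable => // ij _.
by rewrite -[X in measurable X]setTI; exact: measurable_entry.
Qed.

(** Boxes are stable under intersection and generate the sigma-algebra of matrices. *)
Lemma matrix_law_unique (R : realType) (mu nu : {measure set 'M[T]_(m, n) -> \bar R}) :
  (mu setT < +oo)%E ->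
  (forall A, (forall i j, measurable (A i j)) -> mu (entry_box A) = nu (entry_box A)) ->
  forall S, measurable S -> mu S = nu S.
Proof.
move=> mufin munu.
pose G := [set S | exists2 A : 'I_m -> 'I_n -> set T,
  (forall i j, measurable (A i j)) & S = entry_box A].
have boxT : entry_box (fun _ _ => setT) = setT by apply/seteqP; split.
have GT : G setT by exists (fun _ _ => setT).
apply: (measure_unique G (fun=> setT)) => //.
- apply/seteqP; split; last first.
    apply: smallest_sub; first exact: sigma_algebra_measurable.
    by move=> _ [A mA ->]; exact: measurable_entry_box.
  apply: smallest_sub; first exact: smallest_sigma_algebra.
  move=> _ [ij _ [B mB <-]]; apply: sub_sigma_algebra.
  exists (fun i j => if (i, j) == ij then B else setT).
    by move=> i j; case: ifP.
  apply/seteqP; split=> M /=.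
    by move=> [_ HM] i j; case: eqP => // -[]; case: ij HM => i' j' /= HM [-> ->].
  move=> HM; split=> //; have := HM ij.1 ij.2.
  by rewrite -surjective_pairing eqxx.
- move=> _ _ [A mA ->] [B mB ->].
  exists (fun i j => A i j `&` B i j); first by move=> i j; exact: measurableI.
  apply/seteqP; split=> M /=; first by move=> [HA HB] i j; split.
  by move=> HM; split=> i j; case: (HM i j).
- by rewrite bigcup_const//; exists 0%N.
- by move=> _ [A mA ->]; exact: munu.
Qed.

Lemma pushforward_matrix_unique (R : realType) d1 d2
    (Y1 : measurableType d1) (Y2 : measurableType d2)
    (mu : {measure set Y1 -> \bar R}) (nu : {measure set Y2 -> \bar R})
    (f : Y1 -> 'M[T]_(m, n)) (g : Y2 -> 'M[T]_(m, n)) :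
  measurable_fun [set: Y1] f -> measurable_fun [set: Y2] g -> (mu setT < +oo)%E ->
  (forall A, (forall i j, measurable (A i j)) ->
    mu (f @^-1` entry_box A) = nu (g @^-1` entry_box A)) ->
  forall S, measurable S -> mu (f @^-1` S) = nu (g @^-1` S).
Proof.
move=> mf mg mufin munu.
pose m1 := measure_function_pushforward__canonical__measure_function_Measure mu mf.
pose m2 := measure_function_pushforward__canonical__measure_function_Measure nu mg.
exact: (@matrix_law_unique R m1 m2).
Qed.

End matrix_laws.

Section shift.
Context {R : realType}.
Notation mu := (@lebesgue_measure R).

Lemma lebesgue_measure_shift (a : R) (A : set (measurableTypeR R)) : measurable A ->
  pushforward mu (fun x : measurableTypeR R => x + a : measurableTypeR R) A = mu A.
Proof.
move=> mA; have mf : measurable_fun setT (fun x : measurableTypeR R => x + a : measurableTypeR R).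
  exact: measurable_funD.
pose m1 := measure_function_pushforward__canonical__measure_function_Measure mu mf.
apply/esym/(@lebesgue_measure_unique _ m1) => //= _ [[b c]] _ <-.
rewrite /pushforward.
have -> : (fun x : measurableTypeR R => x + a) @^-1` `]b, c]%classic = `]b - a, c - a]%classic.
  by apply/seteqP; split=> x /=; rewrite !in_itv/= ltrBlDr lerBrDr.
rewrite !lebesgue_measure_itv/= !lte_fin ltrBlDr subrK.
by case: ifP => // _; rewrite -!EFinB; congr EFin; ring.
Qed.

Lemma normal_prob_shift (m s a : R) (A : set (measurableTypeR R)) : s != 0 ->
  measurable A -> normal_prob m s [set x | A (x + a)] = normal_prob (m + a) s A.
Proof.
move=> s0 mA; rewrite /normal_prob.
have mf : measurable_fun setT (fun x : measurableTypeR R => x + a : measurableTypeR R).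
  exact: measurable_funD.
have mp : measurable_fun setT (EFin \o normal_pdf (m + a) s).
  by apply/measurable_EFinP; exact: measurable_normal_pdf.
transitivity (\int[pushforward mu (fun x : measurableTypeR R => (x + a)%R : measurableTypeR R)]_(x in A)
   (normal_pdf (m + a) s x)%:E)%E.
  rewrite ge0_integral_pushforward//.
  - apply: eq_integral => x _ /=; rewrite !normal_pdfE// /normal_fun.
    by rewrite opprD addrACA subrr addr0.
  - exact: measurable_funTS.
  - by move=> x _; rewrite lee_fin normal_pdf_ge0.
apply: eq_measure_integral => B mB _; exact: lebesgue_measure_shift.
Qed.

End shift.

Section coordinate_laws.
Context {R : realType} {N : nat}.
Notation RT := (measurableTypeR R).

Lemma measurable_row d (Y : measurableType d) (w : 'I_N -> Y -> RT) :
  (forall i, measurable_fun setT (w i)) ->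
  measurable_fun setT (fun y => \row_i w i y : 'M[RT]_(1, N)).
Proof.
move=> mw; apply: measurable_fun_entries => i j.
rewrite [X in measurable_fun _ X](_ : _ = w j); first exact: mw.
by apply/funext => y; rewrite mxE.
Qed.

Lemma coordinate_law_unique d1 d2 (Y1 : measurableType d1) (Y2 : measurableType d2)
    (lam1 : {measure set Y1 -> \bar R}) (lam2 : {measure set Y2 -> \bar R})
    (w1 : 'I_N -> Y1 -> RT) (w2 : 'I_N -> Y2 -> RT) mu :
  (forall i, measurable_fun setT (w1 i)) -> (forall i, measurable_fun setT (w2 i)) ->
  (lam1 setT < +oo)%E ->
  has_coordinate_laws lam1 w1 mu -> has_coordinate_laws lam2 w2 mu ->
  forall S : set 'M[RT]_(1, N), measurable S ->
    lam1 [set y | S (\row_i w1 i y)] = lam2 [set y | S (\row_i w2 i y)].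
Proof.
move=> mw1 mw2 fin1 law1 law2.
apply: (pushforward_matrix_unique (measurable_row mw1) (measurable_row mw2)) => // A mA.
have boxE d (Y : measurableType d) (w : 'I_N -> Y -> RT) :
    (fun y => \row_i w i y) @^-1` entry_box A = [set y | forall i, A ord0 i (w i y)].
  apply/seteqP; split=> y /= Hy; first by move=> i; have := Hy ord0 i; rewrite mxE.
  by move=> i j; rewrite ord1 mxE.
by rewrite !boxE; apply: etrans (law1 (A ord0) (mA ord0)) _; apply/esym/law2.
Qed.

Lemma has_coordinate_laws_mask d (Y : measurableType d) (lam : set Y -> \bar R)
    (w : 'I_N -> Y -> RT) (mu : 'I_N -> probability RT R) (D : pred 'I_N) :
  has_coordinate_laws lam w mu ->
  has_coordinate_laws lam (fun i y => if D i then w i y else 0)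
    (fun i => if D i then mu i else dirac (0 : RT)).
Proof.
move=> law A mA.
(* A masked coordinate is constantly 0, so its condition either always holds or never does;
   accordingly [A'] is the full or the empty set there. *)
pose A' i := if D i then A i else [set _ | A i 0].
have mA' i : measurable (A' i).
  rewrite /A'; case: ifP => // _.
  by have [A0|A0] := pselect (A i 0);
    [rewrite [X in measurable X](_ : _ = setT)|rewrite [X in measurable X](_ : _ = set0)] => //;
    apply/seteqP; split.
have -> : [set y | forall i, A i (if D i then w i y else 0)] =
    [set y | forall i, A' i (w i y)].
  by apply/seteqP; split=> y /= + i => /(_ i); rewrite /A'; case: ifP.
rewrite law//; apply: eq_bigr => i _; rewrite /A'; case: ifP => // _.
rewrite [RHS]diracE; have [A0|A0] := pselect (A i 0).
  by rewrite mem_set// [X in mu i X](_ : _ = setT) ?probability_setT//; apply/seteqP; split.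
by rewrite memNset// [X in mu i X](_ : _ = set0) ?measure0//; apply/seteqP; split.
Qed.

Lemma has_coordinate_laws_update d (Y : measurableType d) (lam : probability Y R)
    (w : 'I_N -> Y -> RT) (mu : 'I_N -> probability RT R) (nu : probability RT R) (i0 : 'I_N) :
  (forall i, measurable_fun setT (w i)) ->
  has_coordinate_laws lam w mu ->
  has_coordinate_laws (nu \x lam)%E
    (fun i (z : RT * Y) => if i == i0 then z.1 else w i z.2)
    (fun i => if i == i0 then nu else mu i).
Proof.
move=> mw law A mA.
pose A' i := if i == i0 then setT else A i.
have mA' i : measurable (A' i) by rewrite /A'; case: ifP.
have -> : [set z : RT * Y | forall i, A i (if i == i0 then z.1 else w i z.2)] =
    A i0 `*` [set y | forall i, A' i (w i y)].
  apply/seteqP; split=> z /= Hz.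
    split; first by have := Hz i0; rewrite eqxx.
    by move=> i; have := Hz i; rewrite /A'; case: eqP.
  move=> i; case: eqP => [->|/eqP ni]; first exact: Hz.1.
  by have := Hz.2 i; rewrite /A' (negbTE ni).
rewrite product_measure1E//; last first.
  have -> : [set y | forall i, A' i (w i y)] =
      \bigcap_(i in [set: 'I_N]) (w i @^-1` A' i).
    by apply/seteqP; split=> y /= Hy j; [move=> _; exact: Hy|exact: Hy].
  apply: fin_bigcap_measurable => // j _.
  by rewrite -[X in measurable X]setTI; exact: mw.
rewrite (bigD1 i0)//= eqxx; congr (_ * _)%E.
apply: (etrans (law A' mA')).
rewrite (bigD1 i0)//= {1}/A' eqxx probability_setT mul1e.
by apply: eq_bigr => i /negbTE ni; rewrite /A' ni.
Qed.

End coordinate_laws.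

Section bounds.
Context {R : realType}.

Lemma expR_le_half (x : R) : 0 <= x <= 2^-1 -> expR x <= 1 + 2 * x.
Proof.
move=> /andP[x0 x2]; have := expR_ge1Dx (- x); rewrite expRN => H.
have e0 := expR_gt0 x.
have : (1 - x) * expR x <= 1.
  by rewrite -ler_pdivlMr// div1r.
have : (1 + 2 * x) * (1 - x) >= 1 by nra.
nra.
Qed.

(** With a = sqrt (2 q) and t^2 q <= 1/2 the exponential is at most 1 + t^2 a^2, and [chi_square_tv]
    gives a (1 + t^2) / 2. Otherwise a |t| >= 1, and a (1 + t^2) >= 2 a |t| >= 2 exceeds any
    difference of probabilities. *)
Lemma chi_square_tv_le d (T : measurableType d) (P Q : probability T R) (q t : R)
    (A : set T) : 0 < q -> chi_square_le P Q (expR (t ^+ 2 * q)) -> measurable A ->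
  (`|Q A - P A| <= (Num.sqrt (2 * q) * (1 + t ^+ 2))%:E)%E.
Proof.
move=> q0 PQ mA; set a := Num.sqrt (2 * q).
have a0 : 0 < a by rewrite sqrtr_gt0 mulr_gt0.
have a2 : a ^+ 2 = 2 * q by rewrite sqr_sqrtr// mulr_ge0// ltW.
have t20 := sqr_ge0 t.
have [tq|tq] := leP (t ^+ 2 * q) 2^-1.
  apply: (le_trans (chi_square_tv PQ a0 mA)); rewrite lee_fin.
  have E : expR (t ^+ 2 * q) <= 1 + 2 * (t ^+ 2 * q).
    by apply: expR_le_half; rewrite mulr_ge0// ltW.
  have {}E : (expR (t ^+ 2 * q) - 1) / (2 * a) <= (t ^+ 2 * a ^+ 2) / (2 * a).
    by rewrite ler_pM2r ?invr_gt0 ?mulr_gt0// a2; lra.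
  apply: (le_trans (lerD (lexx _) E)).
  have -> : t ^+ 2 * a ^+ 2 / (2 * a) = t ^+ 2 * a / 2 by field; exact: lt0r_neq0.
  nra.
have /ltW QP1 : (`|Q A - P A| < 2%:E)%E.
  have PA := probability_le1 P mA; have QA := probability_le1 Q mA.
  have PA0 : 0 <= fine (P A) by rewrite fine_ge0.
  have QA0 : 0 <= fine (Q A) by rewrite fine_ge0.
  move: PA QA; rewrite -(fineK (fin_num_measure Q _ mA)) -(fineK (fin_num_measure P _ mA)).
  rewrite !lee_fin -EFinB lte_fin => *; rewrite ltr_norml; apply/andP; split; lra.
apply: (le_trans QP1); rewrite lee_fin.
have at1 : 1 <= a * `|t|.
  rewrite -(@ler_pXn2r _ 2)// ?nnegrE ?mulr_ge0 ?(ltW a0)//.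
  by rewrite expr1n exprMn a2 real_normK ?num_real//; lra.
have : 0 <= a * (`|t| - 1) ^+ 2 by rewrite mulr_ge0 ?sqr_ge0// ltW.
have -> : a * (`|t| - 1) ^+ 2 = a * (1 + t ^+ 2) - 2 * (a * `|t|).
  by rewrite sqrrB real_normK ?num_real//; ring.
lra.
Qed.

(* An upper bound on E (1 + t^2) for a standard normal t, by way of
   1 + t^2 <= 4 exp (t^2 / 4). *)
Definition gaussian_weight : R := 4 * (normal_peak 1 / normal_peak (Num.sqrt 2)).

Lemma gaussian_weight_ge0 : 0 <= gaussian_weight.
Proof. by rewrite /gaussian_weight mulr_ge0// divr_ge0// normal_peak_ge0. Qed.

Lemma integral_gaussian_weight (a : R) : 0 <= a ->
  (\int[normal_prob 0 1]_t (a * (4 * expR (t ^+ 2 / 4)))%:E =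
   (a * gaussian_weight)%:E)%E.
Proof.
move=> a0; have mh : measurable_fun [set: R] (fun t : R => a * (4 * expR (t ^+ 2 / 4))).
  apply: measurable_funM => //; apply: measurable_funM => //.
  apply: measurableT_comp => //; apply: measurable_funM => //.
rewrite normal_prob_integral//; last first.
- by move=> t; rewrite lee_fin mulr_ge0// mulr_ge0// expR_ge0.
- exact/measurable_EFinP.
have s20 : Num.sqrt 2 != 0 :> R by rewrite lt0r_neq0// sqrtr_gt0.
have p0 : normal_peak (Num.sqrt 2) != 0 :> R by rewrite lt0r_neq0// normal_peak_gt0.
(* The factor exp (t^2 / 4) turns the density of N(0, 1) into a multiple of that of N(0, 2). *)
have E (t : R) : (a * (4 * expR (t ^+ 2 / 4))) * normal_pdf 0 1 t =
    (a * gaussian_weight) * normal_pdf 0 (Num.sqrt 2) t.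
  rewrite !normal_pdfE// /gaussian_weight /normal_fun sqr_sqrtr// expr1n !subr0.
  have -> : expR (- t ^+ 2 / (2 *+ 2)) = expR (t ^+ 2 / 4) * expR (- t ^+ 2 / 2).
    by rewrite -expRD; congr expR; field.
  by field.
under eq_integral do rewrite -EFinM E EFinM.
rewrite ge0_integralZl//=.
- by rewrite integral_normal_pdf mule1.
- by apply/measurable_EFinP; exact: measurable_normal_pdf.
- by move=> x _; rewrite lee_fin normal_pdf_ge0.
- by rewrite lee_fin mulr_ge0// gaussian_weight_ge0.
Qed.

End bounds.

Section sketch_of_weights.
Context {R : realType} {N k n : nat}.
Notation RT := (measurableTypeR R).
Variable G : 'I_N -> 'M[R]_(k, n).

Definition combination (v : 'rV[R]_N) : 'M[R]_(k, n) := \sum_i v ord0 i *: G i.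

Lemma measurable_combination :
  measurable_fun [set: 'M[RT]_(1, N)] (combination : 'M[RT]_(1, N) -> 'M[RT]_(k, n)).
Proof.
apply: measurable_fun_entries => i j.
rewrite [X in measurable_fun _ X](_ : _ =
    (fun v : 'M[RT]_(1, N) => \sum_(e < N) v ord0 e * G e i j)); last first.
  apply/funext => v; rewrite /combination summxE.
  by apply: eq_bigr => e _; rewrite mxE.
apply: measurable_sum => e; apply: measurable_funM => //.
exact: measurable_entry.
Qed.

(** The weight t of slot [e0] is unbounded, so the shift by t f is not uniformly small. The distance
    is bounded for each t, with growth 1 + t^2, and then averaged over t. *)
Lemma gaussian_mixture_tv d1 d0 (Y1 : measurableType d1) (Y0 : measurableType d0)
    (nu1 : {measure set Y1 -> \bar R}) (nu0 : {measure set Y0 -> \bar R})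
    (v1 : 'I_N -> Y1 -> RT) (v0 : 'I_N -> Y0 -> RT)
    (D : pred 'I_N) (e0 : 'I_N) (f : 'I_N -> R) (m s Q : R) :
  s != 0 -> 0 < Q -> ~~ D e0 ->
  G e0 = \sum_(e | D e) f e *: G e ->
  \sum_(e | D e) f e ^+ 2 <= Q * s ^+ 2 ->
  (forall i, measurable_fun setT (v1 i)) -> (forall i, measurable_fun setT (v0 i)) ->
  (nu1 setT < +oo)%E -> (nu0 setT < +oo)%E ->
  has_coordinate_laws nu1 v1
    (fun e => if e == e0 then normal_prob 0 1 else
              if D e then normal_prob m s else \d_(0 : RT)) ->
  has_coordinate_laws nu0 v0 (fun e => if D e then normal_prob m s else \d_(0 : RT)) ->
  forall S : set 'M[RT]_(k, n), measurable S ->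
  (`| nu1 [set y | S (combination (\row_e v1 e y))] -
      nu0 [set y | S (combination (\row_e v0 e y))] | <=
   (Num.sqrt (2 * Q) * gaussian_weight)%:E)%E.
Proof.
move=> s0 Q0 De0 Gf fQ mv1 mv0 nu1fin nu0fin law1 law0 S mS.
have [d [Y [lam [w [mw lamw shift]]]]] := gaussian_family m s0 N.
pose N0 : probability RT R := normal_prob 0 1.
pose mask (u : 'I_N -> R) : 'rV[R]_N := \row_e (if D e then u e else 0).
pose w0 e y : RT := if D e then w e y else 0.
have mw0 e : measurable_fun setT (w0 e).
  by rewrite /w0; case: (D e).
have lamw0 : has_coordinate_laws lam w0
    (fun e => if D e then normal_prob m s else \d_(0 : RT)).
  have := @has_coordinate_laws_mask R N _ Y lam w
    (fun=> normal_prob m s : probability RT R) D lamw.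
  by move=> H A mA; apply: etrans (H A mA) _; apply: eq_bigr => i _; case: ifP.
pose w1 e (z : RT * Y) : RT := if e == e0 then z.1 else w0 e z.2.
have mw1 e : measurable_fun setT (w1 e).
  rewrite /w1; case: (e == e0); first exact: measurable_fst.
  by apply: measurableT_comp => //; exact: measurable_snd.
have lamw1 : has_coordinate_laws (N0 \x lam)%E w1
    (fun e => if e == e0 then normal_prob 0 1 else
              if D e then normal_prob m s else \d_(0 : RT)).
  pose mu e := if D e then normal_prob m s : probability RT R
               else dirac (0 : RT) : probability RT R.
  have H0 : has_coordinate_laws lam w0 (fun e => mu e).
    move=> A mA; apply: etrans (lamw0 A mA) _; apply: eq_bigr => i _.
    by rewrite /mu; case: ifP.
  have := @has_coordinate_laws_update R N _ Y lam w0 mu N0 e0 mw0 H0.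
  move=> H A mA; apply: etrans (H A mA) _; apply: eq_bigr => i _.
  by case: ifP => // _; rewrite /mu; case: ifP.
have mcS : measurable (combination @^-1` S : set 'M[RT]_(1, N)).
  by rewrite -[X in measurable X]setTI; exact: measurable_combination.
have lamfin : (lam setT < +oo)%E by rewrite probability_setT ltry.
(* Only the probabilities of boxes are known for the given spaces; they determine the law of the
   weight vector, which permits the passage to the model spaces. *)
have -> : nu0 [set y | S (combination (\row_e v0 e y))] =
    lam [set y | S (combination (mask (w^~ y)))].
  exact: (coordinate_law_unique mv0 mw0 nu0fin law0 lamw0 mcS).
have -> : nu1 [set y | S (combination (\row_e v1 e y))] =
    (N0 \x lam)%E [set z | S (combination (\row_e w1 e z))].
  exact: (coordinate_law_unique mv1 mw1 nu1fin law1 lamw1 mcS).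
set B := [set y | S (combination (mask (w^~ y)))].
set C := [set z | S (combination (\row_e w1 e z))].
have mB : measurable B.
  rewrite -[X in measurable X]setTI; apply: (measurableT_comp measurable_combination) => //.
  exact: (measurable_row mw0).
have mC : measurable C.
  rewrite -[X in measurable X]setTI; apply: (measurableT_comp measurable_combination) => //.
  exact: (measurable_row mw1).
have mmask : measurable_fun [set: 'M[RT]_(1, N)]
    (fun v : 'M[RT]_(1, N) => combination (\row_e (if D e then v ord0 e else 0)) : 'M[RT]_(k, n)).
  apply: (measurableT_comp measurable_combination) => //.
  apply: (@measurable_row R N _ 'M[RT]_(1, N) (fun e v => if D e then v ord0 e else 0)) => e.
  by case: (D e) => //; exact: measurable_entry.
have mS' : measurable [set v : 'M[RT]_(1, N) |
    S (combination (\row_e (if D e then v ord0 e else 0)))].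
  by rewrite -[X in measurable X]setTI; exact: mmask.
(* In the section at t, the term t G(e0) is rewritten as t times the flow and merged with the other
   weights. *)
have sectionE t : xsection C t =
    [set y | S (combination (mask (fun e => w e y + t * f e)))].
  suff H y : combination (\row_e w1 e (t, y)) =
      combination (mask (fun e => w e y + t * f e)).
    by apply/seteqP; split=> y; rewrite /xsection /C /= inE/= H.
  transitivity (\sum_e w1 e (t, y) *: G e); first by apply: eq_bigr => e _; rewrite mxE.
  transitivity (\sum_e (if D e then w e y + t * f e else 0) *: G e); last first.
    by apply: eq_bigr => e _; rewrite mxE.
  transitivity (\sum_(e | D e) (w e y + t * f e) *: G e); last first.
    rewrite big_mkcond/=; apply: eq_bigr => e _.
    by case: ifP => //; rewrite scale0r.
  rewrite (bigD1 e0)//= /w1 eqxx/= Gf scaler_sumr.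
  have -> : \sum_(e | e != e0) (if e == e0 then t else w0 e y) *: G e =
      \sum_(e | D e) w e y *: G e.
    rewrite [RHS]big_mkcond/= [LHS]big_mkcond/=; apply: eq_bigr => e _.
    rewrite /w0; case: eqP => [->|_]/=; first by rewrite (negbTE De0).
    by case: ifP => // _; rewrite scale0r.
  rewrite -big_split/=; apply: eq_bigr => e De.
  by rewrite scalerA -scalerDl addrC.
(* Given the weight t of slot e0, the other weights are in effect shifted by
   t f, and so are their means. *)
have close t : (`|lam (xsection C t) - lam B| <= (Num.sqrt (2 * Q) * (1 + t ^+ 2))%:E)%E.
  pose g e := if D e then t * f e else 0.
  have [lamg [lamgw chi]] := shift g.
  have -> : lam (xsection C t) = lamg B.
    have mwg e : measurable_fun setT (fun y => w e y + g e : RT).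
      by apply: measurable_funD => //; exact: mw.
    have lawg : has_coordinate_laws lam (fun e y => w e y + g e : RT)
        (fun e => normal_prob (m + g e) s).
      move=> A mA; have mA' e : measurable [set x : RT | A e (x + g e)].
        rewrite -[X in measurable X]setTI.
        have : measurable_fun [set: RT] (fun x : RT => x + g e : RT) by exact: measurable_funD.
        by apply.
      apply: etrans (lamw _ mA') _; apply: eq_bigr => e _.
      exact: normal_prob_shift.
    rewrite sectionE.
    have := coordinate_law_unique mwg mw lamfin lawg lamgw mS'.
    have E1 : [set y | S (combination (mask (fun e => w e y + t * f e)))] =
        [set y | S (combination (\row_e (if D e then (\row_i (w i y + g i) : 'rV_N) ord0 e else 0)))].
      have M y : mask (fun e => w e y + t * f e) =
          \row_e (if D e then (\row_i (w i y + g i) : 'rV_N) ord0 e else 0).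
        by apply/rowP => e; rewrite !mxE /g; case: ifP.
      by apply/seteqP; split=> y /=; rewrite M.
    have E2 : B = [set y | S (combination (\row_e (if D e then (\row_i (w i y) : 'rV_N) ord0 e else 0)))].
      have M y : mask (w^~ y) =
          \row_e (if D e then (\row_i w i y : 'rV_N) ord0 e else 0).
        by apply/rowP => e; rewrite !mxE.
      by apply/seteqP; split=> y; rewrite /B/= M.
    by rewrite E1 E2; apply.
  apply: chi_square_tv_le => //.
  have [L [mL L0 LE Lc]] := chi; exists L; split=> //.
  apply: (le_trans Lc); rewrite lee_fin ler_expR.
  rewrite ler_pdivrMr ?exprn_even_gt0//= -mulrA.
  have -> : \sum_i g i ^+ 2 = t ^+ 2 * \sum_(e | D e) f e ^+ 2.
    rewrite (bigID D)/= [X in _ + X]big1 ?addr0; last first.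
      by move=> e /negbTE De; rewrite /g De expr0n.
    by rewrite mulr_sumr; apply: eq_bigr => e De; rewrite /g De exprMn.
  by rewrite ler_wpM2l// sqr_ge0.
pose h t := lam (xsection C t).
have mh : measurable_fun [set: RT] h by exact: measurable_fun_xsection.
have a0 : 0 <= Num.sqrt (2 * Q) by exact: sqrtr_ge0.
pose g t : R := Num.sqrt (2 * Q) * (4 * expR (t ^+ 2 / 4)).
have g0 t : 0 <= g t by rewrite mulr_ge0// mulr_ge0// expR_ge0.
have gE t : Num.sqrt (2 * Q) * (1 + t ^+ 2) <= g t.
  rewrite ler_wpM2l//; have := expR_ge1Dx (t ^+ 2 / 4); have := sqr_ge0 t; lra.
have mg : measurable_fun [set: RT] (EFin \o g).
  apply/measurable_EFinP; apply: measurable_funM => //; apply: measurable_funM => //.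
  apply: measurableT_comp => //; apply: measurable_funM => //.
have intg : (\int[N0]_t (g t)%:E = (Num.sqrt (2 * Q) * gaussian_weight)%:E)%E.
  exact: integral_gaussian_weight.
have prodE : (N0 \x lam)%E C = (\int[N0]_t h t)%E by [].
have intb : (\int[N0]_t (cst (lam B)) t = lam B)%E.
  rewrite integral_cst// [X in (_ * X)%E](_ : _ = 1%E) ?mule1//; exact: probability_setT.
have hfin t : h t \is a fin_num.
  by apply: fin_num_measure; exact: measurable_xsection.
have bfin : lam B \is a fin_num by exact: fin_num_measure.
have b0 : (0 <= lam B)%E by exact: measure_ge0.
have h0 t : (0 <= h t)%E by exact: measure_ge0.
(* The distance is split into two one-sided bounds between nonnegative functions, which are
   integrated separately. *)
have hclose t : (h t <= lam B + (g t)%:E)%E /\ (lam B <= h t + (g t)%:E)%E.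
  have := le_trans (close t) (_ : _ <= (g t)%:E)%E; rewrite lee_fin => /(_ (gE t)).
  rewrite -/(h t) -(fineK (hfin t)) -(fineK bfin) -EFinB -!EFinD !lee_fin.
  rewrite ler_norml => /andP[H1 H2]; split; lra.
have I1 : (\int[N0]_t h t <= lam B + (Num.sqrt (2 * Q) * gaussian_weight)%:E)%E.
  rewrite -[in leRHS]intb -intg -ge0_integralD//; last by move=> t _; rewrite lee_fin.
  apply: ge0_le_integral => //.
  - exact: emeasurable_funD.
  - by move=> t _; exact: (hclose t).1.
have I2 : (lam B <= \int[N0]_t h t + (Num.sqrt (2 * Q) * gaussian_weight)%:E)%E.
  rewrite -[in leLHS]intb -intg -ge0_integralD//; last by move=> t _; rewrite lee_fin.
  apply: ge0_le_integral => //.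
  - exact: emeasurable_funD.
  - by move=> t _; exact: (hclose t).2.
pose NL : probability (RT * Y)%type R := (N0 \x lam)%E.
have Cfin : (N0 \x lam)%E C \is a fin_num by exact: (fin_num_measure NL).
move: I1 I2; rewrite -prodE -(fineK Cfin) -(fineK bfin) -EFinB -!EFinD !lee_fin => I1 I2.
by rewrite ler_norml; apply/andP; split; lra.
Qed.

End sketch_of_weights.

(** * The sketch of the hard distribution *)

(** The ends lie in blocks 0 and h of a cycle of 2 h blocks; for h >= 3 these are neither equal nor
    adjacent. *)
Lemma crossing_not_non_crossing (n s l h : nat) (tl hd : 'I_('C(n, 2)) -> 'I_n) p e :
  (0 < s)%N -> (3 <= h)%N -> l = (2 * h)%N -> n = (s * l)%N ->
  crossing tl hd p e -> ~~ non_crossing s l tl hd p e.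
Proof.
move=> s0 h3 lE nE ce.
have blockE (j : 'I_n) i : p j \in block s p i -> (j %/ s)%N = i.
  move=> /imsetP[j']; rewrite inE => /andP[ji ji'] /perm_inj ->.
  by apply/eqP; rewrite eqn_leq leq_divRL// mulnC ji andbT -ltnS ltn_divLR// mulSn addnC mulnC.
move: ce => /existsP[i /existsP[j /and3P[/eqP i0 /eqP j0 /eqP tlhd]]].
have jh : (j %/ s)%N = h.
  by rewrite j0 nE lE mulnCA mul2n doubleK mulKn.
have i00 : (i %/ s)%N = 0%N by rewrite i0 div0n.
have nbr (x y : 'I_n) b : x = i /\ y = j \/ x = j /\ y = i ->
    p x \in block s p b -> (p y \in block s p b) || (p y \in block s p (b.+1 %% l)) -> False.
  move=> xy /blockE xb /orP[/blockE yb|/blockE yb]; case: xy => -[? ?]; subst x y.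
  - by move: h3; rewrite -jh yb -xb i00.
  - by move: h3; rewrite -jh xb -yb i00.
  - move: yb; rewrite jh -xb i00 modn_small; last by rewrite lE; lia.
    by move=> h1; move: h3; rewrite h1.
  - by move: yb; rewrite i00 -xb jh modn_small// lE; lia.
have tlx : exists x y, [/\ tl e = p x, hd e = p y & x = i /\ y = j \/ x = j /\ y = i].
  have := congr1 (fun A : {set _} => tl e \in A) tlhd; rewrite !inE eqxx/= => /esym/orP[] /eqP tle.
    have := congr1 (fun A : {set _} => p j \in A) tlhd; rewrite !inE eqxx orbT => /orP[]/eqP pj; last first.
      by exists i, j; split=> //; left.
    move: pj; rewrite tle => /perm_inj ji; move: h3; rewrite -jh ji i00//.
  have := congr1 (fun A : {set _} => p i \in A) tlhd; rewrite !inE eqxx => /orP[]/eqP pj; last first.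
    by exists j, i; split=> //; right.
  move: pj; rewrite tle => /perm_inj ji; move: h3; rewrite -jh -ji i00//.
have [x [y [tlE hdE xy]]] := tlx.
apply/negP => /existsP[b]; rewrite tlE hdE => /or3P[]/andP[H1 H2].
- by apply: (nbr _ _ _ xy H1); rewrite H2.
- by apply: (nbr _ _ _ xy H1); rewrite H2 orbT.
- apply: (nbr y x _ _ H1); last by rewrite H2 orbT.
  by case: xy => -[-> ->]; [right|left].
Qed.

Section sketch_laws.
Context {R : realType} (n s l k : nat).
Variables (tl hd : 'I_('C(n, 2)) -> 'I_n) (Phi : 'M[R]_(k, 'C(n, 2))).
Context d (Omega : measurableType d) (P : probability Omega R).
Variables (pi : {RV P >-> 'S_n}) (yes : {RV P >-> bool}).
Variable W : 'I_('C(n, 2)) -> {RV P >-> measurableTypeR R}.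
Hypothesis tl_hd : forall e, tl e != hd e.
Hypothesis hard : hard_distribution s l tl hd pi yes W.
Notation RT := (measurableTypeR R).

Let slot_mx e : 'M[R]_(k, n) :=
  \matrix_(i, u) (Phi i e * ((u == hd e)%:R - (u == tl e)%:R)).

(** Absent slots get weight 0, which makes the sketch one fixed linear combination of the slot
    sketches whatever the graph. *)
Definition slot_weight p b e (x : Omega) : RT :=
  if present s l tl hd p b e then W e x else 0.

Lemma measurable_slot_weight p b e : measurable_fun setT (slot_weight p b e).
Proof. by rewrite /slot_weight; case: (present _ _ _ _ _ _ _). Qed.

Lemma sketchE p b x : given pi yes p b x ->
  sketch s l tl hd pi yes W Phi x = combination slot_mx (\row_e slot_weight p b e x).
Proof.
move=> [pix yesx]; rewrite /sketch pix yesx; apply/matrixP => i u.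
rewrite /combination summxE mxE; apply: eq_bigr => e _.
rewrite !mxE /slot_weight; case: ifP => _; last by rewrite mulr0 mul0r.
rewrite mulrCA; congr (_ * _).
case: (eqVneq u (hd e)) => [->|_].
  by rewrite eq_sym (negbTE (tl_hd e)) subr0 mulr1.
have f0 : false%:R = 0 :> R by []; have t1 : true%:R = 1 :> R by [].
by case: eqP => _; rewrite f0 ?t1 ?subrr ?sub0r ?mulr0 ?mulrN1.
Qed.

Lemma measurable_given p b : measurable (given pi yes p b).
Proof.
have -> : given pi yes p b = pi @^-1` [set p] `&` yes @^-1` [set b] by [].
by apply: measurableI; rewrite -[X in measurable X]setTI; apply: measurable_funPT.
Qed.

Lemma given_gt0 p b : exists2 c : R, 0 < c & P (given pi yes p b) = c%:E.
Proof.
have [unif coin _] := hard.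
have mpi : measurable [set x | pi x = p].
  rewrite -[X in measurable X]setTI.
  exact: (measurable_funPT pi measurableT [set p] I).
have mt := measurable_given p true; have mf := measurable_given p false.
have Ep : P [set x | pi x = p] = (P (given pi yes p true) + P (given pi yes p false))%E.
  rewrite -measureU//.
    congr (P _); apply/seteqP; split=> x /= => [pix|[[]|[]]//].
    by rewrite /given/=; case: (yes x); [left|right].
  by apply/seteqP; split=> x //= -[[_ +] [_]] => ->.
have := coin p; rewrite /cond_prob unif.
have -> : [set x | yes x] `&` [set x | pi x = p] = given pi yes p true.
  by apply/seteqP; split=> x /= -[].
move: Ep; rewrite unif -(fineK (fin_num_measure P _ mt)) -(fineK (fin_num_measure P _ mf)).
set x := fine _; set y := fine _.
have n0 : 0 < n`!%:R :> R by rewrite ltr0n fact_gt0.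
rewrite -EFinD => -[exy]; rewrite inver ?invr_eq0 ?gt_eqF//.
rewrite -EFinM invrK => -[ex].
have xE : x = n`!%:R^-1 / 2 by rewrite -ex; field; exact: lt0r_neq0.
have yE : y = n`!%:R^-1 / 2.
  by move: exy; rewrite xE; lra.
by case: b; [exists x; first rewrite xE|exists y; first rewrite yE];
  rewrite ?divr_gt0 ?invr_gt0//= fineK// fin_num_measure.
Qed.

(** Restricting P to an event of positive probability and rescaling gives a measure, to which
    integration and uniqueness results apply. *)
Lemma cond_given_measure p b : exists nu : {measure set Omega -> \bar R},
  [/\ forall A, cond_prob P (given pi yes p b) A = nu A, nu setT = 1%E &
      has_coordinate_laws nu (slot_weight p b)
        (fun e => if present s l tl hd p b e then weight_law tl hd p e else \d_(0 : RT))].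
Proof.
have [c c0 Pc] := given_gt0 p b.
have ci : 0 <= c^-1 by rewrite invr_ge0 ltW.
exists (mscale (NngNum ci) (mrestr P (measurable_given p b))).
have nuE A : cond_prob P (given pi yes p b) A =
    mscale (NngNum ci) (mrestr P (measurable_given p b)) A.
  by rewrite /cond_prob /mscale/= /mrestr Pc inver gt_eqF// muleC.
split => //.
  apply: etrans (esym (nuE _)) _.
  by rewrite /cond_prob setTI Pc inver gt_eqF// -EFinM divff// gt_eqF.
move=> A mA; apply: etrans (esym (nuE _)) _.
rewrite (bigID (present s l tl hd p b))/=.
(* If some absent slot has a condition that excludes 0, both sides vanish; otherwise the absent
   slots contribute factors 1 and independence is assumed for the rest. *)
have [absent|/existsNP[e /not_implyP[eabs eA]]] :=
    pselect (forall e, ~~ present s l tl hd p b e -> A e 0).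
  rewrite [X in (_ * X)%E]big1 ?mule1; last first.
    by move=> e ea; rewrite (negbTE ea) diracE mem_set//; exact: absent.
  have [_ _ indep] := hard.
  have := indep p b A mA.
  have -> : [set x | forall e, present s l tl hd p b e -> A e (W e x)] =
      [set x | forall e, A e (slot_weight p b e x)].
    apply/seteqP; split=> x /= Hx e.
      by rewrite /slot_weight; case: ifPn => [/Hx//|/absent].
    by move=> ep; have := Hx e; rewrite /slot_weight ep.
  by move=> ->; apply: eq_bigr => e ->.
rewrite [X in (_ * X)%E](bigD1 e)//= (negbTE eabs) diracE memNset// mul0e mule0.
have -> : [set x | forall e, A e (slot_weight p b e x)] = set0.
  by apply/seteqP; split=> x //= /(_ e); rewrite /slot_weight (negbTE eabs).
by rewrite /cond_prob set0I measure0 mul0e.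
Qed.

Lemma sketch_law_measure p b : exists nu : {measure set Omega -> \bar R},
  [/\ nu setT = 1%E,
      has_coordinate_laws nu (slot_weight p b)
        (fun e => if present s l tl hd p b e then weight_law tl hd p e else \d_(0 : RT)) &
      forall S, sketch_law s l tl hd pi yes W Phi p b S =
        nu [set x | S (combination slot_mx (\row_e slot_weight p b e x))]].
Proof.
have [nu [nuE nuT law]] := cond_given_measure p b; exists nu; split => // S.
rewrite -nuE /sketch_law /pushforward /cond_prob.
congr (P _ / _)%E; apply/seteqP; split=> x /= [HS gx]; split=> //.
  by rewrite -(sketchE gx).
by rewrite (sketchE gx).
Qed.

Lemma measurable_slot_event p b (S : set 'M[RT]_(k, n)) : measurable S ->
  measurable [set x | S (combination slot_mx (\row_e slot_weight p b e x))].
Proof.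
move=> mS; rewrite -[X in measurable X]setTI.
apply: (measurableT_comp (measurable_combination slot_mx)) => //.
by apply: measurable_row => e; exact: measurable_slot_weight.
Qed.

Lemma tv_sketch_ge0_le1 p :
  (0 <= tv_distance (sketch_law s l tl hd pi yes W Phi p true)
                    (sketch_law s l tl hd pi yes W Phi p false) <= 1)%E.
Proof.
have [nu1 [nu1T _ nu1E]] := sketch_law_measure p true.
have [nu0 [nu0T _ nu0E]] := sketch_law_measure p false.
have le1 (nu : {measure set Omega -> \bar R}) A : nu setT = 1%E -> measurable A ->
    exists2 r : R, nu A = r%:E & 0 <= r <= 1.
  move=> nuT mA; have nuA0 : (0 <= nu A)%E by exact: measure_ge0.
  have nuA1 : (nu A <= 1)%E by rewrite -nuT le_measure// inE.
  have fin : nu A \is a fin_num by rewrite ge0_fin_numE// (le_lt_trans nuA1)// ltry.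
  by exists (fine (nu A)); rewrite ?fineK// -!lee_fin fineK// nuA0.
apply/andP; split.
  apply: (@le_trans _ _ `|sketch_law s l tl hd pi yes W Phi p true set0 -
    sketch_law s l tl hd pi yes W Phi p false set0|%E); first exact: abse_ge0.
  by apply: ereal_sup_ubound; exists set0.
apply: ge_ereal_sup => _ [S mS <-]; rewrite nu1E nu0E.
have [r1 -> /andP[r10 r11]] := le1 _ _ nu1T (measurable_slot_event p true mS).
have [r0 -> /andP[r00 r01]] := le1 _ _ nu0T (measurable_slot_event p false mS).
by rewrite -EFinB lee_fin ler_norml; apply/andP; split; lra.
Qed.

Let sigma : R := Num.sqrt (n%:R `^ (4 / 5) / ln n%:R).

Lemma sketch_tv_le p e0 (f : 'I_('C(n, 2)) -> R) (Q : R) :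
  sigma != 0 -> 0 < Q ->
  (forall e, crossing tl hd p e = (e == e0)) -> ~~ non_crossing s l tl hd p e0 ->
  slot_row tl hd Phi e0 =
    \sum_(e | non_crossing s l tl hd p e) f e *: slot_row tl hd Phi e ->
  \sum_(e | non_crossing s l tl hd p e) f e ^+ 2 <= Q * sigma ^+ 2 ->
  (tv_distance (sketch_law s l tl hd pi yes W Phi p true)
               (sketch_law s l tl hd pi yes W Phi p false) <=
   (Num.sqrt (2 * Q) * gaussian_weight)%:E)%E.
Proof.
move=> sigma0 Q0 cr ncr0 rowE fQ.
have [nu1 [nu1T law1 nu1E]] := sketch_law_measure p true.
have [nu0 [nu0T law0 nu0E]] := sketch_law_measure p false.
have G0 : slot_mx e0 = \sum_(e | non_crossing s l tl hd p e) f e *: slot_mx e.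
  apply: (can_inj mxvecK); rewrite linear_sum/= -[LHS]/(slot_row tl hd Phi e0) rowE.
  by apply: eq_bigr => e _; rewrite linearZ.
rewrite /tv_distance; apply: ge_ereal_sup => _ [S mS <-].
rewrite nu1E nu0E.
apply: (gaussian_mixture_tv sigma0 Q0 ncr0 G0 fQ) => //;
  try exact: measurable_slot_weight; rewrite ?nu1T ?nu0T ?ltry//.
- move=> A mA; apply: etrans (law1 A mA) _; apply: eq_bigr => e _.
  by rewrite /present /weight_law cr; case: eqP => [->|_]; rewrite ?orbT ?orbF.
- move=> A mA; apply: etrans (law0 A mA) _; apply: eq_bigr => e _.
  rewrite /present /weight_law cr orbF; case: eqP => [->|_//].
  by rewrite (negbTE ncr0).
Qed.

End sketch_laws.

(** * Averaging over the random permutation *)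

Section averaging.
Context {R : realType} (n s l k : nat).
Variables (tl hd : 'I_('C(n, 2)) -> 'I_n) (Phi : 'M[R]_(k, 'C(n, 2))).
Context d (Omega : measurableType d) (P : probability Omega R).
Variables (pi : {RV P >-> 'S_n}) (yes : {RV P >-> bool}).
Variable W : 'I_('C(n, 2)) -> {RV P >-> measurableTypeR R}.
Hypothesis hard : hard_distribution s l tl hd pi yes W.

Lemma measurable_permutation_event p : measurable [set x | pi x = p].
Proof.
rewrite -[X in measurable X]setTI.
exact: (measurable_funPT pi measurableT [set p] I).
Qed.

Lemma integral_permutation_le (F : 'S_n -> \bar R) (B : {set 'S_n}) (a : R) :
  0 <= a -> (forall p, 0 <= F p <= 1)%E -> (forall p, p \notin B -> F p <= a%:E)%E ->
  (\int[P]_x F (pi x) <= (a + #|B|%:R / n`!%:R)%:E)%E.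
Proof.
move=> a0 F01 FB; have [unif _ _] := hard.
pose ind p (x : Omega) : \bar R := (\1_[set x | pi x = p] x)%:E.
have mind p : measurable_fun [set: Omega] (ind p).
  by apply/measurable_EFinP; exact/measurable_indic/measurable_permutation_event.
have ind0 p x : (0 <= ind p x)%E by rewrite lee_fin indicE.
have mF : measurable_fun [set: Omega] (fun x => F (pi x)).
  by apply: (measurableT_comp (f := F)) => // _ Y _.
have msum : measurable_fun [set: Omega] (fun x => \sum_(p in B) ind p x)%E.
  rewrite (_ : (fun x => _) = (fun x => \sum_(p <- enum B) ind p x)%E).
    exact: emeasurable_sum.
  by apply/funext => x; rewrite big_enum.
apply: (@le_trans _ _ (\int[P]_x (a%:E + \sum_(p in B) ind p x))%E).
  apply: ge0_le_integral => //.
  - by move=> x _; case/andP: (F01 (pi x)).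
  - exact: emeasurable_funD.
  - move=> x _; have [pB|pB] := boolP (pi x \in B); last first.
      by apply: (le_trans (FB _ pB)); rewrite leeDl// sume_ge0.
    case/andP: (F01 (pi x)) => _ F1; apply: (le_trans F1).
    rewrite (bigD1 (pi x))//= {1}/ind indicE mem_set//= addeCA leeDl//.
    by rewrite adde_ge0 ?lee_fin// sume_ge0.
rewrite ge0_integralD//; last first.
  by move=> x _; rewrite sume_ge0.
rewrite integral_cst// [X in (_ * X)%E](_ : _ = 1%E) ?mule1; last exact: probability_setT.
rewrite EFinD leeD2l//.
have -> : (\int[P]_x (\sum_(p in B) ind p x) = \sum_(p in B) (n`!%:R^-1)%:E)%E.
  transitivity (\int[P]_x (\sum_(p <- enum B) ind p x))%E.
    by apply: eq_integral => x _; rewrite big_enum.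
  rewrite ge0_integral_sum// big_enum/=; apply: eq_bigr => p _.
  by rewrite integral_indic//= ?setIT ?unif//; exact: measurable_permutation_event.
by rewrite sumEFin sumr_const mulr_natl.
Qed.

End averaging.

(** * Rates in terms of t = n^(1/40) *)

Section asymptotics.
Context {R : realType}.

Lemma ln_root_le (n : nat) (t : R) : 0 < t -> t ^+ 40 = n%:R -> ln n%:R <= 40 * t.
Proof.
move=> t0 tn; rewrite -tn lnXn// -[leLHS]mulr_natl ler_wpM2l//.
have := @le_ln1Dx R (t - 1); rewrite (_ : 1 + (t - 1) = t); last by ring.
by move=> H; apply: (le_trans (H _)); lra.
Qed.

(** With L <= 40 t the radicand is at most 2 * 36 * 40 t^-3 = 2880 t^-3 <= 54^2 t^-2. *)
Lemma sqrt_decay (t L : R) : 1 <= t -> L <= 40 * t ->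
  Num.sqrt (2 * (36 * t ^- 4 * L)) <= 54 / t.
Proof.
move=> t1 Lt; have t0 : 0 < t by lra.
have -> : 54 / t = Num.sqrt ((54 / t) ^+ 2).
  by rewrite sqrtr_sqr ger0_norm// divr_ge0// ltW.
rewrite ler_wsqrtr//.
apply: (@le_trans _ _ (2 * (36 * t ^- 4 * (40 * t)))).
  by rewrite !ler_wpM2l// ?mulr_ge0// invr_ge0 exprn_ge0// ltW.
have -> : 2 * (36 * t ^- 4 * (40 * t)) = 2880 * t ^- 2 / t by field; exact: lt0r_neq0.
have -> : (54 / t) ^+ 2 = 2916 * t ^- 2 by field; exact: lt0r_neq0.
have t2 : 0 < t ^- 2 by rewrite invr_gt0 exprn_gt0.
have : t ^- 2 / t <= t ^- 2 by rewrite ler_pdivrMr// ler_peMr// ltW.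
lra.
Qed.

Lemma root_le (x y : R) : 0 <= x -> 0 <= y -> x <= y ^+ 40 -> x `^ (1 / 40) <= y.
Proof.
move=> x0 y0 xy; apply: (@le_trans _ _ ((y ^+ 40) `^ (1 / 40))).
  by apply: ge0_ler_powR; rewrite ?nnegrE// exprn_ge0.
rewrite -powR_mulrn// -powRrM (_ : 40%:R * (1 / 40) = 1 :> R) ?powRr1//.
by field.
Qed.

Lemma cvg_inv_root (K : R) :
  (fun n : nat => K / (n.+1%:R `^ (1 / 40))) @ \oo --> (0 : R).
Proof.
have h : (fun n : nat => (n.+1%:R `^ (1 / 40))^-1 : R) @ \oo --> (0 : R).
  apply/gtr0_cvgV0; first by near=> n; rewrite powR_gt0.
  apply/cvgryPge => A; near=> n.
  have An : `|A| ^+ 40 <= n.+1%:R.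
    apply: (@le_trans _ _ n%:R); last by rewrite ler_nat.
    by near: n; exact: nbhs_infty_ger.
  apply: (le_trans (ler_norm A)).
  apply: (@le_trans _ _ ((`|A| ^+ 40) `^ (1 / 40))); last first.
    by apply: ge0_ler_powR; rewrite ?nnegrE// exprn_ge0.
  rewrite -powR_mulrn// -powRrM (_ : 40%:R * (1 / 40) = 1 :> R) ?powRr1//.
  by field.
have : (fun n : nat => K * (n.+1%:R `^ (1 / 40))^-1) @ \oo --> K * (0 : R).
  exact: cvgMr.
by rewrite mulr0.
Unshelve. all: by end_near. Qed.

End asymptotics.

Theorem theorem3p19 (R : realType) (eps : R) (heps : 0 < eps) :
  exists r : nat -> R, r @ \oo --> (0 : R) /\
  forall (n s l k : nat) (tl hd : 'I_('C(n, 2)) -> 'I_n)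
    (Phi : 'M[R]_(k, 'C(n, 2)))
    (d : measure_display) (Omega : measurableType d) (P : probability Omega R)
    (pi : {RV P >-> 'S_n}) (yes : {RV P >-> bool})
    (W : 'I_('C(n, 2)) -> {RV P >-> measurableTypeR R}),
  ~~ odd n ->
  s%:R = n%:R `^ (1 / 5) :> R ->
  l%:R = n%:R `^ (4 / 5) :> R ->
  k%:R <= n%:R `^ (1 / 20 - eps) ->
  edge_orientation tl hd ->
  hard_distribution s l tl hd pi yes W ->
  (\int[P]_x tv_distance (sketch_law s l tl hd pi yes W Phi (pi x) true)
                         (sketch_law s l tl hd pi yes W Phi (pi x) false)
    <= (r n)%:E)%E.
Proof.
have [K K0 few] := few_bad_permutations R.
set c := @gaussian_weight R.
have c0 : 0 <= c by exact: gaussian_weight_ge0.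
(* Using n + 1 keeps the denominator positive at n = 0 and costs the factor 2. The summand 1 covers
   the small n, where only the trivial bound on the distance is used. *)
exists (fun n : nat => 2 * (54 * c + K + 1) / (n.+1%:R `^ (1 / 40))).
split; first exact: cvg_inv_root.
move=> n s l k tl hd Phi d Omega P pi yes W n_even sE lE kE orient hard.
have tlhd := orient.1.
have tv01 := tv_sketch_ge0_le1 Phi tlhd hard.
pose t : R := n%:R `^ (1 / 40).
have tX (m : nat) (a : R) : a * 40 = m%:R -> n%:R `^ a = t ^+ m.
  move=> am; rewrite /t -powR_mulrn ?powR_ge0// -powRrM -am.
  by rewrite (_ : 1 / 40 * (a * 40) = a)//; field.
have t_ge0 : 0 <= t by exact: powR_ge0.
have s8 : s%:R = t ^+ 8 by rewrite sE; apply: tX; field.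
have l32 : l%:R = t ^+ 32 by rewrite lE; apply: tX; field.
have n40 : n%:R = t ^+ 40 by rewrite -(tX _ 1) ?powRr1// mul1r.
(* As s and l are natural numbers, the real equations for them become exact: n = s^5 and l = s^4. *)
have nE : n = (s ^ 5)%N.
  by apply/eqP; rewrite -(eqr_nat R) natrX s8 -exprM n40.
have lE' : l = (s ^ 4)%N.
  by apply/eqP; rewrite -(eqr_nat R) natrX s8 -exprM l32.
have r1 : 0 < n.+1%:R `^ (1 / 40) :> R by rewrite powR_gt0.
(* For s < 4 every permutation counts as bad; n <= 3^5 makes the asserted bound at least 1. *)
have [s4|s4] := leqP 4 s; last first.
  apply: (le_trans (@integral_permutation_le R n s l tl hd _ Omega P pi yes W hard _
    [set: 'S_n]%SET 0 _ tv01 _)) => //.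
    by move=> p; rewrite finset.in_setT.
  rewrite lee_fin add0r cardsT card_Sn divff; last by rewrite pnatr_eq0 -lt0n fact_gt0.
  have n2 : n.+1%:R `^ (1 / 40) <= 2 :> R.
    apply: root_le => //; apply: (@le_trans _ _ (2 ^+ 8)); last by rewrite ler_weXn2l// ler1n.
    have n243 : (n <= 3 ^ 5)%N by rewrite nE leq_exp2r.
    by rewrite -natrX ler_nat; lia.
  rewrite ler_pdivlMr// [leLHS]mul1r; apply: (le_trans n2); lra.
have n_gt1 : (1 < n)%N.
  have : (4 ^ 5 <= s ^ 5)%N by rewrite leq_exp2r.
  by rewrite -nE; lia.
have n_ge1 : 1 <= n%:R :> R by rewrite ler1n ltnW.
have t_gt0 : 0 < t by rewrite powR_gt0// ltr0n ltnW.
have t_ge1 : 1 <= t.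
  by rewrite -[leLHS](powRr0 n%:R) ler_powR// divr_ge0.
have kt : k%:R <= t ^+ 2.
  apply: (le_trans kE); rewrite -(tX 2%N (1 / 20)); last by field.
  by rewrite ler_powR//; lra.
have [B cardB flow] := few n s l k tl hd Phi t orient s4 lE' nE n_even t_gt0 (esym s8) kt.
have ln_gt : 0 < ln n%:R :> R by rewrite ln_gt0// ltr1n.
have lnt := ln_root_le t_gt0 (esym n40).
(* The energy 36 t^-4 l of the flow in units of the variance l / ln n. *)
pose Q : R := 36 * t ^- 4 * ln n%:R.
have Q0 : 0 < Q by rewrite !mulr_gt0// invr_gt0 exprn_gt0.
have l_gt0 : 0 < l%:R :> R by rewrite l32 exprn_gt0.
(* Since n is even, so are s and l; thus n / 2 = s (l / 2) is the first position of a block. *)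
have s_even : ~~ odd s by move: n_even; rewrite nE oddX.
have lh : l = (2 * l./2)%N by rewrite mul2n even_halfK// lE' oddX.
have h3 : (3 <= l./2)%N.
  by rewrite geq_half_double lE'; apply: (@leq_trans (4 ^ 4)); rewrite // leq_exp2r.
have nsl : n = (s * l)%N by rewrite nE lE' expnS.
have s0 : (0 < s)%N by exact: leq_trans s4.
have far p : p \notin B ->
    (tv_distance (sketch_law s l tl hd pi yes W Phi p true)
                 (sketch_law s l tl hd pi yes W Phi p false) <= (54 / t * c)%:E)%E.
  move=> pB; have [e0 ce0] := has_crossing orient s0 h3 lh nsl p.
  have [f rowE fle] := flow p e0 pB ce0.
  have sigma2 : Num.sqrt (n%:R `^ (4 / 5) / ln n%:R) ^+ 2 = l%:R / ln n%:R :> R.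
    by rewrite sqr_sqrtr -lE// divr_ge0// ltW.
  apply: (le_trans (@sketch_tv_le R n s l k tl hd Phi _ Omega P pi yes W tlhd hard
    p e0 f Q _ Q0 _ _ rowE _)).
  - by rewrite gt_eqF// sqrtr_gt0 -lE divr_gt0.
  - move=> e; apply/idP/eqP => [ce|->//].
    exact: (crossing_uniq orient s0 h3 lh nsl ce ce0).
  - exact: (crossing_not_non_crossing s0 h3 lh nsl ce0).
  - rewrite sigma2; apply: (le_trans fle).
    by rewrite /Q le_eqVlt; apply/orP; left; apply/eqP; field; rewrite !gt_eqF.
  - by rewrite lee_fin ler_wpM2r// sqrt_decay.
apply: (le_trans (@integral_permutation_le R n s l tl hd _ Omega P pi yes W hard _ B
  (54 / t * c) _ tv01 far)).
  by rewrite mulr_ge0// divr_ge0.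
rewrite lee_fin.
have n0 : 0 < n`!%:R :> R by rewrite ltr0n fact_gt0.
have Bt : #|B|%:R / n`!%:R <= K / t by rewrite ler_pdivrMr.
apply: (@le_trans _ _ ((54 * c + K + 1) / t)).
  apply: (le_trans (lerD (lexx _) Bt)).
  rewrite -(mulrA 54) (mulrC t^-1) mulrA -mulrDl ler_wpM2r ?invr_ge0//.
  by rewrite lerDl.
have n2t : n.+1%:R `^ (1 / 40) <= 2 * t.
  apply: root_le; rewrite ?mulr_ge0// exprMn -n40.
  have : (2 : R) <= 2 ^+ 40 by rewrite ler_eXnr// ler1n.
  rewrite -natr1; nra.
rewrite [leLHS](_ : _ = 2 * (54 * c + K + 1) / (2 * t)); last by field; rewrite gt_eqF.
rewrite ler_wpM2l ?lef_pV2 ?posrE ?mulr_gt0//.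
by rewrite mulr_ge0// addr_ge0// addr_ge0// mulr_ge0.
Qed.
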